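(* Let $r>0$ and $\sigma>0$, let $\mathcal{H}_0=L^2\bigl((0,\infty),dS/S\bigr)$, and let $A^{(0)}$ be the undamped Black--Scholes operator on $\mathcal{H}_0$. The operator $A^{(0)}\colon\mathcal{D}(A^{(0)})\to\mathcal{H}_0$ is a bijection with $\mathsf{\Sigma}(A^{(0)})=[r,\infty)$ and $$\bigl\lVert(A^{(0)})^{-1}\bigr\rVert_{\mathcal{L}(\mathcal{H}_0)}=\frac1r.$$
   Context: $r$ is the risk-free interest rate and $\sigma$ the volatility. The operator $A^{(0)}$ is a closed, densely defined realization on $\mathcal{H}_0$ of $A_{\mathrm{BS}}=\frac12\sigma^2S^2\partial_S^2+rS\partial_S-rI$, defined as follows. Let $Q_0\colon\mathcal{H}_0\to L^2(\mathbb{R})$ be the unitary $(Q_0f)(x)=f(e^x)$, let $\mathcal{F}$ be the unitary Fourier transform on $L^2(\mathbb{R})$, $(\mathcal{F}g)(k)=\frac1{\sqrt{2\pi}}\int_{\mathbb{R}}g(x)e^{-ikx}\,dx$, and let $$\rho_0(k)=-\tfrac12\sigma^2k^2+i\bigl(r-\tfrac12\sigma^2\bigr)k-r,\qquad k\in\mathbb{R}.$$ With $T_{\rho_0}$ multiplication by $\rho_0$ on its maximal domain $\{g\in L^2(\mathbb{R}):\rho_0g\in L^2(\mathbb{R})\}$, $$A^{(0)}=Q_0^{-1}\mathcal{F}^{-1}T_{\rho_0}\mathcal{F}Q_0,\qquad\mathcal{D}(A^{(0)})=Q_0^{-1}\mathcal{F}^{-1}\mathcal{D}(T_{\rho_0})=Q_0^{-1}H^2(\mathbb{R}).$$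 For a closed, densely defined operator $A$, the set of singular values is $\mathsf{\Sigma}(A)=\{\sqrt\lambda:\lambda\in\mathsf{\Lambda}(A^*A)\}$, with $\mathsf{\Lambda}$ the spectrum. (Equivalently: writing $A=UT_sV^*$ with $U,V$ isometries from some $L^2(M,\mu)$ and $T_s$ multiplication by an a.e. positive measurable function $s$, it is the essential range of $s$, together with $0$ if $A$ has nontrivial kernel.) *)

(* Defs.v *)
From HB Require Import structures.
From mathcomp Require Import all_boot all_order all_algebra ring_quotient.
From mathcomp Require Import complex ring measurable_realfun.
From mathcomp Require Import all_classical all_reals all_analysis.
Set Implicit Arguments.
Unset Strict Implicit.
Unset Printing Implicit Defensive.
Import Order.TTheory GRing.Theory Num.Theory.
Import numFieldNormedType.Exports.
Local Open Scope classical_set_scope.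
Local Open Scope complex_scope.
Local Open Scope ring_scope.

Section ComplexFunctions.
Context d (T : measurableType d) (R : realType).
Variable mu : {measure set T -> \bar R}.
Implicit Types f g : T -> R[i].

Definition cmeasurable f : Prop :=
  measurable_fun setT (fun x => complex.Re (f x)) /\
  measurable_fun setT (fun x => complex.Im (f x)).

Definition cintegrable f : Prop :=
  mu.-integrable setT (fun x => (complex.Re (f x))%:E) /\
  mu.-integrable setT (fun x => (complex.Im (f x))%:E).

Definition cintegral f : R[i] :=
  (\int[mu]_x complex.Re (f x))%R +i* (\int[mu]_x complex.Im (f x))%R.

Definition sqmod (z : R[i]) : R := complex.Re z ^+ 2 + complex.Im z ^+ 2.

Definition sq_integrable : {pred T -> R[i]} :=
  mem [set f | cmeasurable f /\ (\int[mu]_x (sqmod (f x))%:E < +oo)%E].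

Lemma sqmod_ge0 z : 0 <= sqmod z.
Proof. by rewrite addr_ge0// sqr_ge0. Qed.

Lemma sqmodM a z : sqmod (a * z) = sqmod a * sqmod z.
Proof. by case: a z => [a b] [c e]; rewrite /sqmod /=; simpc => /=; ring. Qed.

Lemma sqmodD z w : sqmod (z + w) <= 2 * (sqmod z + sqmod w).
Proof.
case: z w => [a b] [c e]; rewrite /sqmod /=.
rewrite -subr_ge0 [leRHS](_ : _ = (a - c) ^+ 2 + (b - e) ^+ 2); last by ring.
by rewrite addr_ge0// sqr_ge0.
Qed.

Lemma measurable_sqmod f : cmeasurable f ->
  measurable_fun setT (fun x => sqmod (f x)).
Proof. by move=> [mr mi]; apply: measurable_funD; apply: measurable_funX. Qed.

Lemma sq_integrable_submod_closed : submod_closed sq_integrable.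
Proof.
split.
  rewrite inE /=; split.
    by split; exact: measurable_cst.
  under eq_integral do rewrite /sqmod /= !expr0n /= addr0.
  by rewrite integral0 ltry.
move=> a f g /set_mem/= [mf lf] /set_mem/= [mg lg].
have mafg : cmeasurable (a *: f + g).
  have eR : (fun x => complex.Re ((a *: f + g) x)) =
      (fun x => complex.Re a * complex.Re (f x) - complex.Im a * complex.Im (f x)
                + complex.Re (g x)).
    apply/funext => x; change ((a *: f + g) x) with (a * f x + g x).
    by case: (a) (f x) (g x) => [? ?] [? ?] [? ?].
  have eI : (fun x => complex.Im ((a *: f + g) x)) =
      (fun x => complex.Re a * complex.Im (f x) + complex.Im a * complex.Re (f x)
                + complex.Im (g x)).
    apply/funext => x; change ((a *: f + g) x) with (a * f x + g x).
    by case: (a) (f x) (g x) => [? ?] [? ?] [? ?].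
  case: mf mg => [mfr mfi] [mgr mgi]; split.
    rewrite eR; apply: measurable_funD => //; apply: measurable_funB.
      by apply: measurable_funM => //; exact: measurable_cst.
    by apply: measurable_funM => //; exact: measurable_cst.
  rewrite eI; apply: measurable_funD => //; apply: measurable_funD.
    by apply: measurable_funM => //; exact: measurable_cst.
  by apply: measurable_funM => //; exact: measurable_cst.
rewrite inE /=; split=> //.
have mEf : measurable_fun setT (fun x => (sqmod (f x))%:E).
  by apply/measurable_EFinP; exact: measurable_sqmod.
have mEg : measurable_fun setT (fun x => (sqmod (g x))%:E).
  by apply/measurable_EFinP; exact: measurable_sqmod.
have mEafg : measurable_fun setT (fun x => (sqmod ((a *: f + g) x))%:E).
  by apply/measurable_EFinP; exact: measurable_sqmod.
have c1 : (0 <= 2 * sqmod a)%R by rewrite mulr_ge0// sqmod_ge0.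
have c2 : (0 <= 2 :> R)%R by [].
apply: (@le_lt_trans _ _ (\int[mu]_x
   ((2 * sqmod a)%:E * (sqmod (f x))%:E + 2%:E * (sqmod (g x))%:E)))%E.
  apply: ge0_le_integral => //.
  - by move=> x ?; rewrite lee_fin sqmod_ge0.
  - by apply: emeasurable_funD; exact: measurable_funeM.
  - move=> x ?; rewrite -!EFinM -EFinD lee_fin.
    change ((a *: f + g) x) with (a * f x + g x).
    by rewrite (le_trans (sqmodD _ _))// sqmodM mulrDr mulrA.
rewrite ge0_integralD//; last 4 first.
- by move=> x ?; rewrite mule_ge0// lee_fin sqmod_ge0.
- exact: measurable_funeM.
- by move=> x ?; rewrite mule_ge0// lee_fin sqmod_ge0.
- exact: measurable_funeM.
rewrite !ge0_integralZl//; try by move=> x ?; rewrite lee_fin sqmod_ge0.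
by rewrite lte_add_pinfty// lte_mul_pinfty.
Qed.

HB.instance Definition _ := GRing.isSubmodClosed.Build _ _ sq_integrable
  sq_integrable_submod_closed.

Record L2fun := MkL2fun { L2fun_val :> T -> R[i] ;
                          L2funP : L2fun_val \in sq_integrable }.
HB.instance Definition _ := [isSub for L2fun_val].
HB.instance Definition _ := [Choice of L2fun by <:].
HB.instance Definition _ := [SubChoice_isSubLmodule of L2fun by <:].

Definition ae_null : {pred L2fun} :=
  mem [set f : L2fun | {ae mu, forall x, f x = 0}].

Lemma ae_null_zmod_closed : zmod_closed ae_null.
Proof.
split; first by rewrite inE /=; exact: aeW.
move=> f g /set_mem/= f0 /set_mem/= g0; rewrite inE /=.
by apply: filterS2 f0 g0 => x fx gx /=; rewrite -[LHS]/(f x - g x) fx gx subr0.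
Qed.

HB.instance Definition _ := GRing.isZmodClosed.Build _ ae_null
  ae_null_zmod_closed.

Definition L2 : Type := Quotient.quot ae_null.
HB.instance Definition _ := GRing.Zmodule.on L2.
HB.instance Definition _ := EqQuotient.on L2.

Local Open Scope quotient_scope.

Definition L2_scale (a : R[i]) (u : L2) : L2 := \pi_L2 (a *: repr u).

Lemma L2_eqP (f g : L2fun) :
  \pi_L2 f = \pi_L2 g <-> {ae mu, forall x, f x = g x}.
Proof.
have eB (x : T) : (f - g) x = f x - g x by [].
split=> [/eqP|fg].
  rewrite -[_ == _]/(_ == _ %[mod Quotient.quot ae_null]) -Quotient.idealrBE.
  move=> /set_mem; apply: filterS => x.
  by move=> /(etrans (esym (eB x)))/eqP; rewrite subr_eq0 => /eqP.
apply/eqP; rewrite -[_ == _]/(_ == _ %[mod Quotient.quot ae_null]).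
rewrite -Quotient.idealrBE; apply/mem_set; apply: filterS fg => x fgx.
by apply: etrans (eB x) _; rewrite fgx subrr.
Qed.

Lemma repr_pi (f : L2fun) : {ae mu, forall x, repr (\pi_L2 f) x = f x}.
Proof. by apply/L2_eqP; rewrite reprK. Qed.

Lemma pi_add (f g : L2fun) : \pi_L2 (f + g) = \pi_L2 f + \pi_L2 g.
Proof. exact: (Quotient.pi_add ae_null). Qed.

Lemma pi_scale a (f : L2fun) : L2_scale a (\pi_L2 f) = \pi_L2 (a *: f).
Proof.
apply/L2_eqP; apply: filterS (repr_pi f) => x e.
exact: (congr1 ( *%R a) e).
Qed.

Lemma L2_scaleA a b u : L2_scale a (L2_scale b u) = L2_scale (a * b) u.
Proof. by rewrite -[u]reprK (pi_scale b) !pi_scale scalerA. Qed.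

Lemma L2_scale1 : left_id 1 L2_scale.
Proof. by move=> u; rewrite -[u]reprK pi_scale scale1r. Qed.

Lemma L2_scaleDr : right_distributive L2_scale +%R.
Proof.
move=> a u v; rewrite -[u]reprK -[v]reprK -pi_add.
by rewrite !pi_scale scalerDr pi_add.
Qed.

Lemma L2_scaleDl u : {morph L2_scale^~ u : a b / a + b}.
Proof. by move=> a b; rewrite -[u]reprK !pi_scale scalerDl pi_add. Qed.

HB.instance Definition _ := GRing.Zmodule_isLmodule.Build R[i] L2
  L2_scaleA L2_scale1 L2_scaleDr L2_scaleDl.

(* The junk value 0 is returned when f is not square integrable. *)
Definition L2class (f : T -> R[i]) : L2 :=
  if insub f is Some g then \pi_L2 (g : L2fun) else 0.

(* An arbitrary representative of the class [u]. *)
Definition rep (u : L2) : T -> R[i] := L2fun_val (repr u).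

Definition L2dot (u v : L2) : R[i] :=
  cintegral (fun x => rep u x * (rep v x)^*%C).

Definition L2norm (u : L2) : R :=
  Num.sqrt (\int[mu]_x sqmod (rep u x))%R.

End ComplexFunctions.
Arguments L2 {d T R} mu.
Arguments L2class {d T R} mu f.

(* A possibly unbounded operator: [op_fun] is only meaningful on [dom]. *)
Record operator (H K : Type) := Operator { dom : set H ; op_fun :> H -> K }.

Section Operators.
Context d (T : measurableType d) (R : realType).
Variable mu : {measure set T -> \bar R}.
Local Notation H := (L2 mu).
Implicit Types (A B : operator H H) (l : R[i]).

(* [z] is unique, hence [adjoint A] meaningful, when [dom A] is dense. *)
Definition is_adjoint_value A (h z : H) : Prop :=
  forall f, dom A f -> L2dot (A f) h = L2dot f z.

Definition adjoint A : operator H H :=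
  Operator [set h | exists z, is_adjoint_value A h z]
           (fun h => xget 0 (is_adjoint_value A h)).

Definition comp_op A B : operator H H :=
  Operator [set f | dom B f /\ dom A (B f)] (fun f => A (B f)).

Definition resolvent_set A : set R[i] :=
  [set l | set_bij (dom A) setT (fun f => A f - l *: f) /\
           exists M : R, forall f, dom A f ->
             L2norm f <= M * L2norm (A f - l *: f)].

Definition spectrum A : set R[i] := ~` resolvent_set A.

(* [sqrtC] is the complex square root, so no point of the spectrum of A*A is
   dropped or altered by a restriction to the nonnegative reals. *)
Definition singular_values A : set R[i] :=
  [set sqrtC l | l in spectrum (comp_op (adjoint A) A)].

Definition inverse_op A : H -> H := 'pinv_(fun=> 0) (dom A) A.

Definition opnorm (B : H -> H) : \bar R :=
  ereal_sup [set (L2norm (B f))%:E | f in [set f : H | L2norm f <= 1]].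

Definition mul_op (m : T -> R[i]) : operator H H :=
  Operator [set g | (fun x => m x * rep g x) \in sq_integrable mu]
           (fun g => L2class mu (fun x => m x * rep g x)).

End Operators.

Section Fourier.
Variable R : realType.
Local Notation leb := (@lebesgue_measure R).
Local Notation L2R := (L2 leb).

Definition fourier_integral (g : R -> R[i]) (k : R) : R[i] :=
  (Num.sqrt (2 * pi))^-1%:C *
  cintegral leb (fun x => g x * (cos (k * x) -i* sin (k * x))).

(* [h] is the value at [g] of the continuous extension to L^2 of the Fourier
   integral on the intersection of L^1 and L^2. *)
Definition is_fourier (g h : L2R) : Prop :=
  exists u v : nat -> L2R,
    [/\ forall n, cintegrable leb (rep (u n)),
        forall n, {ae leb, forall k,
                     rep (v n) k = fourier_integral (rep (u n)) k},
        (fun n => L2norm (u n - g)) @ \oo --> (0 : R) &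
        (fun n => L2norm (v n - h)) @ \oo --> (0 : R)].

Definition fourier (g : L2R) : L2R := xget 0 (is_fourier g).

Definition inv_fourier : L2R -> L2R := 'pinv_(fun=> 0) setT fourier.

End Fourier.

Section BlackScholes.
Variable R : realType.
Local Notation leb := (@lebesgue_measure R).

(* The measure dS/S on (0,oo), extended by 0 to the Borel sets of the line. *)
Definition dS_over_S (A : set (measurableTypeR R)) : \bar R :=
  (\int[leb]_(S in A `&` `]0%R, +oo[) (S^-1)%:E)%E.

Let dS_over_S0 : dS_over_S set0 = 0%E.
Proof. by rewrite /dS_over_S set0I integral_set0. Qed.

Let dS_over_S_ge0 A : (0 <= dS_over_S A)%E.
Proof.
apply: integral_ge0 => x [_] /=; rewrite in_itv /= andbT => x0.
by rewrite lee_fin invr_ge0 ltW.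
Qed.

Let dS_over_S_sigma_additive : semi_sigma_additive dS_over_S.
Proof.
move=> /= F mF tF mUF; rewrite /dS_over_S setI_bigcupl ge0_integral_bigcup//=.
- apply: is_cvg_ereal_nneg_natsum_cond => n _ _; exact: dS_over_S_ge0.
- by move=> n; apply: measurableI.
- apply: (@measurable_funS _ _ (measurableTypeR R) _ (`]0, +oo[ : set R)) => //.
    by move=> x [n _ []].
  apply: measurableT_comp => //; apply: open_continuous_measurable_fun => //.
  move=> x; rewrite inE /= in_itv /= andbT => x0.
  by apply: inv_continuous; rewrite gt_eqF.
- move=> x [n _ [_]] /=; rewrite in_itv /= andbT => x0.
  by rewrite lee_fin invr_ge0 ltW.
- exact: trivIset_setIr.
Qed.

HB.instance Definition _ := isMeasure.Build _ _ _ dS_over_S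
  dS_over_S0 dS_over_S_ge0 dS_over_S_sigma_additive.

(* Functions on (0,oo) are represented by functions on the line, modulo
   equality almost everywhere for dS/S, which does not see (-oo,0]. *)
Definition H_0 : Type := L2 dS_over_S.

Definition Q_0 (f : H_0) : L2 leb := L2class leb (fun x => rep f (expR x)).

Definition inv_Q_0 : L2 leb -> H_0 := 'pinv_(fun=> 0) setT Q_0.

Definition rho_0 (r sigma k : R) : R[i] :=
  (- (2^-1 * sigma ^+ 2 * k ^+ 2) - r) +i* ((r - 2^-1 * sigma ^+ 2) * k).

Definition A_0 (r sigma : R) : operator H_0 H_0 :=
  let T_rho_0 := mul_op leb (rho_0 r sigma) in
  Operator [set f | dom T_rho_0 (fourier (Q_0 f))]
           (fun f => inv_Q_0 (inv_fourier (T_rho_0 (fourier (Q_0 f))))).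

End BlackScholes.

(* Main.v *)
Require Import Defs.
From mathcomp Require Import all_boot all_order all_algebra ring_quotient.
From mathcomp Require Import complex ring lra measurable_realfun.
From mathcomp Require Import all_classical all_reals all_analysis.

(** The Fourier transform is unitary. Write [C] and [S] for the cosine and sine
    transforms of a real bounded function [a] with compact support. Weighting
    [C^2 + S^2] by [exp (- e k)] on [k >= 0] and applying Fubini turns its
    integral into the Poisson average
    [\int (\int a (e t + x) a x dx) / (1 + t^2) dt], which tends to
    [pi * \int a^2] as [e] tends to 0. By density this makes the Fourier transform
    an isometry [F] of L^2. The multiplication formula [\int (F f) g = \int f (F g)]
    then yields [F (conj (F (conj h))) = h]: both sides have the norm of [h] and
    their inner product is that norm squared.

    Hence [A_0] is unitarily equivalent to multiplication by [rho_0], and its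
    [A*A] to multiplication by [|rho_0|^2], a continuous function whose range is
    [[r^2, +oo[] because
    [|rho_0 k|^2 = (sigma^2 k^2 / 2 + r)^2 + ((r - sigma^2 / 2) k)^2]. *)

Set Implicit Arguments.
Unset Strict Implicit.
Unset Printing Implicit Defensive.
Import Order.TTheory GRing.Theory Num.Theory.
Import numFieldNormedType.Exports.
Local Open Scope classical_set_scope.
Local Open Scope complex_scope.
Local Open Scope ring_scope.

(** * The Hilbert space L^2 *)

Section L2Space.
Context d (T : measurableType d) (R : realType).
Variable mu : {measure set T -> \bar R}.
Local Notation H := (L2 mu).
Implicit Types (u v w : H) (f g : T -> R[i]).
Local Open Scope quotient_scope.

(** [fourier] and [adjoint] are both chosen by [xget] from a relation, so each needs existence and
    uniqueness before it can be computed. For [fourier], existence rests on the completeness of L^2.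
    Uniqueness must handle arbitrary approximating sequences in the intersection of L^1 and L^2,
    where the Plancherel identity is not yet available; the inequality that Fatou's lemma gives on
    truncations is enough, and the isometry is recovered afterwards along bounded functions with
    compact support. For [adjoint], density of the domain is replaced by test functions cut off
    where the symbol is bounded.

    The weight [exp (- e k)] on a half-line is chosen because the integrals it produces have
    elementary antiderivatives: its cosine transform is the Poisson kernel, and the constant [pi] is
    the total mass of [1 / (1 + t^2)]. The half-line suffices because [C] is even and [S] is odd.

    The minimum [r] of [|rho_0|] is reached at [k = 0] only, a null set. The spectrum and the norm
    of the inverse are therefore detected with indicators of short intervals instead of
    eigenvectors. *)

Lemma sq_integrableP f : f \in sq_integrable mu <->
  cmeasurable f /\ (\int[mu]_x (sqmod (f x))%:E < +oo)%E.
Proof. by rewrite inE. Qed.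

Lemma rep_sq u : rep u \in sq_integrable mu.
Proof. exact: L2funP. Qed.

Lemma rep_class f : f \in sq_integrable mu ->
  {ae mu, forall x, rep (L2class mu f) x = f x}.
Proof.
move=> fs; rewrite /L2class /rep.
case: insubP => [h _ hf|]; last by rewrite fs.
by have := repr_pi h; apply: filterS => x ->; rewrite -hf.
Qed.

Lemma L2_ext u v : {ae mu, forall x, rep u x = rep v x} -> u = v.
Proof. by move=> uv; rewrite -[u]reprK -[v]reprK; apply/L2_eqP. Qed.

Lemma repD u v : {ae mu, forall x, rep (u + v) x = rep u x + rep v x}.
Proof.
suff key w : w = u + v -> {ae mu, forall x, rep w x = rep u x + rep v x}.
  exact: key.
by rewrite -[u in u + v]reprK -[v in _ + v]reprK -Defs.pi_add => ->; exact: repr_pi.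
Qed.

Lemma repZ a u : {ae mu, forall x, rep (a *: u) x = a * rep u x}.
Proof.
exact: (repr_pi (a *: repr u)).
Qed.

Lemma repN u : {ae mu, forall x, rep (- u) x = - rep u x}.
Proof.
suff key w : w = - u -> {ae mu, forall x, rep w x = - rep u x} by exact: key.
rewrite -scaleN1r => ->; have := repZ (-1) u.
by apply: filterS => x e; rewrite e mulN1r.
Qed.

Lemma repB u v : {ae mu, forall x, rep (u - v) x = rep u x - rep v x}.
Proof. by apply: filterS2 (repD u (- v)) (repN v) => x -> ->. Qed.

Lemma integrable_sqmod f : f \in sq_integrable mu ->
  mu.-integrable setT (fun x => (sqmod (f x))%:E).
Proof.
move=> /sq_integrableP[mf If]; apply/integrableP; split.
  by apply/measurable_EFinP; exact: measurable_sqmod.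
by under eq_integral do rewrite gee0_abs ?lee_fin ?sqmod_ge0//.
Qed.

Lemma integrable_le_sqmod f g (h : T -> R) : f \in sq_integrable mu ->
  g \in sq_integrable mu -> measurable_fun setT h ->
  (forall x, `|h x| <= sqmod (f x) + sqmod (g x)) ->
  mu.-integrable setT (EFin \o h).
Proof.
move=> sf sg mh hfg.
apply: (@le_integrable _ _ _ mu setT _ _
   (fun x => (sqmod (f x))%:E + (sqmod (g x))%:E)%E) => //.
- exact/measurable_EFinP.
- by move=> x _ /=; rewrite lee_fin (le_trans (hfg x))// ler_norm.
- by apply: integrableD => //; exact: integrable_sqmod.
Qed.

Definition N2 u : R := (\int[mu]_x sqmod (rep u x))%R.

Lemma N2E u : (\int[mu]_x (sqmod (rep u x))%:E)%E = (N2 u)%:E.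
Proof.
rewrite /N2 /Rintegral fineK// integrable_fin_num//.
exact: integrable_sqmod (rep_sq u).
Qed.

Lemma N2_ge0 u : 0 <= N2 u.
Proof. by apply: Rintegral_ge0 => x _; exact: sqmod_ge0. Qed.

Lemma L2normE u : L2norm u = Num.sqrt (N2 u).
Proof. by []. Qed.

Lemma L2norm_ge0 u : 0 <= L2norm u.
Proof. exact: sqrtr_ge0. Qed.

Lemma sqr_L2norm u : L2norm u ^+ 2 = N2 u.
Proof. by rewrite sqr_sqrtr// N2_ge0. Qed.

Lemma measurable_sqmod_rep u : measurable_fun setT (fun x => (sqmod (rep u x))%:E).
Proof.
apply/measurable_EFinP/measurable_sqmod.
by have /sq_integrableP[] := rep_sq u.
Qed.

Lemma N2_class f : f \in sq_integrable mu ->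
  (N2 (L2class mu f))%:E = (\int[mu]_x (sqmod (f x))%:E)%E.
Proof.
move=> sf; rewrite -N2E; apply: ae_eq_integral => //.
- exact: measurable_sqmod_rep.
- by apply/measurable_EFinP/measurable_sqmod; have /sq_integrableP[] := sf.
- by have := rep_class sf; apply: filterS => x e _; rewrite e.
Qed.

Lemma L2_eq0 u : N2 u = 0 -> u = 0.
Proof.
move=> N0; apply: L2_ext.
have /ae_eq_integral_abs h : measurable_fun setT (fun x => (sqmod (rep u x))%:E).
  exact: measurable_sqmod_rep.
have /h{h} e0 : (\int[mu]_x `|(sqmod (rep u x))%:E|)%E = 0%E.
  by under eq_integral do rewrite gee0_abs ?lee_fin ?sqmod_ge0//; rewrite N2E N0.
(* The chosen representative of the class [0] vanishes only almost everywhere; writing [0] as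
   [0 *: u] yields this. *)
have := repZ 0 u; rewrite scale0r.
apply: filterS2 (e0 measurableT) => x /(_ I) e ->.
rewrite mul0r; case: e; rewrite /sqmod => /eqP.
rewrite paddr_eq0 ?sqr_ge0// !sqrf_eq0 => /andP[/eqP a /eqP b].
by rewrite [LHS]complexE a b /= mulr0 addr0.
Qed.

(** The real part of [L2dot]. Norms, Cauchy-Schwarz and polarization only need this real inner
    product, and the imaginary part comes back as [rdot u ('i *: v)]. *)
Definition rdot u v : R := (\int[mu]_x (complex.Re (rep u x) * complex.Re (rep v x) +
   complex.Im (rep u x) * complex.Im (rep v x)))%R.

Lemma cmeasurable_rep u : cmeasurable (rep u).
Proof. by have /sq_integrableP[] := rep_sq u. Qed.

Lemma normrM_le (a b : R) : `|a * b| <= a ^+ 2 + b ^+ 2.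
Proof.
have : 0 <= (`|a| - `|b|) ^+ 2 by exact: sqr_ge0.
rewrite normrM -(real_normK (num_real a)) -(real_normK (num_real b)).
have := normr_ge0 a; have := normr_ge0 b; nra.
Qed.

Lemma rdot_integrand_le (z w : R[i]) :
  `|complex.Re z * complex.Re w + complex.Im z * complex.Im w| <= sqmod z + sqmod w.
Proof.
rewrite (le_trans (ler_normD _ _))// /sqmod.
rewrite (le_trans (lerD (normrM_le _ _) (normrM_le _ _)))//.
by rewrite le_eqVlt; apply/orP; left; apply/eqP; ring.
Qed.

Lemma measurable_rdot_integrand f g : cmeasurable f -> cmeasurable g ->
  measurable_fun setT (fun x => complex.Re (f x) * complex.Re (g x) +
   complex.Im (f x) * complex.Im (g x)).
Proof. by move=> [? ?] [? ?]; apply: measurable_funD; apply: measurable_funM. Qed.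

Lemma integrable_rdot u v : mu.-integrable setT (EFin \o (fun x =>
   complex.Re (rep u x) * complex.Re (rep v x) +
   complex.Im (rep u x) * complex.Im (rep v x))).
Proof.
apply: (integrable_le_sqmod (rep_sq u) (rep_sq v)).
  exact: measurable_rdot_integrand (cmeasurable_rep _) (cmeasurable_rep _).
by move=> x; exact: rdot_integrand_le.
Qed.

Lemma ae_eq_Rintegral (p q : T -> R) : measurable_fun setT p ->
  measurable_fun setT q -> {ae mu, forall x, p x = q x} ->
  (\int[mu]_x p x = \int[mu]_x q x)%R.
Proof.
move=> mp mq pq; congr fine; apply: ae_eq_integral => //; try exact/measurable_EFinP.
by apply: filterS pq => x -> _.
Qed.

Lemma rdotC u v : rdot u v = rdot v u.
Proof. by apply: eq_Rintegral => x _; ring. Qed.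

Lemma rdotDl u v w : rdot (u + v) w = rdot u w + rdot v w.
Proof.
rewrite /rdot -RintegralD//; try exact: integrable_rdot.
apply: ae_eq_Rintegral.
- exact: measurable_rdot_integrand (cmeasurable_rep _) (cmeasurable_rep _).
- by apply: measurable_funD;
    exact: measurable_rdot_integrand (cmeasurable_rep _) (cmeasurable_rep _).
- apply: filterS (repD u v) => x ->.
  by case: (rep u x) (rep v x) (rep w x) => [? ?] [? ?] [? ?] /=; ring.
Qed.

Lemma rdotZl (a : R) u v : rdot (a%:C *: u) v = a * rdot u v.
Proof.
rewrite /rdot -RintegralZl//; last exact: integrable_rdot.
apply: ae_eq_Rintegral.
- exact: measurable_rdot_integrand (cmeasurable_rep _) (cmeasurable_rep _).
- by apply: measurable_funM => //;
    exact: measurable_rdot_integrand (cmeasurable_rep _) (cmeasurable_rep _).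
- apply: filterS (repZ a%:C u) => x ->.
  by case: (rep u x) (rep v x) => [? ?] [? ?] /=; ring.
Qed.

Lemma N2_rdot u : N2 u = rdot u u.
Proof. by apply: eq_Rintegral => x _; rewrite /sqmod !expr2. Qed.

Lemma N2D u v : N2 (u + v) = N2 u + N2 v + 2 * rdot u v.
Proof.
by rewrite !N2_rdot rdotDl ![rdot _ (u + v)]rdotC !rdotDl [rdot v u]rdotC; ring.
Qed.

Lemma N2Z a u : N2 (a *: u) = sqmod a * N2 u.
Proof.
apply: EFin_inj; rewrite EFinM -!N2E -ge0_integralZl//; last 3 first.
- exact: measurable_sqmod_rep.
- by move=> x _; rewrite lee_fin sqmod_ge0.
- by rewrite lee_fin sqmod_ge0.
apply: ae_eq_integral => //.
- exact: measurable_sqmod_rep.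
- apply: measurable_funeM; exact: measurable_sqmod_rep.
- by apply: filterS (repZ a u) => x -> _; rewrite sqmodM.
Qed.

Lemma N2N u : N2 (- u) = N2 u.
Proof. by rewrite -scaleN1r N2Z /sqmod/= oppr0 expr0n/= addr0 sqrrN expr1n mul1r. Qed.

Lemma rdotNl u v : rdot (- u) v = - rdot u v.
Proof.
have -> : - u = ((- 1)%:C *: u) by rewrite rmorphN1 scaleN1r.
by rewrite rdotZl mulN1r.
Qed.

Lemma rdotBl u v w : rdot (u - v) w = rdot u w - rdot v w.
Proof. by rewrite rdotDl rdotNl. Qed.

Lemma rdotBr u v w : rdot w (u - v) = rdot w u - rdot w v.
Proof. by rewrite rdotC rdotBl ![rdot w _]rdotC. Qed.

Lemma N2B u v : N2 (u - v) = N2 u + N2 v - 2 * rdot u v.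
Proof. by rewrite N2D N2N rdotC rdotNl rdotC mulrN. Qed.

Lemma rdot_sqr_le u v : rdot u v ^+ 2 <= N2 u * N2 v.
Proof.
have h (a b : R) : 0 <= a ^+ 2 * N2 u + b ^+ 2 * N2 v + 2 * (a * b) * rdot u v.
  have := N2_ge0 (a%:C *: u + b%:C *: v).
  rewrite N2D !N2Z rdotZl rdotC rdotZl rdotC /sqmod/= !expr0n/= !addr0.
  by rewrite (_ : 2 * (a * (b * _)) = 2 * (a * b) * rdot u v)//; ring.
have := N2_ge0 u; have := N2_ge0 v.
have := h (N2 v) (- rdot u v).
rewrite [leRHS](_ : _ = N2 v * (N2 u * N2 v - rdot u v ^+ 2)); last by ring.
have [v0 _ _ _|v0] := eqVneq (N2 v) 0.
  (* With [N2 v = 0] the previous combination reads [0 <= 0]. This one gives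
     [0 <= - (N2 u + 2) * rdot u v ^+ 2], which forces [rdot u v = 0]. *)
  have := h (- rdot u v) (N2 u + 1); rewrite v0 mulr0 addr0.
  have := N2_ge0 u; nra.
move=> + v1; rewrite pmulr_rge0 ?subr_ge0//.
by rewrite lt_neqAle eq_sym v0.
Qed.

Lemma normr_rdot_le u v : `|rdot u v| <= L2norm u * L2norm v.
Proof.
rewrite -(@ler_pXn2r _ 2) ?nnegrE ?mulr_ge0 ?L2norm_ge0//.
by rewrite real_normK ?num_real// exprMn !sqr_L2norm rdot_sqr_le.
Qed.

Lemma L2normD u v : L2norm (u + v) <= L2norm u + L2norm v.
Proof.
rewrite -(@ler_pXn2r _ 2) ?nnegrE ?addr_ge0 ?L2norm_ge0//.
rewrite sqr_L2norm N2D sqrrD !sqr_L2norm.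
by have := le_trans (ler_norm _) (normr_rdot_le u v); lra.
Qed.

Lemma L2normN u : L2norm (- u) = L2norm u.
Proof. by rewrite !L2normE N2N. Qed.

Lemma L2norm_dist u v : `|L2norm u - L2norm v| <= L2norm (u - v).
Proof.
have := L2normD (v - u) u; have := L2normD (u - v) v.
by rewrite !subrK -[v - u]opprB L2normN ler_norml => ? ?; apply/andP; split; lra.
Qed.

Lemma L2norm_eq0 u : L2norm u = 0 -> u = 0.
Proof. by move=> u0; apply: L2_eq0; rewrite -sqr_L2norm u0 expr0n. Qed.

Lemma L2norm0 : L2norm (0 : H) = 0.
Proof. by rewrite L2normE -(scale0r (0 : H)) N2Z /sqmod/= expr0n/= addr0 mul0r sqrtr0. Qed.

Lemma L2dotE u v : L2dot u v = rdot u v +i* rdot u ('i *: v).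
Proof.
rewrite /L2dot /cintegral; congr (_ +i* _).
  by apply: eq_Rintegral => x _; case: (rep u x) (rep v x) => [? ?] [? ?] /=; ring.
have iu : cmeasurable (fun x => 'i * rep v x).
  have [m1 m2] := cmeasurable_rep v; split.
    rewrite (_ : (fun x => _) = (fun x => - complex.Im (rep v x))).
      exact: measurable_funN.
    by apply/funext => x; case: (rep v x) => [? ?] /=; ring.
  rewrite (_ : (fun x => _) = (fun x => complex.Re (rep v x)))//.
  by apply/funext => x; case: (rep v x) => [? ?] /=; ring.
transitivity (\int[mu]_x (complex.Re (rep u x) * complex.Re ('i * rep v x) +
   complex.Im (rep u x) * complex.Im ('i * rep v x)))%R.
  by apply: eq_Rintegral => x _; case: (rep u x) (rep v x) => [? ?] [? ?] /=; ring.
apply: ae_eq_Rintegral.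
- exact: measurable_rdot_integrand (cmeasurable_rep _) iu.
- exact: measurable_rdot_integrand (cmeasurable_rep _) (cmeasurable_rep _).
- by apply: filterS (repZ 'i v) => x ->.
Qed.

End L2Space.

(** * Completeness of L^2 along geometrically fast sequences *)

Lemma cvg_of_geometric_steps (R : realType) (a : R^nat) (s : R) :
    (forall n, `|a n.+1 - a n| <= s * (2^-1) ^+ n) ->
  cvgn a /\ forall n, `|limn a - a n| <= 2 * s * (2^-1) ^+ n.
Proof.
move=> H.
have s0 : 0 <= s by have := H 0%N; rewrite expr0 mulr1; apply: le_trans.
have p0 n : 0 <= s * (2^-1) ^+ n by rewrite mulr_ge0// exprn_ge0.
have E n : s * (2^-1) ^+ n = 2 * (s * (2^-1) ^+ n.+1) by rewrite exprS; field.
(* The tail of the step bounds after [n] sums to [2 * s * (2^-1) ^+ n]. Adding it to [a n] gives a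
   nonincreasing sequence, subtracting it a nondecreasing one, and the limit is caught between
   them. *)
have up n m : (n <= m)%N -> a m + 2 * (s * (2^-1) ^+ m) <= a n + 2 * (s * (2^-1) ^+ n).
  move=> /subnK <-; elim: (m - n)%N => [//|k IH]; rewrite addSn.
  apply: le_trans IH; have := H (k + n)%N; rewrite ler_norml => /andP[_].
  by have := E (k + n)%N; lra.
have lo n m : (n <= m)%N -> a n - 2 * (s * (2^-1) ^+ n) <= a m - 2 * (s * (2^-1) ^+ m).
  move=> /subnK <-; elim: (m - n)%N => [//|k IH]; rewrite addSn.
  apply: (le_trans IH); have := H (k + n)%N; rewrite ler_norml => /andP[+ _].
  by have := E (k + n)%N; lra.
have g0 : (fun n => 2 * (s * (2^-1) ^+ n)) @ \oo --> (0 : R).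
  rewrite (_ : (fun n => _) = geometric (2 * s) 2^-1).
    by apply: cvg_geometric; rewrite ger0_norm ?invr_ge0// invf_lt1// ltr1n.
  by apply/funext => n; rewrite /geometric/= mulrA.
have ca : cvgn a.
  rewrite (_ : a = (fun n => a n + 2 * (s * (2^-1) ^+ n)) - (fun n => 2 * (s * (2^-1) ^+ n))).
    apply: is_cvgB; last by apply/cvg_ex; exists 0.
    apply: nonincreasing_is_cvgn; first by move=> n m nm; exact: up.
    exists (a 0%N - 2 * (s * (2^-1) ^+ 0)) => _ [n _ <-].
    by apply: (le_trans (lo 0%N n (leq0n _))); have := p0 n; lra.
  by apply/funext => n; rewrite [RHS]/=/GRing.add/=; rewrite addrK.
split=> // n; rewrite -mulrA ler_norml; apply/andP; split.
  rewrite lerBrDl; apply: limr_ge => //; exists n => // m /= nm.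
  by have := lo _ _ nm; have := p0 m; lra.
rewrite lerBlDl; apply: limr_le => //; exists n => // m /= nm.
by have := up _ _ nm; have := p0 m; lra.
Qed.

Section Completeness.
Context d (T : measurableType d) (R : realType).
Variable mu : {measure set T -> \bar R}.
Local Notation H := (L2 mu).
Implicit Types (u v w : H) (f g : T -> R[i]).

Lemma sqmod_cst_class f u : cmeasurable f ->
  (\int[mu]_x (sqmod (f x - rep u x))%:E < +oo)%E -> f \in sq_integrable mu.
Proof.
move=> mf lf; have mfu : (fun x => f x - rep u x) \in sq_integrable mu.
  apply/sq_integrableP; split=> //.
  have [fr fi] := mf; have [ur ui] := cmeasurable_rep u.
  split; [under eq_fun do rewrite raddfB/= | under eq_fun do rewrite raddfB/=];
  exact: measurable_funB.
have := rpredD mfu (rep_sq u); rewrite (_ : _ + _ = f)//.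
by apply/funext => x; exact: subrK.
Qed.

(** The Riesz-Fischer argument. The rate [8^-1] splits as [4^-1 * 2^-1]: after multiplication by
    [4 ^+ n] the squared steps still have summable integrals, so their sum [G] is finite almost
    everywhere, and there the steps themselves are at most [sqrt G * (2^-1) ^+ n]. *)
Lemma L2_complete_fast (v : nat -> H) (C : R) :
    (forall n, N2 (v n.+1 - v n) <= C * (8^-1) ^+ n) ->
  exists w, (fun n => L2norm (v n - w)) @ \oo --> (0 : R).
Proof.
move=> HC.
have C0 : 0 <= C.
  by have := HC 0%N; rewrite expr0 mulr1; apply: le_trans; exact: N2_ge0.
pose p n := rep (v n).
have mp n : cmeasurable (p n) by exact: cmeasurable_rep.
pose d_ n x := 4 ^+ n * sqmod (p n.+1 x - p n x).
have d0 n x : 0 <= d_ n x by rewrite mulr_ge0 ?sqmod_ge0// exprn_ge0.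
have md n : measurable_fun setT (fun x => (d_ n x)%:E).
  apply/measurable_EFinP; apply: measurable_funM => //.
  apply: measurable_sqmod; have [? ?] := mp n; have [? ?] := mp n.+1; split.
    by under eq_fun do rewrite raddfB/=; exact: measurable_funB.
  by under eq_fun do rewrite raddfB/=; exact: measurable_funB.
(* The bound is [C * (2^-1) ^+ n], put in the shape whose series [cvg_geometric_eseries_half] sums
   to [2 * C]. *)
have Id n : (\int[mu]_x (d_ n x)%:E <= (2 * C / (2 ^ (n + 1))%:R)%:E)%E.
  rewrite (_ : (\int[mu]_x _)%E = (4 ^+ n * N2 (v n.+1 - v n))%:E).
    rewrite lee_fin (le_trans (ler_wpM2l _ (HC n))) ?exprn_ge0//.
    rewrite mulrCA -exprMn (_ : 4 * 8^-1 = 2^-1) ?exprVn; last by field.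
    rewrite natrX exprD expr1 le_eqVlt; apply/orP; left; apply/eqP.
    by field; rewrite expf_neq0.
  rewrite EFinM -N2E -ge0_integralZl//; last 2 first.
  - exact: measurable_sqmod_rep.
  - by move=> x _; rewrite lee_fin sqmod_ge0.
  apply: ae_eq_integral => //.
  - apply: measurable_funeM; exact: measurable_sqmod_rep.
  - by apply: filterS (repB (v n.+1) (v n)) => x -> _.
pose G x := (\sum_(0 <= n <oo) (d_ n x)%:E)%E.
have G0 x : (0 <= G x)%E by apply: nneseries_ge0 => n _ _; rewrite lee_fin.
have mG : measurable_fun setT G.
  by apply: ge0_emeasurable_sum => // n x _ _; rewrite lee_fin.
have IG : (\int[mu]_x G x <= (2 * C)%:E)%E.
  rewrite integral_nneseries//; last by move=> n x _; rewrite lee_fin.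
  apply: (@le_trans _ _ (\sum_(0 <= n <oo) (2 * C / (2 ^ (n + 1))%:R)%:E)%E).
    by apply: lee_nneseries => // n _ _; apply: integral_ge0 => x _; rewrite lee_fin.
  have := @cvg_geometric_eseries_half R (2 * C) 0; rewrite expr0 divr1.
  by move=> /cvg_lim <-.
have iG : mu.-integrable setT G.
  apply/integrableP; split=> //; under eq_integral do rewrite gee0_abs//.
  by rewrite (le_lt_trans IG)// ltry.
pose E := [set x | G x \is a fin_num].
have mE : measurable E by rewrite -[E]setTI; exact: emeasurable_fin_num.
have aeE : {ae mu, forall x, E x}.
  by have := integrable_ae measurableT iG; apply: filterS => x; exact.
pose g x := fine (G x).
have dg n x : E x -> d_ n x <= g x.
  move=> Ex; rewrite -lee_fin fineK//.
  apply: le_trans (nneseries_lim_ge n.+1 _); last by move=> k _ _; rewrite lee_fin.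
  by rewrite big_nat_recr//= leeDr// sume_ge0// => k _; rewrite lee_fin.
have step (q : R[i] -> R) n x : E x -> {morph q : a b / a - b} ->
    (forall z, q z ^+ 2 <= sqmod z) ->
  `|q (p n.+1 x) - q (p n x)| <= Num.sqrt (g x) * (2^-1) ^+ n.
  move=> Ex qB qle; have gx := le_trans (d0 n x) (dg n x Ex).
  rewrite -qB -(@ler_pXn2r _ 2) ?nnegrE ?mulr_ge0 ?exprn_ge0 ?sqrtr_ge0//.
  rewrite real_normK ?num_real// exprMn sqr_sqrtr// (le_trans (qle _))//.
  have := dg n x Ex; rewrite /d_ mulrC -ler_pdivlMr ?exprn_gt0//.
  by rewrite exprAC -exprVn (_ : (2^-1) ^+ 2 = 4^-1 :> R)//; field.
have sR (z : R[i]) : complex.Re z ^+ 2 <= sqmod z by rewrite lerDl sqr_ge0.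
have sI (z : R[i]) : complex.Im z ^+ 2 <= sqmod z by rewrite lerDr sqr_ge0.
(* The indicator of [E] makes the sequence converge at every point, so that the limit is measurable
   without an exceptional set. *)
pose lr (q : R[i] -> R) x := limn (fun n => q (p n x) * \1_E x).
have lrE (q : R[i] -> R) x : {morph q : a b / a - b} ->
    (forall z, q z ^+ 2 <= sqmod z) ->
    (fun n => q (p n x) * \1_E x) @ \oo --> lr q x /\
    (E x -> forall n, `|lr q x - q (p n x)| <= 2 * Num.sqrt (g x) * (2^-1) ^+ n).
  move=> qB qle; rewrite /lr indicE; case: (boolP (x \in E)) => [/set_mem Ex|nEx] /=.
    under eq_fun do rewrite mulr1.
    by have [c1 c2] := cvg_of_geometric_steps (fun n => step q n x Ex qB qle).
  split; last by move=> /mem_set; rewrite (negbTE nEx).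
  by under eq_fun do rewrite mulr0; rewrite lim_cst//; exact: cvg_cst.
have RB : {morph (@complex.Re R) : a b / a - b} by move=> ? ?; rewrite raddfB.
have IB : {morph (@complex.Im R) : a b / a - b} by move=> ? ?; rewrite raddfB.
pose w x := lr (@complex.Re R) x +i* lr (@complex.Im R) x.
have m1E : measurable_fun setT (\1_E : T -> R) by exact: measurable_indic.
have mw : cmeasurable w.
  split => /=.
    apply: (@measurable_fun_cvg _ _ _ _ (fun n x => complex.Re (p n x) * \1_E x)).
      by move=> n; apply: measurable_funM => //; have [] := mp n.
    by move=> x _; have [] := lrE _ x RB sR.
  apply: (@measurable_fun_cvg _ _ _ _ (fun n x => complex.Im (p n x) * \1_E x)).
    by move=> n; apply: measurable_funM => //; have [] := mp n.
  by move=> x _; have [] := lrE _ x IB sI.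
have wp n x : E x -> sqmod (w x - p n x) <= 8 * (4^-1) ^+ n * g x.
  move=> Ex; have gx := le_trans (d0 n x) (dg n x Ex).
  have [_ /(_ Ex n) h1] := lrE _ x RB sR; have [_ /(_ Ex n) h2] := lrE _ x IB sI.
  have e0 : 0 <= 2 * Num.sqrt (g x) * 2^-1 ^+ n.
    by rewrite !mulr_ge0 ?sqrtr_ge0// exprn_ge0.
  have k (a : R) : `|a| <= 2 * Num.sqrt (g x) * 2^-1 ^+ n ->
      a ^+ 2 <= 4 * (4^-1) ^+ n * g x.
    move=> h; rewrite -[a ^+ 2]real_normK ?num_real//.
    rewrite (le_trans (lerXn2r 2 _ _ h)) ?nnegrE//.
    rewrite !exprMn sqr_sqrtr// exprAC (_ : (2^-1) ^+ 2 = 4^-1 :> R); last by field.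
    by rewrite le_eqVlt; apply/orP; left; apply/eqP; ring.
  have := k _ h1; have := k _ h2; rewrite /sqmod /w !raddfB/=; lra.
have mwp n : measurable_fun setT (fun x => (sqmod (w x - p n x))%:E).
  apply/measurable_EFinP/measurable_sqmod; have [? ?] := mp n; have [? ?] := mw; split.
    by under eq_fun do rewrite raddfB/=; exact: measurable_funB.
  by under eq_fun do rewrite raddfB/=; exact: measurable_funB.
have Iwp n : (\int[mu]_x (sqmod (w x - p n x))%:E <= (8 * (4^-1) ^+ n * (2 * C))%:E)%E.
  have c0 : 0 <= 8 * (4^-1) ^+ n :> R by rewrite mulr_ge0// exprn_ge0.
  apply: (@le_trans _ _ (\int[mu]_x ((8 * (4^-1) ^+ n)%:E * G x))%E).
    apply: ae_ge0_le_integral => //.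
    - by move=> x _; rewrite lee_fin sqmod_ge0.
    - by move=> x _; rewrite mule_ge0.
    - exact: measurable_funeM.
    - by apply: filterS aeE => x Ex _; rewrite -[G x]fineK// -EFinM lee_fin wp.
  by rewrite ge0_integralZl// [leRHS]EFinM lee_wpmul2l.
have sw : w \in sq_integrable mu.
  by apply: (@sqmod_cst_class _ (v 0%N)) => //; rewrite (le_lt_trans (Iwp 0%N))// ltry.
exists (L2class mu w).
have N2le n : N2 (v n - L2class mu w) <= 16 * C * (4^-1) ^+ n.
  rewrite -opprB N2N -lee_fin -N2E.
  rewrite (_ : (\int[mu]_x _)%E = (\int[mu]_x (sqmod (w x - p n x))%:E)%E).
    by rewrite (le_trans (Iwp n))// lee_fin; lra.
  apply: ae_eq_integral => //; first exact: measurable_sqmod_rep.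
  by apply: filterS2 (repB (L2class mu w) (v n)) (rep_class sw) => x -> -> _.
apply: (@squeeze_cvgr _ _ _ _ (fun=> 0) (geometric (Num.sqrt (16 * C)) (2^-1))).
- near=> n; rewrite L2norm_ge0/= -(@ler_pXn2r _ 2) ?nnegrE ?L2norm_ge0 ?mulr_ge0 ?sqrtr_ge0 ?exprn_ge0//.
  rewrite sqr_L2norm exprMn sqr_sqrtr ?mulr_ge0// exprAC.
  by rewrite (_ : (2^-1) ^+ 2 = 4^-1 :> R)//; field.
- exact: cvg_cst.
- by apply: cvg_geometric; rewrite ger0_norm ?invr_ge0// invf_lt1// ltr1n.
Unshelve. all: by end_near. Qed.

End Completeness.

(** Preservation of [N2] is all that is asked; polarization returns the inner product in
    [unitary_dot]. *)
Definition unitary d d' (T : measurableType d) (T' : measurableType d') (R : realType)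
    (mu : {measure set T -> \bar R}) (nu : {measure set T' -> \bar R})
    (U : L2 mu -> L2 nu) : Prop :=
  [/\ {morph U : u v / u + v}, forall a, {morph U : u / a *: u},
      forall u, N2 (U u) = N2 u & forall w, exists u, U u = w].

(** * The logarithmic change of variable *)

Section LogChangeOfVariable.
Variable R : realType.
Local Notation leb := (@lebesgue_measure R).
Local Notation RM := (measurableTypeR R).
Local Notation dSS := (@dS_over_S R).

Lemma dS_over_SE (A : set RM) :
  dSS A = (\int[leb]_(S in A `&` `]0%R, +oo[) (S^-1)%:E)%E.
Proof. by []. Qed.

Lemma integral_inv_exp (a b : R) : a < b ->
  (\int[leb]_(x in `]expR a, expR b]) (x^-1)%:E = (b - a)%:E)%E.
Proof.
move=> ab.
have cV x : expR a <= x -> {for x, continuous (fun x : R => x^-1)}.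
  by move=> ax; apply: inv_continuous; rewrite gt_eqF// (lt_le_trans _ ax)// expR_gt0.
rewrite integral_itv_obnd_cbnd; last first.
  apply/measurable_EFinP.
  apply: (@measurable_funS _ _ RM _ (`]0, +oo[ : set R)) => //.
    by move=> x /=; rewrite !in_itv/= andbT => /andP[+ _]; apply: lt_trans; exact: expR_gt0.
  apply: open_continuous_measurable_fun => // x; rewrite inE/= in_itv/= andbT => x0.
  by apply: inv_continuous; rewrite gt_eqF.
rewrite (@continuous_FTC2 _ _ (@ln R)) ?ltr_expR//.
- by rewrite !expRK EFinB.
- apply: continuous_in_subspaceT => x; rewrite inE/= in_itv/= => /andP[ax _]; exact: cV.
- split.
  + move=> x; rewrite in_itv/= => /andP[ax _].
    by have [] := is_derive1_ln (lt_trans (expR_gt0 a) ax).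
  + by apply: cvg_at_right_filter; apply: continuous_ln; exact: expR_gt0.
  + by apply: cvg_at_left_filter; apply: continuous_ln; exact: expR_gt0.
- move=> x; rewrite in_itv/= => /andP[ax _]; rewrite derive1E.
  by have [_] := is_derive1_ln (lt_trans (expR_gt0 a) ax).
Qed.

(** In the coordinate [ln S] the measure [dS/S] gives mass [b - a] to []a, b]], and these values
    characterize Lebesgue measure. *)
Lemma dS_over_S_preimage_ln (A : set RM) : measurable A ->
  dSS (@ln R @^-1` A) = leb A.
Proof.
rewrite -[LHS]/(pushforward dSS (@ln R : RM -> RM) A) => mA.
have mln : measurable_fun [set: RM] (@ln R : RM -> RM) by exact: measurable_ln.
apply: esym; unshelve apply: lebesgue_measure_unique mA => //=.
move=> _ [[a b]] /= _ <-.
rewrite lebesgue_measure_itv/= lte_fin /pushforward/= dS_over_SE.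
(* The intersection with []0, +oo[] discards the points where [ln] takes its default value. *)
have -> : @ln R @^-1` `]a, b] `&` `]0, +oo[ = `]expR a, expR b]%classic.
  apply/seteqP; split => x /=; rewrite !in_itv/= ?andbT.
    by move=> [/andP[ax xb] x0]; rewrite -ltr_ln ?posrE ?expR_gt0// -ler_ln ?posrE ?expR_gt0// !expRK ax.
  move=> /andP[ax xb]; have x0 := lt_trans (expR_gt0 a) ax.
  by rewrite x0 -ltr_expR -ler_expR lnK ?ax.
case: ltP => [ab|ba]; first by rewrite integral_inv_exp// EFinB.
by rewrite set_itv_ge ?integral_set0// -leNgt bnd_simp ler_expR.
Qed.

Lemma ae_dS_over_S_gt0 : {ae dSS, forall x : RM, 0 < x :> R}.
Proof.
exists `]-oo, 0]%classic; split => //.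
  rewrite dS_over_SE (_ : _ `&` _ = set0) ?integral_set0//.
  rewrite -subset0 => x /=; rewrite !in_itv/= andbT => -[x0].
  by rewrite ltNge x0.
by move=> x /= /negP; rewrite in_itv/= -leNgt.
Qed.

Lemma ae_comp_exp (P : RM -> Prop) : {ae dSS, forall x : RM, P x} ->
  {ae leb, forall x : RM, P (expR x)}.
Proof.
move=> [N [mN N0 PN]].
have mE : measurable (@expR R @^-1` N : set RM).
  by rewrite -[X in measurable X]setTI; exact: measurable_expR.
exists (@expR R @^-1` N); split => //.
(* On []0, +oo[] the map [expR \o ln] is the identity, so [N] and its preimage under this map have
   the same trace there. *)
- rewrite -dS_over_S_preimage_ln// -N0 !dS_over_SE; congr (\int[leb]_(x in _) _)%E.
  apply/seteqP; split => x /=; rewrite in_itv/= andbT => -[Nx x0]; have e := lnK x0.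
    by rewrite e in Nx.
  by rewrite e.
- by move=> x /= nP; apply: PN.
Qed.

(** Lebesgue measure is the pushforward of [dS/S] by [ln], so the left side is the [dS/S] integral
    of [f (expR (ln x))], which agrees with [f x] for positive [x]. *)
Lemma ge0_integral_comp_exp (f : RM -> R) : measurable_fun [set: RM] f ->
  (forall x, 0 <= f x) ->
  (\int[leb]_x (f (expR x))%:E = \int[dSS]_x (f x)%:E)%E.
Proof.
move=> mf f0.
have mfe : measurable_fun setT (fun x : RM => (f (expR x))%:E).
  by apply/measurable_EFinP; apply: measurableT_comp => //; exact: measurable_expR.
have mln : measurable_fun [set: RM] (@ln R : RM -> RM) by exact: measurable_ln.
transitivity (\int[dSS]_x (f (expR (ln x)))%:E)%E; last first.
  apply: ae_eq_integral => //.
  - by apply: (measurableT_comp mfe); exact: mln.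
  - exact/measurable_EFinP.
  - by apply: filterS ae_dS_over_S_gt0 => x x0 _; rewrite lnK.
have := @ge0_integral_pushforward _ _ _ _ _ _ mln dSS setT _ measurableT mfe.
rewrite preimage_setT => <-; last by move=> x _; rewrite lee_fin.
apply: eq_measure_integral => A mA _; apply/esym; exact: dS_over_S_preimage_ln.
Qed.

Lemma sq_integrable_comp_exp (f : R -> R[i]) : f \in sq_integrable dSS ->
  (fun x => f (expR x)) \in sq_integrable leb.
Proof.
move=> /sq_integrableP[[mr mi] If]; apply/sq_integrableP; split.
  by split; [exact: (measurableT_comp mr (@measurable_expR R))|
    exact: (measurableT_comp mi (@measurable_expR R))].
rewrite (ge0_integral_comp_exp (f := fun x => sqmod (f x)))//.
  exact: measurable_sqmod.
by move=> x; exact: sqmod_ge0.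
Qed.

Lemma rep_Q_0 (f : H_0 R) : {ae leb, forall x : RM, rep (Q_0 f) x = rep f (expR x)}.
Proof. by apply: rep_class; apply: sq_integrable_comp_exp; exact: rep_sq. Qed.

Lemma Q_0_unitary : unitary (@Q_0 R).
Proof.
split.
- move=> f g; apply: L2_ext.
  apply: filterS3 (rep_Q_0 (f + g)) (ae_comp_exp (repD f g))
    (filterI (repD (Q_0 f) (Q_0 g)) (filterI (rep_Q_0 f) (rep_Q_0 g))).
  by move=> x /= -> -> [-> [-> ->]].
- move=> a f; apply: L2_ext.
  apply: filterS3 (rep_Q_0 (a *: f)) (ae_comp_exp (repZ a f))
    (filterI (repZ a (Q_0 f)) (rep_Q_0 f)).
  by move=> x /= -> -> [-> ->].
- move=> f; apply: EFin_inj.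
  rewrite N2_class; last by apply: sq_integrable_comp_exp; exact: rep_sq.
  rewrite (ge0_integral_comp_exp (f := fun x => sqmod (rep f x))) ?N2E//.
    by apply: measurable_sqmod; exact: cmeasurable_rep.
  by move=> x; exact: sqmod_ge0.
- move=> g; pose f x := rep g (ln x).
  have mf : cmeasurable (f : RM -> R[i]).
    have [mr mi] := cmeasurable_rep g.
    by split; [exact: (measurableT_comp mr (@measurable_ln R))|
      exact: (measurableT_comp mi (@measurable_ln R))].
  have sf : f \in sq_integrable dSS.
    apply/sq_integrableP; split=> //.
    rewrite -(ge0_integral_comp_exp (f := fun x => sqmod (f x))).
    - by rewrite /f; under eq_integral do rewrite expRK; rewrite N2E ltry.
    - exact: measurable_sqmod.
    - by move=> x; exact: sqmod_ge0.
  exists (L2class dSS f); apply: L2_ext.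
  apply: filterS2 (rep_Q_0 (L2class dSS f)) (ae_comp_exp (rep_class sf)) => x -> ->.
  by rewrite /f expRK.
Qed.

End LogChangeOfVariable.

(** * Integral kernels *)

Section BoundedKernel.
Context d1 d2 (T1 : measurableType d1) (T2 : measurableType d2) (R : realType).
Variables (m1 : {sigma_finite_measure set T1 -> \bar R})
  (m2 : {sigma_finite_measure set T2 -> \bar R}).

(** Tonelli's theorem applied to the positive and negative parts. Integrability is not assumed:
    where the integral is infinite, [fine] returns a default value and remains measurable. *)
Lemma measurable_fun_Rintegral_snd (F : T1 -> T2 -> R) :
  measurable_fun setT (fun z : T1 * T2 => F z.1 z.2) ->
  measurable_fun setT (fun x => \int[m2]_y F x y)%R.
Proof.
move=> mF; rewrite /Rintegral; apply: measurableT_comp => //.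
have mEF : measurable_fun setT (fun z : T1 * T2 => (F z.1 z.2)%:E).
  exact/measurable_EFinP.
under eq_fun do rewrite integralE.
have mp := measurable_funepos mEF; have mn := measurable_funeneg mEF.
rewrite !unlock in mp mn *; apply: emeasurable_funB.
  apply: (@measurable_fun_fubini_tonelli_F _ _ _ _ _ m2
    (fun z => maxe (F z.1 z.2)%:E 0%E)); first exact: mp.
  by move=> z; rewrite le_max lexx orbT.
apply: (@measurable_fun_fubini_tonelli_F _ _ _ _ _ m2
    (fun z => maxe (- (F z.1 z.2)%:E) 0)%E); first exact: mn.
by move=> z; rewrite le_max lexx orbT.
Qed.

Lemma measurable_section_fst (F : T1 -> T2 -> R) (x : T1) :
  measurable_fun setT (fun z : T1 * T2 => F z.1 z.2) ->
  measurable_fun setT (F x).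
Proof. by move=> mF; apply: (measurableT_comp mF (pair1_measurable x)). Qed.

Lemma measurable_section_snd (F : T1 -> T2 -> R) (y : T2) :
  measurable_fun setT (fun z : T1 * T2 => F z.1 z.2) ->
  measurable_fun setT (F^~ y).
Proof. by move=> mF; apply: (measurableT_comp mF (pair2_measurable y)). Qed.
End BoundedKernel.

Lemma integrable_bounded_mul d (T : measurableType d) (R : realType)
    (mu : {measure set T -> \bar R}) (K w : T -> R) (M : R) :
  measurable_fun setT K -> (forall y, `|K y| <= M) ->
  mu.-integrable setT (EFin \o w) -> mu.-integrable setT (EFin \o (fun y => K y * w y)).
Proof.
move=> mK KM iw; have mw : measurable_fun setT w.
  by apply/measurable_EFinP; exact: measurable_int iw.
apply: (@le_integrable _ _ _ mu setT _ _ (fun y => M%:E * (EFin \o w) y)%E) => //.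
- by apply/measurable_EFinP; exact: measurable_funM.
- move=> y _ /=; rewrite lee_fin !normrM ler_wpM2r//.
  by rewrite (le_trans (KM y))// ler_norm.
- exact: integrableZl.
Qed.

Lemma normr_Rintegral_bounded_le d (T : measurableType d) (R : realType)
    (mu : {measure set T -> \bar R}) (K w : T -> R) (M : R) :
  measurable_fun setT K -> (forall y, `|K y| <= M) ->
  mu.-integrable setT (EFin \o w) ->
  `|\int[mu]_y (K y * w y)| <= M * (\int[mu]_y `|w y|).
Proof.
move=> mK KM iw; have iKw := integrable_bounded_mul mK KM iw.
apply: (le_trans (le_normr_Rintegral _ iKw)) => //.
rewrite -RintegralZl//; last exact: (integrable_norm iw).
apply: le_Rintegral => //.
- exact: (integrable_norm iKw).
- have h : mu.-integrable setT (fun y => M%:E * (`|w y|)%:E)%E.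
    by apply: integrableZl => //; exact: integrable_norm iw.
  exact: h.
- by move=> y _; rewrite normrM ler_wpM2r.
Qed.

Section FubiniBoundedKernel.
Context d1 d2 (T1 : measurableType d1) (T2 : measurableType d2) (R : realType).
Variables (m1 : {sigma_finite_measure set T1 -> \bar R})
  (m2 : {sigma_finite_measure set T2 -> \bar R}).

(** The form in which Fubini's theorem is used below: a bounded kernel between two integrable
    functions, so that [M * |u x| * |w y|] dominates the integrand on the product. *)
Lemma Rintegral_kernel_swap (K : T1 -> T2 -> R) (u : T1 -> R) (w : T2 -> R) (M : R) : 0 <= M ->
  measurable_fun setT (fun z : T1 * T2 => K z.1 z.2) ->
  (forall x y, `|K x y| <= M) ->
  m1.-integrable setT (EFin \o u) -> m2.-integrable setT (EFin \o w) ->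
  (\int[m1]_x (u x * \int[m2]_y (K x y * w y)) =
   \int[m2]_y (w y * \int[m1]_x (K x y * u x)))%R.
Proof.
move=> M_ge0 mK KM iu iw.
have mu : measurable_fun setT u by apply/measurable_EFinP; exact: measurable_int iu.
have mw : measurable_fun setT w by apply/measurable_EFinP; exact: measurable_int iw.
pose F x y := K x y * w y * u x.
have mF : measurable_fun setT (fun z : T1 * T2 => (F z.1 z.2)%:E).
  apply/measurable_EFinP; apply: measurable_funM; first apply: measurable_funM => //.
    by apply: (measurableT_comp mw); exact: measurable_snd.
  by apply: (measurableT_comp mu); exact: measurable_fst.
have iKw x : m2.-integrable setT (EFin \o (fun y => K x y * w y)).
  by apply: integrable_bounded_mul => //; exact: measurable_section_fst.
have iKu y : m1.-integrable setT (EFin \o (fun x => K x y * u x)).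
  by apply: (@integrable_bounded_mul _ _ _ _ (K^~ y)) => //; exact: measurable_section_snd.
have iF : (m1 \x m2)%E.-integrable setT (fun z => (F z.1 z.2)%:E).
  apply/integrable12ltyP => //.
  apply: (@le_lt_trans _ _ (\int[m1]_x (`|(u x)%:E| * (M * \int[m2]_y `|w y|)%:E))%E).
    have M0 : 0 <= M * (\int[m2]_y `|w y|)%R by rewrite mulr_ge0// Rintegral_ge0.
    apply: ge0_le_integral => //.
    - by move=> x _; exact: integral_ge0.
    - apply: (@measurable_fun_fubini_tonelli_F _ _ _ _ _ m2
    ((fun z : T1 * T2 => `|(F z.1 z.2)%:E|)%E)) => //.
      exact: measurableT_comp.
    - by apply: emeasurable_funM => //; apply: measurableT_comp => //; exact/measurable_EFinP.
    - move=> x _ /=; under eq_integral do rewrite /F normrM EFinM.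
      rewrite ge0_integralZr//; last 1 first.
      + by apply/measurable_EFinP; apply: measurableT_comp => //; apply/measurable_EFinP; exact: measurable_int (iKw x).
      rewrite muleC lee_wpmul2l//.
      have /integrable_norm iKwn := iKw x.
      have iwn := integrable_norm iw.
      rewrite (_ : (\int[m2]_y _)%E = (\int[m2]_y `|K x y * w y|)%R%:E); last first.
        by rewrite /Rintegral fineK//; exact: (integrable_fin_num measurableT iKwn).
      rewrite lee_fin -RintegralZl//; apply: le_Rintegral => //.
      + have h : m2.-integrable setT (fun y => M%:E * (`|w y|)%:E)%E.
          by apply: integrableZl => //; exact: integrable_norm iw.
        exact: h.
      + by move=> y _; rewrite normrM ler_wpM2r.
  rewrite ge0_integralZr//; last 2 first.
  - by apply: measurableT_comp => //; exact: measurable_int iu.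
  - by rewrite lee_fin mulr_ge0// Rintegral_ge0.
  have /integrable_norm/(integrable_fin_num measurableT) := iu.
  by move=> /fineK <-; rewrite -EFinM ltry.
have := Fubini iF; rewrite /F/= => FF.
rewrite /Rintegral; congr fine; transitivity (\int[m1]_x \int[m2]_y (F x y)%:E)%E.
  apply: eq_integral => x _; rewrite /F EFinM fineK; last first.
    exact: (integrable_fin_num measurableT (iKw x)).
  under [RHS]eq_integral do rewrite EFinM.
  by rewrite (integralZr _ (iKw x))// muleC.
rewrite FF; apply: eq_integral => y _; rewrite EFinM fineK; last first.
  exact: (integrable_fin_num measurableT (iKu y)).
under [LHS]eq_integral do rewrite mulrAC EFinM.
by rewrite (integralZr _ (iKu y))// muleC.
Qed.

End FubiniBoundedKernel.

(** * Plancherel identity for real functions *)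

Section AbelWeight.
Variable R : realType.
Local Notation leb := (@lebesgue_measure R).
Local Notation RM := (measurableTypeR R).

Lemma is_derive_mull (c k : R) : is_derive k 1 (fun k : R => c * k) c.
Proof.
have := is_deriveZ c (is_derive_id k (1 : R)).
by rewrite /GRing.scale/= mulr1.
Qed.

Lemma is_derive_expR_mull (c k : R) :
  is_derive k 1 (fun k => expR (c * k)) (c * expR (c * k)).
Proof.
have := is_derive1_comp (is_derive_expR (c * k)) (is_derive_mull c k).
by rewrite mulrC.
Qed.

Lemma is_derive_sin_mull (c k : R) :
  is_derive k 1 (fun k => sin (c * k)) (c * cos (c * k)).
Proof.
have := is_derive1_comp (is_derive_sin (c * k)) (is_derive_mull c k).
by rewrite mulrC.
Qed.

Lemma is_derive_cos_mull (c k : R) :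
  is_derive k 1 (fun k => cos (c * k)) (- c * sin (c * k)).
Proof.
have := is_derive1_comp (is_derive_cos (c * k)) (is_derive_mull c k).
by rewrite mulrC mulrN mulNr.
Qed.

Lemma continuous_expR_mull (c : R) : continuous (fun k : R => expR (c * k)).
Proof.
by move=> x; apply: differentiable_continuous; apply/derivable1_diffP;
  have [] := is_derive_expR_mull c x.
Qed.

Lemma ge0_integral_derive_y (f F : R -> R) (a l : R) : (forall x, 0 <= f x) ->
  continuous f -> (forall x : R, is_derive x (1 : R) F (f x)) -> F x @[x --> +oo%R] --> l ->
  (\int[leb]_(x in `[a, +oo[) (f x)%:E = (l - F a)%:E)%E.
Proof.
move=> f0 cf dF Fl; rewrite (@ge0_continuous_FTC2y _ f F a l) ?EFinB//.
- exact: continuous_subspaceT.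
- apply: cvg_at_right_filter; apply: differentiable_continuous.
  by apply/derivable1_diffP; have [] := dF a.
- by move=> x _; rewrite derive1E; have [] := dF x.
Qed.

Lemma cvg_expR_mull (e : R) : 0 < e -> expR (- e * k) @[k --> +oo%R] --> (0 : R).
Proof.
move=> e0; apply/cvgrPdist_lt => d d0.
have /cvgrPdist_lt/(_ d d0)[A [Ar AH]] := @cvgr_expR R.
exists (A / e); split; first exact: num_real.
by move=> k; rewrite ltr_pdivrMr// mulNr mulrC; exact: AH.
Qed.

Lemma integral_expR_mull (e : R) : 0 < e ->
  (\int[leb]_(k in `[0%R, +oo[) (expR (- e * k))%:E = (e^-1)%:E)%E.
Proof.
move=> e0.
have D (x : R) : is_derive x (1 : R) (fun k => - e^-1 * expR (- e * k)) (expR (- e * x)).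
  apply: is_derive_eq (is_deriveZ (- e^-1) (is_derive_expR_mull (- e) x)) _.
  by rewrite /GRing.scale/= mulrA mulrNN mulVf ?mul1r// gt_eqF.
have L : - e^-1 * expR (- e * k) @[k --> +oo%R] --> (0 : R).
  rewrite -[X in _ --> X](mulr0 (- e^-1)); apply: cvgM; first exact: cvg_cst.
  exact: cvg_expR_mull.
rewrite (ge0_integral_derive_y 0 _ _ D L).
- by rewrite mulr0 expR0 mulr1 sub0r opprK.
- by move=> x; exact: expR_ge0.
- exact: continuous_expR_mull.
Qed.

(** The summand [1] keeps the integrand nonnegative, as the fundamental theorem on a half-line
    requires; its own contribution [e^-1] is subtracted in [Rintegral_cos_abel_weight]. *)
Lemma integral_expR_mull_cos (e x : R) : 0 < e ->
  (\int[leb]_(k in `[0%R, +oo[) (expR (- e * k) * (1 + cos (x * k)))%:E =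
   (e^-1 + e / (e ^+ 2 + x ^+ 2))%:E)%E.
Proof.
move=> e0; have d0 : 0 < e ^+ 2 + x ^+ 2 by rewrite ltr_wpDr ?sqr_ge0// exprn_gt0.
pose c := (e ^+ 2 + x ^+ 2)^-1.
(* [expR (- e * k) * G k] is an antiderivative: the trigonometric part of [G] is the real part of
   [exp (i x k) / (- e + i x)]. *)
pose G (k : R) := - e^-1 + (c * x * sin (x * k) + (- (c * e)) * cos (x * k)).
have DG (k : R) : is_derive k (1 : R) G (x * (c * x * cos (x * k) + c * e * sin (x * k))).
  have := is_deriveD (is_derive_cst (- e^-1) k (1 : R))
    (is_deriveD (is_deriveZ (c * x) (is_derive_sin_mull x k))
                (is_deriveZ (- (c * e)) (is_derive_cos_mull x k))).
  by move=> h; apply: (is_derive_eq h); rewrite /GRing.scale/=; ring.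
have D (k : R) : is_derive k (1 : R) (fun k => expR (- e * k) * G k)
    (expR (- e * k) * (1 + cos (x * k))).
  have := is_deriveM (is_derive_expR_mull (- e) k) (DG k).
  move=> h; apply: (is_derive_eq h); rewrite /GRing.scale/= /G /c; field.
  by rewrite gt_eqF//= gt_eqF.
have L : expR (- e * k) * G k @[k --> +oo%R] --> (0 : R).
  pose M := e^-1 + (`|c * x| + `|c * e|).
  have h0 : expR (- e * k) * M @[k --> +oo%R] --> (0 : R).
    rewrite -[X in _ --> X](mul0r M); apply: cvgM; last exact: cvg_cst.
    exact: cvg_expR_mull.
  apply/norm_cvg0P; apply: (squeeze_cvgr _ _ h0); last exact: cvg_cst.
  near=> k; rewrite normr_ge0/= normrM ger0_norm ?expR_ge0// ler_wpM2l ?expR_ge0//.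
  rewrite /G /M (le_trans (ler_normD _ _))// lerD//.
    by rewrite normrN ger0_norm// invr_ge0 ltW.
  rewrite (le_trans (ler_normD _ _))// !normrM normrN lerD//.
    by rewrite ler_piMr ?mulr_ge0// ler_norml sin_geN1 sin_le1.
  by rewrite normrM ler_piMr ?mulr_ge0// ler_norml cos_geN1 cos_le1.
rewrite (ge0_integral_derive_y 0 _ _ D L).
- rewrite mulr0 expR0 mul1r /G mulr0 sin0 cos0 /c; congr EFin; field.
  by rewrite gt_eqF//= gt_eqF.
- by move=> k; rewrite mulr_ge0 ?expR_ge0// -lerBlDl sub0r cos_geN1.
- move=> k; have [h _] := is_deriveM (is_derive_expR_mull (- e) k)
    (is_deriveD (is_derive_cst (1 : R) k (1 : R)) (is_derive_cos_mull x k)).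
  by move/derivable1_diffP : h => /differentiable_continuous.
Unshelve. all: by end_near. Qed.

(** The half-line is encoded as an indicator, so that the weight is an integrable function on the
    whole line and can enter [Rintegral_kernel_swap]. *)
Definition abel_weight (e : R) (k : RM) : R := expR (- e * k) * \1_(`[0, +oo[ : set R) k.

Lemma abel_weight_ge0 e k : 0 <= abel_weight e k.
Proof. by rewrite mulr_ge0 ?expR_ge0// indicE. Qed.

Lemma measurable_mull (c : R) : measurable_fun [set: RM] (fun k : RM => c * k : RM).
Proof. by apply: measurable_funM => //; exact: measurable_cst. Qed.

Lemma measurable_abel_weight e : measurable_fun setT (abel_weight e).
Proof.
apply: measurable_funM; last exact: measurable_indic.
exact: (measurableT_comp (@measurable_expR R) (measurable_mull (- e))).
Qed.

Lemma integral_abel_weightE (e : R) (g : RM -> R) :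
  (\int[leb]_(k in `[0%R, +oo[) (expR (- e * k) * g k)%:E =
   \int[leb]_k (g k * abel_weight e k)%:E)%E.
Proof.
rewrite integral_mkcond; apply: eq_integral => k _.
rewrite patchE /abel_weight indicE; case: ifP => _ /=; last by rewrite !mulr0.
by rewrite mulr1 mulrC.
Qed.

Lemma integral_abel_weight (e : R) : 0 < e ->
  (\int[leb]_k (abel_weight e k)%:E = (e^-1)%:E)%E.
Proof.
move=> e0; have := integral_abel_weightE e (fun=> 1); rewrite -integral_expR_mull//.
by under [LHS]eq_integral do rewrite mulr1; under [in RHS]eq_integral do rewrite mul1r.
Qed.

Lemma integrable_abel_weight (e : R) : 0 < e -> leb.-integrable setT (EFin \o abel_weight e).
Proof.
move=> e0; apply/integrableP; split.
  by apply/measurable_EFinP; exact: measurable_abel_weight.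
under eq_integral do rewrite gee0_abs ?lee_fin ?abel_weight_ge0//.
by rewrite integral_abel_weight// ltry.
Qed.

Lemma measurable_cos : measurable_fun [set: RM] (@cos R : RM -> RM).
Proof. by apply: continuous_measurable_fun; exact: continuous_cos. Qed.

Lemma measurable_sin : measurable_fun [set: RM] (@sin R : RM -> RM).
Proof. by apply: continuous_measurable_fun; exact: continuous_sin. Qed.

Lemma measurable_cos_mull (c : R) : measurable_fun [set: RM] (fun k : RM => cos (c * k)).
Proof. exact: (measurableT_comp measurable_cos (measurable_mull c)). Qed.

Lemma Rintegral_cos_abel_weight (e x : R) : 0 < e ->
  \int[leb]_k (cos (x * k) * abel_weight e k) = e / (e ^+ 2 + x ^+ 2).
Proof.
move=> e0; have i1 := integrable_abel_weight e0.
have i2 : leb.-integrable setT (EFin \o (fun k => cos (x * k) * abel_weight e k)).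
  apply: (@integrable_bounded_mul _ _ _ leb _ _ 1 _ _ i1).
    exact: measurable_cos_mull.
  by move=> k; rewrite ler_norml cos_geN1 cos_le1.
have E1 : \int[leb]_k (abel_weight e k) = e^-1.
  by rewrite /Rintegral integral_abel_weight.
have := integral_abel_weightE e (fun k => 1 + cos (x * k)).
rewrite integral_expR_mull_cos//.
under eq_integral do rewrite mulrDl mul1r.
move=> /(congr1 fine)/= E2.
have := RintegralD measurableT i1 i2; rewrite /Rintegral -E2 -/(Rintegral _ _ _) E1.
by move=> /addrI.
Qed.

End AbelWeight.

(** * Affine substitutions in Lebesgue integrals *)

Section AffineChangeOfVariable.
Variable R : realType.
Local Notation leb := (@lebesgue_measure R).
Local Notation RM := (measurableTypeR R).
Variables (a e : R).
Hypothesis e0 : 0 < e.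

Let affine (t : RM) : RM := a + e * t.

Lemma measurable_affine : measurable_fun [set: RM] affine.
Proof.
apply: measurable_funD; first exact: measurable_cst.
by apply: measurable_funM => //; exact: measurable_cst.
Qed.

(** The rescaled pushforward gives length [c - b] to []b, c]], hence is Lebesgue measure by
    uniqueness. *)
Lemma lebesgue_measure_affine (A : set RM) : measurable A ->
  (e%:E * leb (affine @^-1` A))%E = leb A.
Proof.
move=> mA; have mf := measurable_affine.
pose k : {nonneg R} := NngNum (ltW e0).
pose P : {measure set RM -> \bar R} :=
  measure_function_pushforward__canonical__measure_function_Measure leb mf.
transitivity (mscale k P A); first by [].
apply: esym; unshelve apply: lebesgue_measure_unique mA => //=.
move=> _ [[b c]] /= _ <-; rewrite /mscale/= /pushforward.
have -> : affine @^-1` `]b, c] = `](b - a) / e, (c - a) / e]%classic.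
  apply/seteqP; split => x /=; rewrite !in_itv/= /affine.
    by rewrite ltr_pdivrMr// ler_pdivlMr// ltrBlDl lerBrDl [x * e]mulrC.
  by rewrite ltr_pdivrMr// ler_pdivlMr// ltrBlDl lerBrDl [x * e]mulrC.
rewrite !lebesgue_measure_itv/= !lte_fin ltr_pM2r ?invr_gt0// ltrD2r.
case: ifP => _; last by rewrite mule0.
rewrite -!EFinB -EFinM; congr EFin; field; exact: lt0r_neq0.
Qed.

Lemma ge0_integral_affine (f : RM -> \bar R) : measurable_fun [set: RM] f ->
  (forall x, 0 <= f x)%E ->
  (\int[leb]_x f x = e%:E * \int[leb]_t f (affine t))%E.
Proof.
move=> mf f0; have mA := measurable_affine.
pose k : {nonneg R} := NngNum (ltW e0).
pose P : {measure set RM -> \bar R} :=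
  measure_function_pushforward__canonical__measure_function_Measure leb mA.
have := @ge0_integral_pushforward _ _ _ _ _ _ mA leb setT _ measurableT mf.
rewrite preimage_setT => <-; last by move=> x _; exact: f0.
transitivity (\int[mscale k P]_x f x)%E; last first.
  by rewrite ge0_integral_mscale.
apply: eq_measure_integral => A mA' _; apply: esym; exact: lebesgue_measure_affine.
Qed.

Lemma integrable_affine (f : RM -> R) : leb.-integrable [set: RM] (EFin \o f) ->
  leb.-integrable [set: RM] (EFin \o (f \o affine)).
Proof.
move=> /integrableP[mf If]; apply/integrableP; split.
  exact: (measurableT_comp mf measurable_affine).
move: If; rewrite (ge0_integral_affine (f := fun x => `|(EFin \o f) x|%E))//.
  rewrite /=; have : (0 <= \int[leb]_t `|f (affine t)|%:E)%E.
    by apply: integral_ge0 => t _; rewrite lee_fin.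
  case: (integral _ _ _) => [r _ _|_|//]; first exact: ltry.
  by rewrite gt0_muley// lte_fin.
exact: measurableT_comp.
Qed.

Lemma Rintegral_affine (f : RM -> R) : leb.-integrable [set: RM] (EFin \o f) ->
  \int[leb]_x f x = e * \int[leb]_t f (affine t).
Proof.
move=> If; have Ifa := integrable_affine If.
have mf : measurable_fun [set: RM] (EFin \o f) by exact: measurable_int If.
rewrite /Rintegral -[e in RHS]/(fine e%:E) -fineM//; last first.
  exact: (integrable_fin_num measurableT Ifa).
congr fine; rewrite integralE [in RHS]integralE muleBr//; last first.
  apply: fin_num_adde_defl; rewrite fin_numN.
  exact: (integrable_fin_num measurableT (integrable_funeneg measurableT Ifa)).
congr (_ - _)%E.
  rewrite ge0_integral_affine//; last exact: measurable_funepos.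
  by congr (_ * _)%E; apply: eq_integral => x _; rewrite !funeposE.
rewrite ge0_integral_affine//; last exact: measurable_funeneg.
by congr (_ * _)%E; apply: eq_integral => x _; rewrite !funenegE.
Qed.

End AffineChangeOfVariable.

Lemma Rintegral_dominated_cvg d (T : measurableType d) (R : realType)
    (mu : {measure set T -> \bar R}) (f_ : nat -> T -> R) (f g : T -> R) :
  (forall n, measurable_fun setT (f_ n)) ->
  (forall x, f_ ^~ x @ \oo --> f x) ->
  mu.-integrable setT (EFin \o g) -> (forall n x, `|f_ n x| <= g x) ->
  (fun n => \int[mu]_x f_ n x)%R @ \oo --> (\int[mu]_x f x)%R.
Proof.
move=> mf ff ig fg; have mf' n : measurable_fun setT (EFin \o f_ n).
  exact/measurable_EFinP.
have ff' x : setT x -> (fun n => (EFin \o f_ n) x) @ \oo --> (EFin \o f) x.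
  by move=> _; apply: cvg_EFin; [exact: nearW|exact: ff].
have fg' n x : setT x -> (`|(EFin \o f_ n) x| <= (EFin \o g) x)%E.
  by move=> _; rewrite /= lee_fin.
have gf x : setT x -> (EFin \o g) x \is a fin_num by [].
have c := dominated_cvg measurableT mf' ff' gf ig fg'.
have If : mu.-integrable setT (EFin \o f).
  apply: (le_integrable measurableT _ _ ig).
    by apply/measurable_EFinP; apply: measurable_fun_cvg (fun x _ => ff x).
  move=> x _; rewrite /= lee_fin (le_trans _ (ler_norm _))//.
  have /cvg_norm cn := ff x; rewrite -(cvg_lim _ cn)//.
  by apply: limr_le; [apply/cvg_ex; eexists; exact: cn|exact: nearW].
apply: fine_cvg; rewrite fineK//; exact: (integrable_fin_num measurableT If).
Qed.

(** * Bounded functions with compact support and their autocorrelation *)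

Section CompactSupport.
Variable R : realType.
Local Notation leb := (@lebesgue_measure R).
Local Notation RM := (measurableTypeR R).

Definition bounded_compact_support (a : RM -> R) : Prop :=
  [/\ measurable_fun setT a, exists M, forall x, `|a x| <= M &
      exists N, forall x : R, N <= `|x| -> a x = 0].
Local Notation bcs := bounded_compact_support.

Lemma bcs_bounds a : bcs a -> exists M N : R, [/\ 0 <= M, 0 < N,
  forall x, `|a x| <= M & forall x : R, N <= `|x| -> a x = 0].
Proof.
move=> [_ [M HM] [N HN]]; exists M, (Num.max N 1); split => //.
- exact: le_trans (HM 0).
- by rewrite lt_max ltr01 orbT.
- by move=> x; rewrite ge_max => /andP[/HN].
Qed.

Lemma integrable_cst_indic_itv (M N : R) :
  leb.-integrable [set: RM] (EFin \o (fun x => M * \1_(`[- N, N]%classic : set R) x)).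
Proof.
apply: (@integrable_bounded_mul _ RM _ leb (fun=> M) _ `|M|) => //.
exact: integrable_indic_itv.
Qed.

Lemma bcs_le_indic a : bcs a -> exists M N : R, forall x, `|a x| <= M * \1_(`[- N, N]%classic : set R) x.
Proof.
move=> /bcs_bounds[M [N [M0 N0 HM HN]]]; exists M, N => x.
rewrite indicE; case: (boolP (x \in _)) => [_|]; first by rewrite mulr1.
rewrite notin_setE/= in_itv/= -ler_norml => /negP; rewrite -ltNge => /ltW/HN ->.
by rewrite normr0 mulr0.
Qed.

Lemma bcs_integrable a : bcs a -> leb.-integrable setT (EFin \o a).
Proof.
move=> ba; have [M [N H]] := bcs_le_indic ba.
apply: (le_integrable measurableT _ _ (integrable_cst_indic_itv M N)).
  by apply/measurable_EFinP; have [] := ba.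
by move=> x _; rewrite /= lee_fin (le_trans (H x))// ler_norm.
Qed.

(** The autocorrelation of [a]. Its value at [0] is the integral of [a ^+ 2], so the Plancherel
    identity amounts to recovering this value from the power spectrum. *)
Definition correlation (a : RM -> R) (z : R) := \int[leb]_x (a (z + x) * a x).

Lemma measurable_shift (z : R) : measurable_fun [set: RM] (fun x : RM => z + x : RM).
Proof. by apply: measurable_funD => //; exact: measurable_cst. Qed.

Lemma normr_correlation_le a M z : bcs a -> (forall x, `|a x| <= M) ->
  `|correlation a z| <= M * \int[leb]_x `|a x|.
Proof.
move=> ba aM; apply: normr_Rintegral_bounded_le => //; last exact: bcs_integrable.
by apply: (measurableT_comp _ (measurable_shift z)); have [] := ba.
Qed.

Lemma bounded_on_itv (g : R -> R) (N : R) : 0 < N -> continuous g ->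
  exists B, forall x, `|x| <= N -> `|g x| <= B.
Proof.
move=> N0 cg; have cn : {within `[- N, N], continuous (fun x => `|g x|)}.
  by apply: continuous_subspaceT => x; apply: cvg_norm; exact: cg.
have NN : - N <= N by rewrite (@le_trans _ _ 0)// ?oppr_le0 ltW.
have [c _ cB] := EVT_max NN cn.
by exists `|g c| => x xN; apply: cB; rewrite in_itv/= -ler_norml.
Qed.

(** Translations of [a] need not converge pointwise. One of the two factors is therefore replaced by
    [h], a continuous function cut off to [[- N, N]] and close to [a] in L^1; the error is uniform
    in the shift because the other factor is bounded by [M]. *)
Lemma cvg_correlation a (z : nat -> R) : bcs a -> z @ \oo --> (0 : R) ->
  (fun n => correlation a (z n)) @ \oo --> correlation a 0.
Proof.
move=> ba z0; have ia := bcs_integrable ba; have [ma _ _] := ba.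
have [M [N [M0 N0 aM aN]]] := bcs_bounds ba.
pose D : set RM := `[- N, N]%classic.
have mD : measurable D by exact: measurable_itv.
have DE (x : R) : (x \in D) = (`|x| <= N).
  by apply/idP/idP; rewrite inE /D/= in_itv/= -ler_norml.
have lD : (leb D < +oo)%E.
  by rewrite lebesgue_measure_itv/=; case: ifP => // _; rewrite -EFinB ltry.
have iaD : leb.-integrable D (EFin \o a).
  exact: (integrableS measurableT mD (@subsetT _ _) ia).
apply/cvgrPdist_lt => eta eta0.
(* The replacement costs at most [M * eta' <= eta / 4] at [z n] and again at [0], leaving [eta / 2]
   for the convergence of [Ch]. The [+ 1] keeps the denominator positive when [M = 0]. *)
pose eta' := eta / (4 * (M + 1)).
have M1 : 0 < M + 1 by lra.
have eta'0 : 0 < eta' by rewrite divr_gt0// mulr_gt0.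
have [g_ [cg ig /fine_cvgP[fg /cvgrPdist_lt/(_ _ eta'0)]]] :=
  approximation_continuous_integrable mD lD iaD.
move=> [n0 _ /(_ n0 (leqnn _))]; rewrite sub0r normrN => gn0.
pose g := g_ n0; pose h : RM -> R := fun x => g x * \1_D x.
have mg : measurable_fun [set: RM] (g : RM -> R).
  by apply: continuous_measurable_fun; exact: cg.
have mh : measurable_fun setT h.
  by apply: measurable_funM => //; exact: measurable_indic.
have [B gB] := bounded_on_itv N0 (cg n0).
have hB x : `|h x| <= `|B|.
  rewrite /h indicE DE; case: (boolP (`|x| <= N)) => [/gB xB|_]; last first.
    by rewrite mulr0 normr0.
  by rewrite mulr1 (le_trans xB)// ler_norm.
have ih : leb.-integrable setT (EFin \o h).
  apply: (le_integrable measurableT _ _ (integrable_cst_indic_itv `|B| N)).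
    exact/measurable_EFinP.
  move=> x _; rewrite /= lee_fin (le_trans _ (ler_norm _))//.
  have := hB x; rewrite /h -/D indicE; case: (x \in D); first by rewrite !mulr1.
  by rewrite !mulr0 normr0.
have shift_a s : measurable_fun setT (fun x : RM => a (s + x)).
  exact: (measurableT_comp ma (measurable_shift s)).
pose Ch s := \int[leb]_x (a (s + x) * h x).
have iah : leb.-integrable setT (EFin \o (fun x => a x - h x)).
  by rewrite /comp; under eq_fun do rewrite EFinB; exact: integrableB.
have diff s : `|correlation a s - Ch s| <= M * eta'.
  rewrite /correlation /Ch -RintegralB//; last 2 first.
  - exact: (integrable_bounded_mul (shift_a s) (fun x => aM (s + x)) ia).
  - exact: (integrable_bounded_mul (shift_a s) (fun x => aM (s + x)) ih).
  under eq_Rintegral do rewrite -mulrBr.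
  apply: le_trans (normr_Rintegral_bounded_le (shift_a s) (fun x => aM (s + x)) iah) _.
  rewrite ler_wpM2l//.
  have -> : \int[leb]_x `|a x - h x| = \int[leb]_(x in D) `|a x - g x|.
    rewrite [RHS]Rintegral_mkcond; apply: eq_Rintegral => x _.
    rewrite patchE /h indicE; case: ifPn => [_|xD]; first by rewrite mulr1.
    by rewrite mulr0 subr0 aN ?normr0// ltW// ltNge -DE.
  exact: le_trans (ler_norm _) (ltW gn0).
have cCh : (fun n => Ch (z n)) @ \oo --> Ch 0.
  (* A translation of the variable moves the shift from [a], which is only measurable, onto [h]. *)
  have E s : Ch s = \int[leb]_x (h (- s + x) * a x).
    rewrite (@Rintegral_affine _ s 1)// ?mul1r; last first.
      exact: (integrable_bounded_mul (measurableT_comp mh (measurable_shift (- s)))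
        (fun x => hB (- s + x)) ia).
    by apply: eq_Rintegral => x _; rewrite mul1r addKr mulrC.
  under eq_fun do rewrite E.
  rewrite E; apply: (@Rintegral_dominated_cvg _ _ _ leb _ _ (fun x => `|B| * `|a x|)).
  - move=> n; apply: measurable_funM => //.
    exact: (measurableT_comp mh (measurable_shift (- z n))).
  - move=> x; rewrite oppr0 add0r.
    (* The jumps of [h] at [- N] and [N] do no harm, because [a] vanishes at these points. Where
       [|x| < N], the shifted point eventually stays in the region where [h] is the continuous
       [g]. *)
    have [xN|xN] := leP N `|x|.
      by rewrite (aN x xN) mulr0; under eq_fun do rewrite mulr0; exact: cvg_cst.
    apply: cvgM; last exact: cvg_cst.
    have zx : (fun n => - z n + x) @ \oo --> x.
      rewrite -[X in _ --> X]add0r -oppr0; apply: cvgD; last exact: cvg_cst.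
      exact: cvgN.
    have hg : {near \oo, (fun n => g (- z n + x)) =1 (fun n => h (- z n + x))}.
      have zxn : (fun n => `|- z n + x|) @ \oo --> `|x| by exact: cvg_norm.
      apply: filterS (cvgr_lt _ zxn N xN) => n nN.
      by rewrite /h indicE DE ltW// mulr1.
    rewrite {2}/h indicE DE ltW// mulr1.
    apply: cvg_trans (near_eq_cvg hg) _.
    exact: (continuous_cvg _ (cg n0 x) zx).
  - have h' : leb.-integrable setT (fun x => `|B|%:E * (`|a x|)%:E)%E.
      by apply: integrableZl => //; exact: integrable_norm ia.
    exact: h'.
  - by move=> n x; rewrite normrM ler_wpM2r.
have Me : M * eta' <= eta / 4.
  rewrite /eta' mulrA ler_pdivrMr ?mulr_gt0//.
  rewrite [leRHS](_ : _ = eta * (M + 1)); last by field.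
  by rewrite mulrC ler_wpM2l ?(ltW eta0)// lerDl.
have /cvgrPdist_lt/(_ (eta / 2)) := cCh.
have e2 : 0 < eta / 2 by rewrite divr_gt0.
move=> /(_ e2); apply: filterS => n.
have := diff 0; have := diff (z n).
rewrite !ltr_norml !ler_norml => /andP[? ?] /andP[? ?] /andP[? ?].
by apply/andP; split; lra.
Qed.

End CompactSupport.

(** * The Cauchy kernel and its total mass *)

Section CauchyKernel.
Variable R : realType.
Local Notation leb := (@lebesgue_measure R).
Local Notation RM := (measurableTypeR R).

Definition cauchy_kernel (t : RM) : R := (1 + t ^+ 2)^-1.

Lemma oneDsqr_gt0 (t : R) : 0 < 1 + t ^+ 2.
Proof. by rewrite ltr_pwDl// sqr_ge0. Qed.

Lemma cauchy_kernel_ge0 t : 0 <= cauchy_kernel t.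
Proof. by rewrite invr_ge0 ltW// oneDsqr_gt0. Qed.

Lemma continuous_cauchy_kernel : continuous (cauchy_kernel : R -> R).
Proof. exact: continuous_oneDsqrV. Qed.

Lemma measurable_cauchy_kernel : measurable_fun [set: RM] cauchy_kernel.
Proof. by apply: continuous_measurable_fun; exact: continuous_cauchy_kernel. Qed.

Lemma integral_cauchy_kernel : (\int[leb]_t (cauchy_kernel t)%:E = pi%:E)%E.
Proof.
rewrite ge0_symfun_integralT//.
- rewrite (_ : [set x | _] = `[0, +oo[%classic); last first.
    by apply/seteqP; split => x /=; rewrite in_itv/= andbT.
  by rewrite integral0y_oneDsqr -EFinM mulrC divfK.
- exact: cauchy_kernel_ge0.
- exact: continuous_cauchy_kernel.
- by move=> x /=; rewrite /cauchy_kernel sqrrN.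
Qed.

Lemma integrable_cauchy_kernel : leb.-integrable setT (EFin \o cauchy_kernel).
Proof.
apply/integrableP; split.
  by apply/measurable_EFinP; exact: measurable_cauchy_kernel.
under eq_integral do rewrite gee0_abs ?lee_fin ?cauchy_kernel_ge0//.
by rewrite integral_cauchy_kernel ltry.
Qed.

End CauchyKernel.

(** * The Plancherel identity on a half-line for real functions *)

Section RealPlancherel.
Variable R : realType.
Local Notation leb := (@lebesgue_measure R).
Local Notation RM := (measurableTypeR R).
Local Notation bcs := (@bounded_compact_support R).

Definition fcos (a : RM -> R) (k : RM) : R := \int[leb]_x (cos (k * x) * a x).
Definition fsin (a : RM -> R) (k : RM) : R := \int[leb]_x (sin (k * x) * a x).

Lemma normr_cos_le1 (t : R) : `|cos t| <= 1.
Proof. by rewrite ler_norml cos_geN1 cos_le1. Qed.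

Lemma normr_sin_le1 (t : R) : `|sin t| <= 1.
Proof. by rewrite ler_norml sin_geN1 sin_le1. Qed.

Lemma measurable_mul2 : measurable_fun [set: RM * RM] (fun z : RM * RM => z.1 * z.2 : RM).
Proof. by apply: measurable_funM; [exact: measurable_fst|exact: measurable_snd]. Qed.

Lemma measurable_cos2 : measurable_fun [set: RM * RM] (fun z : RM * RM => cos (z.1 * z.2)).
Proof. exact: (measurableT_comp (@measurable_cos R) measurable_mul2). Qed.

Lemma measurable_sin2 : measurable_fun [set: RM * RM] (fun z : RM * RM => sin (z.1 * z.2)).
Proof. exact: (measurableT_comp (@measurable_sin R) measurable_mul2). Qed.

Lemma measurable_cosk (k : RM) : measurable_fun [set: RM] (fun x : RM => cos (k * x)).
Proof. exact: (measurable_section_fst (F := fun k x : RM => cos (k * x)) k measurable_cos2). Qed.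

Lemma measurable_sink (k : RM) : measurable_fun [set: RM] (fun x : RM => sin (k * x)).
Proof. exact: (measurable_section_fst (F := fun k x : RM => sin (k * x)) k measurable_sin2). Qed.

Section Integrable.
Variable a : RM -> R.
Hypothesis ia : leb.-integrable setT (EFin \o a).

Let ma : measurable_fun setT a.
Proof. by apply/measurable_EFinP; exact: measurable_int ia. Qed.

Lemma integrable_cos_mul k : leb.-integrable setT (EFin \o (fun x => cos (k * x) * a x)).
Proof. by apply: integrable_bounded_mul (measurable_cosk k) (fun x => normr_cos_le1 _) ia. Qed.

Lemma integrable_sin_mul k : leb.-integrable setT (EFin \o (fun x => sin (k * x) * a x)).
Proof. by apply: integrable_bounded_mul (measurable_sink k) (fun x => normr_sin_le1 _) ia. Qed.

Lemma measurable_fcos : measurable_fun setT (fcos a).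
Proof.
apply: (@measurable_fun_Rintegral_snd _ _ RM RM R leb (fun k x => cos (k * x) * a x)).
apply: measurable_funM; first exact: measurable_cos2.
exact: (measurableT_comp ma measurable_snd).
Qed.

Lemma measurable_fsin : measurable_fun setT (fsin a).
Proof.
apply: (@measurable_fun_Rintegral_snd _ _ RM RM R leb (fun k x => sin (k * x) * a x)).
apply: measurable_funM; first exact: measurable_sin2.
exact: (measurableT_comp ma measurable_snd).
Qed.

Lemma normr_fcos_le k : `|fcos a k| <= \int[leb]_x `|a x|.
Proof.
rewrite -[leRHS]mul1r; apply: (normr_Rintegral_bounded_le (measurable_cosk k)) => //.
by move=> x; exact: normr_cos_le1.
Qed.

Lemma normr_fsin_le k : `|fsin a k| <= \int[leb]_x `|a x|.
Proof.
rewrite -[leRHS]mul1r; apply: (normr_Rintegral_bounded_le (measurable_sink k)) => //.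
by move=> x; exact: normr_sin_le1.
Qed.

Lemma fcosN k : fcos a (- k) = fcos a k.
Proof. by apply: eq_Rintegral => x _; rewrite mulNr cosN. Qed.

Lemma fsinN k : fsin a (- k) = - fsin a k.
Proof.
rewrite /fsin -[in RHS]mulN1r -RintegralZl//; last exact: integrable_sin_mul.
by apply: eq_Rintegral => x _; rewrite mulNr sinN mulN1r mulNr.
Qed.

Definition power_spectrum (k : RM) : R := fcos a k ^+ 2 + fsin a k ^+ 2.

Lemma measurable_power_spectrum : measurable_fun setT power_spectrum.
Proof.
by apply: measurable_funD; apply: measurable_funX; [exact: measurable_fcos|exact: measurable_fsin].
Qed.

Lemma power_spectrum_ge0 k : 0 <= power_spectrum k.
Proof. by rewrite addr_ge0// sqr_ge0. Qed.

Let I := \int[leb]_x `|a x|.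

Let I_ge0 : 0 <= I. Proof. exact: Rintegral_ge0. Qed.

Lemma power_spectrum_le k : `|power_spectrum k| <= 2 * I ^+ 2.
Proof.
rewrite ger0_norm ?power_spectrum_ge0// [leRHS](_ : _ = I ^+ 2 + I ^+ 2); last by ring.
by rewrite lerD// -[leLHS]real_normK ?num_real// lerXn2r ?nnegrE//;
  [exact: normr_fcos_le|exact: normr_fsin_le].
Qed.

(** The weight makes the frequency variable integrable. Two exchanges then bring the integral over
    [k] inside, one for each factor of the squares, and it is evaluated by
    [Rintegral_cos_abel_weight]. *)
Lemma power_spectrum_abel e : 0 < e ->
  \int[leb]_k (power_spectrum k * abel_weight e k) =
  \int[leb]_x (a x * \int[leb]_y (e / (e ^+ 2 + (x - y) ^+ 2) * a y)).
Proof.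
move=> e0; have iw := integrable_abel_weight e0.
(* Only one factor of each square is expanded as an integral; the other stays as a bounded
   coefficient of the kernel. *)
pose K (k x : RM) := cos (k * x) * fcos a k + sin (k * x) * fsin a k.
have mK : measurable_fun [set: RM * RM] (fun z : RM * RM => K z.1 z.2).
  apply: measurable_funD; apply: measurable_funM.
  - exact: measurable_cos2.
  - exact: (measurableT_comp measurable_fcos measurable_fst).
  - exact: measurable_sin2.
  - exact: (measurableT_comp measurable_fsin measurable_fst).
have KI k x : `|K k x| <= I + I.
  rewrite (le_trans (ler_normD _ _))// lerD// normrM -[leRHS]mul1r ler_pM//.
  - exact: normr_cos_le1.
  - exact: normr_fcos_le.
  - exact: normr_sin_le1.
  - exact: normr_fsin_le.
transitivity (\int[leb]_k (abel_weight e k * \int[leb]_x (K k x * a x))).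
  apply: eq_Rintegral => k _; rewrite mulrC; congr (_ * _).
  rewrite /power_spectrum !expr2 {1}/fcos {1}/fsin.
  rewrite -!RintegralZr//; try exact: integrable_cos_mul; try exact: integrable_sin_mul.
  rewrite -RintegralD//; last 2 first.
  - rewrite /comp; under eq_fun do rewrite EFinM; apply: integrableZr => //; exact: integrable_cos_mul.
  - rewrite /comp; under eq_fun do rewrite EFinM; apply: integrableZr => //; exact: integrable_sin_mul.
  by apply: eq_Rintegral => x _; rewrite /K; ring.
apply: etrans (Rintegral_kernel_swap (addr_ge0 I_ge0 I_ge0) mK KI iw ia) _.
apply: eq_Rintegral => x _; congr (_ * _).
(* The addition formula for [cos] merges the two products, so that only [x - y] remains. *)
have KE k : K k x = \int[leb]_y (cos ((x - y) * k) * a y).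
  rewrite /K /fcos /fsin -!RintegralZl//; try exact: integrable_cos_mul; try exact: integrable_sin_mul.
  rewrite -RintegralD//; last 2 first.
  - rewrite /comp; under eq_fun do rewrite EFinM; apply: integrableZl => //; exact: integrable_cos_mul.
  - rewrite /comp; under eq_fun do rewrite EFinM; apply: integrableZl => //; exact: integrable_sin_mul.
  by apply: eq_Rintegral => y _; rewrite mulrBl ![_ * k]mulrC cosB; ring.
transitivity (\int[leb]_k (abel_weight e k * \int[leb]_y (cos ((x - y) * k) * a y))).
  by apply: eq_Rintegral => k _; rewrite mulrC KE.
rewrite (@Rintegral_kernel_swap _ _ RM RM R leb leb
  (fun k y => cos ((x - y) * k)) (abel_weight e) a 1)//; last 2 first.
- apply: (measurableT_comp (@measurable_cos R)).
  apply: measurable_funM; last exact: measurable_fst.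
  apply: measurable_funB; first exact: measurable_cst.
  exact: measurable_snd.
- by move=> k y; exact: normr_cos_le1.
by apply: eq_Rintegral => y _; rewrite Rintegral_cos_abel_weight// mulrC.
Qed.

End Integrable.

(** The Poisson kernel is a rescaled Cauchy kernel. Substituting [y = x + e * t] moves [e] from the
    kernel into the argument of [a], so that a fixed multiple of the Cauchy kernel can dominate as
    [e] tends to [0]. *)
Lemma poisson_average (a : RM -> R) (e x : R) : 0 < e ->
  leb.-integrable setT (EFin \o a) ->
  \int[leb]_y (e / (e ^+ 2 + (x - y) ^+ 2) * a y) =
  \int[leb]_t (a (e * t + x) * cauchy_kernel t).
Proof.
move=> e0 ia.
have PE (u : R) : e / (e ^+ 2 + u ^+ 2) = e^-1 * cauchy_kernel (e^-1 * u).
  rewrite /cauchy_kernel; have h := oneDsqr_gt0 (e^-1 * u).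
  have h' : 0 < e ^+ 2 + u ^+ 2 by rewrite ltr_pwDl ?sqr_ge0// exprn_gt0.
  by field; rewrite !gt_eqF.
have ck1 (u : R) : `|cauchy_kernel u| <= 1.
  rewrite ger0_norm ?cauchy_kernel_ge0// invf_le1 ?oneDsqr_gt0//.
  by rewrite lerDl sqr_ge0.
rewrite (@Rintegral_affine _ x e e0); last first.
  apply: (integrable_bounded_mul (M := e^-1) _ _ ia).
  - under eq_fun do rewrite PE; apply: measurable_funM; first exact: measurable_cst.
    apply: (measurableT_comp (@measurable_cauchy_kernel R)).
    apply: measurable_funM; first exact: measurable_cst.
    by apply: measurable_funB => //; exact: measurable_cst.
  - move=> y; rewrite PE normrM ger0_norm ?invr_ge0 ?(ltW e0)//.
    by rewrite ler_piMr ?invr_ge0 ?(ltW e0).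
have iae : leb.-integrable setT (EFin \o (fun t => cauchy_kernel t * a (x + e * t))).
  apply: (integrable_bounded_mul (M := 1)) => //; first exact: measurable_cauchy_kernel.
  exact: (integrable_affine x e0 ia).
transitivity (e * (\int[leb]_t (e^-1 * (cauchy_kernel t * a (x + e * t))))).
  congr (_ * _); apply: eq_Rintegral => t _.
  rewrite PE (_ : x - (x + e * t) = - (e * t)); last by ring.
  by rewrite mulrN mulrA mulVf ?gt_eqF// mul1r /cauchy_kernel sqrrN mulrA.
rewrite RintegralZl// mulrA divff ?gt_eqF// mul1r.
by apply: eq_Rintegral => t _; rewrite mulrC [x + _]addrC.
Qed.

Lemma measurable_correlation (a : RM -> R) : measurable_fun setT a ->
  measurable_fun [set: RM] (correlation a : RM -> R).
Proof.
move=> ma; apply: (@measurable_fun_Rintegral_snd _ _ RM RM R leb (fun z x => a (z + x) * a x)).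
apply: measurable_funM.
  apply: (measurableT_comp ma).
  by apply: measurable_funD; [exact: measurable_fst|exact: measurable_snd].
exact: (measurableT_comp ma measurable_snd).
Qed.

Lemma power_spectrum_correlation (a : RM -> R) (e : R) : bcs a -> 0 < e ->
  \int[leb]_k (power_spectrum a k * abel_weight e k) =
  \int[leb]_t (correlation a (e * t) * cauchy_kernel t).
Proof.
move=> ba e0; have ia := bcs_integrable ba; have [ma [M aM] _] := ba.
rewrite power_spectrum_abel//.
transitivity (\int[leb]_x (a x * \int[leb]_t (a (e * t + x) * cauchy_kernel t))).
  by apply: eq_Rintegral => x _; rewrite poisson_average.
have M0 : 0 <= M by exact: le_trans (aM 0).
have mK : measurable_fun [set: RM * RM] (fun z : RM * RM => a (e * z.2 + z.1)).
  apply: (measurableT_comp ma); apply: measurable_funD; last exact: measurable_fst.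
  by apply: measurable_funM; [exact: measurable_cst|exact: measurable_snd].
apply: etrans (@Rintegral_kernel_swap _ _ RM RM R leb leb (fun x t => a (e * t + x))
  a _ M M0 mK (fun x t => aM _) ia (integrable_cauchy_kernel R)) _.
by apply: eq_Rintegral => t _; rewrite mulrC.
Qed.

(** The weighted integral has two limits as [e n] decreases to [0], equal by uniqueness. On the
    correlation side it converges by domination, the kernel having mass [pi]. On the spectral side
    the power spectrum is not yet known to be integrable, but the weights increase to the indicator
    of the half-line and monotone convergence applies. *)
Lemma integral_power_spectrum (a : RM -> R) : bcs a ->
  (\int[leb]_(k in `[0%R, +oo[) (power_spectrum a k)%:E =
   (pi * \int[leb]_x (a x ^+ 2))%:E)%E.
Proof.
move=> ba; have ia := bcs_integrable ba; have [ma [M aM] _] := ba.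
pose e n : R := n.+1%:R^-1.
have e_gt0 n : 0 < e n by rewrite invr_gt0.
have e_cvg : e @ \oo --> (0 : R) by exact: cvg_harmonic.
pose I := \int[leb]_x `|a x|.
have ck0 (t : RM) : 0 <= cauchy_kernel t by exact: cauchy_kernel_ge0.
have lim1 : (fun n => \int[leb]_k (power_spectrum a k * abel_weight (e n) k)) @ \oo -->
    pi * \int[leb]_x (a x ^+ 2).
  under eq_fun do rewrite power_spectrum_correlation//.
  have -> : pi * \int[leb]_x (a x ^+ 2) = \int[leb]_t (correlation a 0 * cauchy_kernel t).
    rewrite RintegralZl//; last exact: integrable_cauchy_kernel.
    rewrite mulrC; congr (_ * _).
      by apply: eq_Rintegral => x _; rewrite add0r expr2.
    by rewrite /Rintegral integral_cauchy_kernel.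
  apply: (@Rintegral_dominated_cvg _ _ _ leb _ _ (fun t => M * I * cauchy_kernel t)).
  - move=> n; apply: measurable_funM; last exact: measurable_cauchy_kernel.
    exact: (measurableT_comp (measurable_correlation ma) (measurable_mull (e n))).
  - move=> t; apply: cvgM; last exact: cvg_cst.
    apply: cvg_correlation => //.
    by rewrite -[X in _ --> X](mul0r t); apply: cvgM => //; exact: cvg_cst.
  - rewrite /comp; under eq_fun do rewrite EFinM; apply: integrableZl => //.
    exact: integrable_cauchy_kernel.
  - move=> n t; rewrite normrM [X in _ * X]ger0_norm// ler_wpM2r//.
    exact: normr_correlation_le.
pose g n (k : RM) := (power_spectrum a k * abel_weight (e n) k)%:E.
have mps := measurable_power_spectrum ia.
have mg n : measurable_fun setT (g n).
  by apply/measurable_EFinP; apply: measurable_funM => //; exact: measurable_abel_weight.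
have g0 n k : setT k -> (0 <= g n k)%E.
  by move=> _; rewrite lee_fin mulr_ge0 ?power_spectrum_ge0 ?abel_weight_ge0.
have ndg k : setT k -> {homo g ^~ k : n m / (n <= m)%N >-> (n <= m)%E}.
  move=> _ n m nm; rewrite lee_fin ler_wpM2l ?power_spectrum_ge0// /abel_weight.
  rewrite indicE; case: (boolP (k \in _)) => [|_]; last by rewrite !mulr0.
  rewrite inE/= in_itv/= andbT !mulr1 ler_expR !mulNr lerN2 => k0.
  by rewrite ler_wpM2r// lef_pV2 ?posrE// ler_nat.
have := @cvg_monotone_convergence _ _ _ leb _ measurableT g mg g0 ndg.
have -> : (fun n => \int[leb]_k g n k)%E =
    (fun n => (\int[leb]_k (power_spectrum a k * abel_weight (e n) k))%:E).
  apply/funext => n; rewrite /Rintegral fineK//.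
  have iw := integrable_abel_weight (e_gt0 n).
  have := integrable_bounded_mul mps (power_spectrum_le ia) iw.
  exact: (integrable_fin_num measurableT).
move=> lim2; transitivity (\int[leb]_k limn (g ^~ k))%E.
  rewrite integral_mkcond; apply: eq_integral => k _; apply/esym/cvg_lim => //.
  rewrite (_ : (_ \_ _) k = (power_spectrum a k * \1_(`[0, +oo[%classic : set R) k)%:E); last first.
    by rewrite patchE indicE; case: ifP; rewrite ?mulr1 ?mulr0.
  apply: cvg_EFin; first exact: nearW.
  rewrite /abel_weight; apply: cvgM; first exact: cvg_cst.
  rewrite -[X in _ --> X]mul1r; apply: cvgM; last exact: cvg_cst.
  rewrite -expR0 -[X in expR X](mul0r k) -oppr0.
  apply: continuous_cvg; first exact: continuous_expR.
  by apply: cvgM; [exact: cvgN|exact: cvg_cst].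
have lim3 : (fun n => (\int[leb]_k (power_spectrum a k * abel_weight (e n) k))%:E) @ \oo -->
    (pi * \int[leb]_x (a x ^+ 2))%:E.
  by apply: cvg_EFin => //; exact: nearW.
by apply: cvg_unique lim2 lim3.
Qed.

End RealPlancherel.

(** * Limits and complex conjugation in L^2 *)

Section L2Limits.
Context d (T : measurableType d) (R : realType).
Variable mu : {measure set T -> \bar R}.
Local Notation H := (L2 mu).
Implicit Types (u v w : nat -> H) (g h : H).

Definition L2_cvg u g : Prop := (fun n => L2norm (u n - g)) @ \oo --> (0 : R).

Lemma L2_cvg_norm u g : L2_cvg u g -> (fun n => L2norm (u n)) @ \oo --> L2norm g.
Proof.
move=> ug; apply/cvgrPdist_lt => e e0.
have /cvgrPdist_lt/(_ e e0) := ug; apply: filterS => n.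
rewrite sub0r normrN ger0_norm ?L2norm_ge0//; apply: le_lt_trans.
by rewrite distrC L2norm_dist.
Qed.

Lemma L2_cvgD u v g h : L2_cvg u g -> L2_cvg v h ->
  L2_cvg (fun n => u n + v n) (g + h).
Proof.
move=> ug vh; have uv : (fun n => L2norm (u n - g) + L2norm (v n - h)) @ \oo --> (0 : R).
  by rewrite -[X in _ --> X]addr0; exact: cvgD.
apply: (squeeze_cvgr _ _ uv); last exact: cvg_cst.
near=> n; rewrite L2norm_ge0/= (_ : u n + v n - (g + h) = (u n - g) + (v n - h)) ?L2normD//.
by rewrite opprD addrACA.
Unshelve. all: by end_near. Qed.

Lemma L2normZ a g : L2norm (a *: g) = Num.sqrt (sqmod a) * L2norm g.
Proof. by rewrite !L2normE N2Z sqrtrM// sqmod_ge0. Qed.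

Lemma L2_cvgZ a u g : L2_cvg u g -> L2_cvg (fun n => a *: u n) (a *: g).
Proof.
move=> ug; rewrite /L2_cvg (_ : (fun n => _) =
    (fun n => Num.sqrt (sqmod a) * L2norm (u n - g))); last first.
  by apply/funext => n; rewrite -scalerBr L2normZ.
by rewrite -[X in _ --> X](mulr0 (Num.sqrt (sqmod a))); apply: cvgM => //; exact: cvg_cst.
Qed.

Lemma L2_cvg_rdot u v g h : L2_cvg u g -> L2_cvg v h ->
  (fun n => rdot (u n) (v n)) @ \oo --> rdot g h.
Proof.
move=> ug vh; rewrite -[X in _ --> X]addr0 -[X in _ --> _ + X]add0r.
have -> : (fun n => rdot (u n) (v n)) =
    (fun n => rdot g h + (rdot (u n - g) (v n) + rdot g (v n - h))).
  by apply/funext => n; rewrite rdotBl rdotBr; ring.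
have c0 (s : nat -> R) (t : nat -> R) : (forall n, `|s n| <= t n) ->
    t @ \oo --> (0 : R) -> s @ \oo --> (0 : R).
  move=> st t0; apply/norm_cvg0P; apply: (squeeze_cvgr _ _ t0); last exact: cvg_cst.
  by near=> n; rewrite normr_ge0 st.
apply: cvgD; first exact: cvg_cst.
apply: cvgD.
  apply: (c0 _ (fun n => L2norm (u n - g) * L2norm (v n))).
    by move=> n; exact: normr_rdot_le.
  rewrite -[X in _ --> X](mul0r (L2norm h)); apply: cvgM => //.
  exact: L2_cvg_norm.
apply: (c0 _ (fun n => L2norm g * L2norm (v n - h))).
  by move=> n; exact: normr_rdot_le.
by rewrite -[X in _ --> X](mulr0 (L2norm g)); apply: cvgM => //; exact: cvg_cst.
Unshelve. all: by end_near. Qed.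

Lemma sq_integrable_conj (f : T -> R[i]) : f \in sq_integrable mu ->
  (fun x => (f x)^*%C) \in sq_integrable mu.
Proof.
move=> /sq_integrableP[[mr mi] If]; apply/sq_integrableP; split.
  split; [rewrite (_ : (fun x => _) = (fun x => complex.Re (f x)))//
         |rewrite (_ : (fun x => _) = (fun x => - complex.Im (f x)))//].
  - by apply/funext => x; case: (f x).
  - exact: measurableT_comp.
  - by apply/funext => x; case: (f x).
rewrite (_ : (fun x => _) = (fun x => (sqmod (f x))%:E))//.
by apply/funext => x; case: (f x) => a b; rewrite /sqmod/= sqrrN.
Qed.

Definition L2conj g : H := L2class mu (fun x => (rep g x)^*%C).

Lemma rep_conj g : {ae mu, forall x, rep (L2conj g) x = (rep g x)^*%C}.
Proof. by apply: rep_class; apply: sq_integrable_conj; exact: rep_sq. Qed.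

Lemma L2conjK g : L2conj (L2conj g) = g.
Proof.
apply: L2_ext; apply: filterS2 (rep_conj (L2conj g)) (rep_conj g) => x -> ->.
by case: (rep g x) => a b /=; rewrite opprK.
Qed.

Lemma L2conjB g h : L2conj (g - h) = L2conj g - L2conj h.
Proof.
apply: L2_ext; apply: filterS3 (rep_conj (g - h)) (repB g h)
  (filterI (repB (L2conj g) (L2conj h)) (filterI (rep_conj g) (rep_conj h))).
by move=> x -> -> [-> [-> ->]]; rewrite rmorphB.
Qed.

Lemma N2_conj g : N2 (L2conj g) = N2 g.
Proof.
apply: EFin_inj; rewrite -!N2E; apply: ae_eq_integral => //; try exact: measurable_sqmod_rep.
apply: filterS (rep_conj g) => x -> _.
by case: (rep g x) => a b; rewrite /sqmod/= sqrrN.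
Qed.

Lemma L2_cvg_conj u g : L2_cvg u g -> L2_cvg (fun n => L2conj (u n)) (L2conj g).
Proof.
move=> ug; rewrite /L2_cvg (_ : (fun n => _) = (fun n => L2norm (u n - g)))//.
by apply/funext => n; rewrite -L2conjB L2normE N2_conj.
Qed.

End L2Limits.

Lemma ge0_integral_fold (R : realType) (g : measurableTypeR R -> R) :
  measurable_fun setT g -> (forall k, 0 <= g k) ->
  (\int[@lebesgue_measure R]_k (g k)%:E =
   \int[@lebesgue_measure R]_(k in `[0%R, +oo[) (g k + g (- k))%:E)%E.
Proof.
move=> mg g0.
have mgN : measurable_fun setT (fun k : measurableTypeR R => g (- k)).
  by apply: (measurableT_comp mg); apply: measurable_funN; exact: measurable_id.
under [RHS]eq_integral do rewrite EFinD.
rewrite ge0_integralD//=; last 4 first.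
- by move=> k _; rewrite lee_fin.
- by apply/measurable_EFinP; exact: measurable_funTS.
- by move=> k _; rewrite lee_fin.
- by apply/measurable_EFinP; exact: measurable_funTS.
rewrite (@ge0_integration_by_substitution0 _ (fun k => (g (- k))%:E)); last 2 first.
- exact/measurable_EFinP.
- by move=> k; rewrite lee_fin.
under [X in (_ = _ + X)%E]eq_integral do rewrite opprK.
rewrite -integral_itv_bndo_bndc; last by apply/measurable_EFinP; exact: measurable_funTS.
rewrite addeC -ge0_integral_setU//=.
- by congr (integral _ _ _); apply/seteqP; split => x //= _;
    rewrite !in_itv/= andbT; case: (ltP x 0); [left|right].
- by apply/measurable_EFinP; exact: measurable_funTS.
- by move=> x _; rewrite lee_fin.
- by apply/disj_setPS => x []/=; rewrite !in_itv/= andbT => /lt_geF ->.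
Qed.

(** * The Fourier transform on L^2 *)

Section ComplexFourier.
Variable R : realType.
Local Notation leb := (@lebesgue_measure R).
Local Notation RM := (measurableTypeR R).
Local Notation bcs := (@bounded_compact_support R).
Local Notation re f := (fun x => complex.Re (f x)).
Local Notation im f := (fun x => complex.Im (f x)).
Implicit Types f g : RM -> R[i].

Lemma twopi_gt0 : 0 < 2 * pi :> R.
Proof. by rewrite mulr_gt0// pi_gt0. Qed.

Lemma fourier_integralE f k : cintegrable leb f ->
  fourier_integral f k = (Num.sqrt (2 * pi))^-1%:C *
    ((fcos (re f) k + fsin (im f) k) +i* (fcos (im f) k - fsin (re f) k)).
Proof.
move=> [ir ii]; rewrite /fourier_integral; congr (_ * _); rewrite /cintegral.
congr (_ +i* _).
  rewrite /fcos /fsin -RintegralD//; try exact: integrable_cos_mul; try exact: integrable_sin_mul.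
  by apply: eq_Rintegral => x _; case: (f x) => a b /=; ring.
rewrite /fcos /fsin -RintegralB//; try exact: integrable_cos_mul; try exact: integrable_sin_mul.
by apply: eq_Rintegral => x _; case: (f x) => a b /=; ring.
Qed.

Lemma Re_fourier_integral f k : cintegrable leb f ->
  complex.Re (fourier_integral f k) =
  (Num.sqrt (2 * pi))^-1 * (fcos (re f) k + fsin (im f) k).
Proof. by move=> fi; rewrite fourier_integralE//= mul0r subr0. Qed.

Lemma Im_fourier_integral f k : cintegrable leb f ->
  complex.Im (fourier_integral f k) =
  (Num.sqrt (2 * pi))^-1 * (fcos (im f) k - fsin (re f) k).
Proof. by move=> fi; rewrite fourier_integralE//= mul0r addr0. Qed.

Lemma sqmod_fourier_integral f k : cintegrable leb f ->
  sqmod (fourier_integral f k) = (2 * pi)^-1 *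
    ((fcos (re f) k + fsin (im f) k) ^+ 2 + (fcos (im f) k - fsin (re f) k) ^+ 2).
Proof.
move=> fi; rewrite /sqmod Re_fourier_integral// Im_fourier_integral// !exprMn -mulrDr.
by rewrite exprVn sqr_sqrtr// ltW// twopi_gt0.
Qed.

Lemma cmeasurable_fourier_integral f : cintegrable leb f ->
  cmeasurable (fourier_integral f : RM -> R[i]).
Proof.
move=> fi; have [ir ii] := fi; split.
- under eq_fun do rewrite Re_fourier_integral//.
  apply: measurable_funM; first exact: measurable_cst.
  by apply: measurable_funD; [exact: measurable_fcos|exact: measurable_fsin].
- under eq_fun do rewrite Im_fourier_integral//.
  apply: measurable_funM; first exact: measurable_cst.
  by apply: measurable_funB; [exact: measurable_fcos|exact: measurable_fsin].
Qed.

Definition cbcs f := bcs (re f) /\ bcs (im f).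

Lemma cbcs_cintegrable f : cbcs f -> cintegrable leb f.
Proof. by move=> [br bi]; split; exact: bcs_integrable. Qed.

Lemma bcs_sqr (a : RM -> R) : bcs a -> leb.-integrable setT (EFin \o (fun x => a x ^+ 2)).
Proof.
move=> ba; have [ma [M aM] _] := ba.
by apply: (integrable_bounded_mul ma aM); exact: bcs_integrable.
Qed.

Lemma integral_sqmod_cbcs f : cbcs f -> (\int[leb]_x (sqmod (f x))%:E =
  (\int[leb]_x (complex.Re (f x) ^+ 2) + \int[leb]_x (complex.Im (f x) ^+ 2))%:E)%E.
Proof.
move=> [/bcs_sqr br /bcs_sqr bi]; rewrite -RintegralD// /Rintegral fineK//.
apply: (integrable_fin_num measurableT).
by rewrite /comp; under eq_fun do rewrite EFinD; exact: integrableD.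
Qed.

Lemma cbcs_sq_integrable f : cbcs f -> f \in sq_integrable leb.
Proof.
move=> bf; apply/sq_integrableP; split; last by rewrite integral_sqmod_cbcs// ltry.
by have [[? _ _] [? _ _]] := bf.
Qed.

(** For [f = a + i b] the cross terms of [|F f|^2] are odd in [k]. Adding the values at [k] and
    [- k] cancels them and leaves the two power spectra, each with coefficient [2 / (2 * pi)], that
    is [pi^-1]. *)
Theorem plancherel_cbcs f : cbcs f ->
  (\int[leb]_k (sqmod (fourier_integral f k))%:E = \int[leb]_x (sqmod (f x))%:E)%E.
Proof.
move=> bf; have fi := cbcs_cintegrable bf; have [br bi] := bf; have [ir ii] := fi.
have pp := @pi_gt0 R.
rewrite ge0_integral_fold; last 2 first.
- by apply: measurable_sqmod; exact: cmeasurable_fourier_integral.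
- by move=> k; exact: sqmod_ge0.
transitivity (\int[leb]_(k in `[0%R, +oo[)
   (pi^-1%:E * ((power_spectrum (re f) k)%:E + (power_spectrum (im f) k)%:E)))%E.
  apply: eq_integral => k _; rewrite -EFinD -EFinM; congr EFin.
  rewrite !sqmod_fourier_integral// !fcosN !fsinN// /power_spectrum.
  by move: (@pi R) pp => p pp; field; rewrite gt_eqF.
have mr := measurable_power_spectrum ir; have mi := measurable_power_spectrum ii.
rewrite ge0_integralZl//; last 3 first.
- apply: measurable_funTS; apply: emeasurable_funD; exact/measurable_EFinP.
- by move=> k _; rewrite adde_ge0// lee_fin power_spectrum_ge0.
- by rewrite lee_fin invr_ge0 ltW.
rewrite ge0_integralD//; last 4 first.
- by move=> k _; rewrite lee_fin power_spectrum_ge0.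
- by apply: measurable_funTS; exact/measurable_EFinP.
- by move=> k _; rewrite lee_fin power_spectrum_ge0.
- by apply: measurable_funTS; exact/measurable_EFinP.
rewrite !integral_power_spectrum// integral_sqmod_cbcs// -EFinD -EFinM -mulrDr mulrA.
by rewrite mulVf ?gt_eqF// mul1r.
Qed.

(** A cut in position and in size at once, so that a single sequence is bounded, compactly
    supported, dominated by [f] and eventually equal to [f] at each point. *)
Definition truncate (n : nat) f (x : RM) : R[i] :=
  (\1_[set x : RM | `|x| < n%:R /\ sqmod (f x) < n%:R] x)%:C * f x.

Lemma measurable_truncate_set n f : cmeasurable f ->
  measurable [set x : RM | `|x| < n%:R /\ sqmod (f x) < n%:R].
Proof.
move=> mf.
have m1 : measurable_fun [set: RM] (fun x : RM => `|x| : R) by exact: measurableT_comp.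
have m2 := measurable_sqmod mf.
rewrite (_ : [set x | _] =
   (fun x : RM => `|x| : R) @^-1` `]-oo, n%:R[ `&` (fun x => sqmod (f x)) @^-1` `]-oo, n%:R[).
  apply: measurableI; rewrite -[X in measurable X]setTI; [exact: m1|exact: m2].
by apply/seteqP; split => x /=; rewrite !in_itv.
Qed.

Lemma Re_truncate n f x : complex.Re (truncate n f x) =
  \1_[set x : RM | `|x| < n%:R /\ sqmod (f x) < n%:R] x * complex.Re (f x).
Proof. by rewrite /truncate; case: (f x) => a b /=; rewrite mul0r subr0. Qed.

Lemma Im_truncate n f x : complex.Im (truncate n f x) =
  \1_[set x : RM | `|x| < n%:R /\ sqmod (f x) < n%:R] x * complex.Im (f x).
Proof. by rewrite /truncate; case: (f x) => a b /=; rewrite mul0r addr0. Qed.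

Lemma normr_le_sqr_lt (y s : R) : y ^+ 2 < s -> `|y| <= s + 1.
Proof.
move=> ys; have := sqr_ge0 (`|y| - 1); rewrite sqrrB1 real_normK ?num_real//.
have := normr_ge0 y; lra.
Qed.

Lemma cbcs_truncate n f : cmeasurable f -> cbcs (truncate n f).
Proof.
move=> mf; have mT := measurable_truncate_set n mf; have [mr mi] := mf.
have key (q : R[i] -> R) : measurable_fun setT (fun x => q (f x)) ->
    (forall z, q z ^+ 2 <= sqmod z) ->
    bcs (fun x => \1_[set x : RM | `|x| < n%:R /\ sqmod (f x) < n%:R] x * q (f x)).
  move=> mq qle; split.
  - by apply: measurable_funM => //; exact: measurable_indic.
  - exists (n%:R + 1) => x; rewrite indicE; case: (boolP (x \in _)) => [|_].
      rewrite inE/= => -[_ fn]; rewrite mul1r; apply: normr_le_sqr_lt.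
      exact: le_lt_trans (qle _) fn.
    by rewrite mul0r normr0 addr_ge0.
  - exists n%:R => x nx; rewrite indicE memNset ?mul0r//=.
    by case; rewrite ltNge nx.
split.
- under eq_fun do rewrite Re_truncate.
  by apply: key => // z; rewrite /sqmod lerDl sqr_ge0.
- under eq_fun do rewrite Im_truncate.
  by apply: key => // z; rewrite /sqmod lerDr sqr_ge0.
Qed.

Lemma truncate_indic_cvg f (x : RM) :
  (fun n => \1_[set x : RM | `|x| < n%:R /\ sqmod (f x) < n%:R] x : R) @ \oo --> (1 : R).
Proof.
apply: cvg_near_cst; near=> n.
rewrite indicE mem_set//=; split.
  by near: n; exact: nbhs_infty_gtr.
by near: n; exact: nbhs_infty_gtr.
Unshelve. all: by end_near. Qed.

Lemma sqmod_truncate_le n f x : sqmod (truncate n f x) <= sqmod (f x).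
Proof.
rewrite /truncate sqmodM {1}/sqmod/= expr0n/= addr0 indicE.
by case: (x \in _); rewrite ?expr1n ?mul1r// expr0n mul0r sqmod_ge0.
Qed.

Lemma fcos_cvg (a : RM -> R) (s : nat -> RM -> R) k :
  leb.-integrable setT (EFin \o a) -> (forall n, measurable_fun setT (s n)) ->
  (forall n x, `|s n x| <= 1) -> (forall x, s ^~ x @ \oo --> (1 : R)) ->
  (fun n => fcos (fun x => s n x * a x) k) @ \oo --> fcos a k /\
  (fun n => fsin (fun x => s n x * a x) k) @ \oo --> fsin a k.
Proof.
move=> ia ms s1 sc.
have ma : measurable_fun setT a by apply/measurable_EFinP; exact: measurable_int ia.
have key (t : RM -> R) : measurable_fun setT t -> (forall x, `|t x| <= 1) ->
  (fun n => \int[leb]_x (t x * (s n x * a x))) @ \oo --> \int[leb]_x (t x * a x).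
  move=> mt t1; apply: (@Rintegral_dominated_cvg _ _ _ leb _ _ (fun x => `|a x|)).
  - by move=> n; apply: measurable_funM => //; exact: measurable_funM.
  - move=> x; apply: cvgM; first exact: cvg_cst.
    by rewrite -[X in _ --> X]mul1r; apply: cvgM => //; exact: cvg_cst.
  - exact: (integrable_norm ia).
  - move=> n x; rewrite !normrM -[leRHS]mul1r ler_pM ?mulr_ge0//.
    by rewrite -[leRHS]mul1r ler_pM.
split; apply: key.
- exact: measurable_cosk.
- by move=> x; exact: normr_cos_le1.
- exact: measurable_sink.
- by move=> x; exact: normr_sin_le1.
Qed.

(** Integrability of [f] makes the transforms of its truncations converge pointwise, and their L^2
    norms are bounded by that of [f]. Fatou's lemma then gives an inequality, which is what
    uniqueness of the transform on L^2 needs. *)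
Lemma fourier_integral_L1L2_le f : cintegrable leb f ->
  (\int[leb]_k (sqmod (fourier_integral f k))%:E <= \int[leb]_x (sqmod (f x))%:E)%E.
Proof.
move=> fi; have [ir ii] := fi.
have mf : cmeasurable f.
  by split; apply/measurable_EFinP; [exact: measurable_int ir|exact: measurable_int ii].
pose s n (x : RM) : R := \1_[set x : RM | `|x| < n%:R /\ sqmod (f x) < n%:R] x.
have ms n : measurable_fun setT (s n).
  by apply: measurable_indic; exact: measurable_truncate_set.
have s1 n x : `|s n x| <= 1.
  by rewrite /s indicE; case: (_ \in _); rewrite ?normr1 ?normr0.
have bt n := cbcs_truncate n mf.
have it n := cbcs_cintegrable (bt n).
pose F n k := (sqmod (fourier_integral (truncate n f) k))%:E.
have mF n : measurable_fun [set: RM] (F n).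
  by apply/measurable_EFinP; apply: measurable_sqmod; exact: cmeasurable_fourier_integral.
have F0 n k : setT k -> (0 <= F n k)%E by move=> _; rewrite lee_fin sqmod_ge0.
have cF k : (fun n => F n k) @ \oo --> (sqmod (fourier_integral f k))%:E.
  apply: cvg_EFin; first exact: nearW.
  rewrite /F /comp /=; under eq_fun do rewrite sqmod_fourier_integral//.
  rewrite sqmod_fourier_integral//; apply: cvgM; first exact: cvg_cst.
  have [rc rs] := fcos_cvg k ir ms s1 (truncate_indic_cvg f).
  have [ic is_] := fcos_cvg k ii ms s1 (truncate_indic_cvg f).
  have Rt n : (fun x => complex.Re (truncate n f x)) = (fun x => s n x * complex.Re (f x)).
    by apply/funext => x; rewrite Re_truncate.
  have It n : (fun x => complex.Im (truncate n f x)) = (fun x => s n x * complex.Im (f x)).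
    by apply/funext => x; rewrite Im_truncate.
  under eq_fun do rewrite Rt It.
  rewrite !expr2; apply: cvgD; apply: cvgM; try exact: cvgD; exact: cvgB.
rewrite (_ : (\int[leb]_k _)%E = \int[leb]_k limn_einf (F ^~ k))%E; last first.
  apply: eq_integral => k _; apply/esym; have := cF k => h.
  by rewrite is_cvg_limn_einfE; [apply: cvg_lim|apply/cvg_ex; eexists; exact: h].
apply: (le_trans (fatou leb measurableT mF F0)).
rewrite limn_einf_lim; apply: lime_le; first exact: is_cvg_einfs.
apply: nearW => n; apply: (@le_trans _ _ (\int[leb]_k F n k)%E).
  by apply: ereal_inf_lbound; exists n => /=.
rewrite /F plancherel_cbcs//; apply: ge0_le_integral => //.
- by move=> x _; rewrite lee_fin sqmod_ge0.
- by apply/measurable_EFinP; apply: measurable_sqmod; have [[? _ _] [? _ _]] := bt n.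
- by apply/measurable_EFinP; exact: measurable_sqmod.
- by move=> x _; rewrite lee_fin sqmod_truncate_le.
Qed.

Lemma fourier_integral_sq_integrable f : cintegrable leb f -> f \in sq_integrable leb ->
  fourier_integral f \in sq_integrable leb.
Proof.
move=> fi /sq_integrableP[_ fs]; apply/sq_integrableP; split.
  exact: cmeasurable_fourier_integral.
exact: le_lt_trans (fourier_integral_L1L2_le fi) fs.
Qed.

(** The shape of the real and imaginary parts of [l * f + g], with [p] and [q] built from the real
    and imaginary parts of [l]. *)
Lemma integrable_comb (a b c : RM -> R) (p q : R) :
  leb.-integrable setT (EFin \o a) -> leb.-integrable setT (EFin \o b) ->
  leb.-integrable setT (EFin \o c) ->
  leb.-integrable setT (EFin \o (fun x => p * a x + q * b x + c x)).
Proof.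
move=> ia ib ic; rewrite /comp; under eq_fun do rewrite !EFinD !EFinM.
by apply: integrableD => //; apply: integrableD => //; exact: integrableZl.
Qed.

Lemma Rintegral_comb (a b c : RM -> R) (p q : R) :
  leb.-integrable setT (EFin \o a) -> leb.-integrable setT (EFin \o b) ->
  leb.-integrable setT (EFin \o c) ->
  \int[leb]_x (p * a x + q * b x + c x) =
  p * \int[leb]_x a x + q * \int[leb]_x b x + \int[leb]_x c x.
Proof.
move=> ia ib ic.
have iZ (t : R) (h : RM -> R) : leb.-integrable setT (EFin \o h) ->
    leb.-integrable setT (EFin \o (fun x => t * h x)).
  by move=> ih; rewrite /comp; under eq_fun do rewrite EFinM; exact: integrableZl.
rewrite RintegralD//; last first.
  by rewrite /comp; under eq_fun do rewrite EFinD; apply: integrableD => //; exact: iZ.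
rewrite RintegralD//; try exact: iZ.
by rewrite !RintegralZl.
Qed.

Lemma fcos_comb (a b c : RM -> R) (p q k : R) :
  leb.-integrable setT (EFin \o a) -> leb.-integrable setT (EFin \o b) ->
  leb.-integrable setT (EFin \o c) ->
  fcos (fun x => p * a x + q * b x + c x) k = p * fcos a k + q * fcos b k + fcos c k /\
  fsin (fun x => p * a x + q * b x + c x) k = p * fsin a k + q * fsin b k + fsin c k.
Proof.
move=> ia ib ic; rewrite /fcos /fsin; split; rewrite -Rintegral_comb;
  try exact: integrable_cos_mul; try exact: integrable_sin_mul;
  by apply: eq_Rintegral => x _; ring.
Qed.

Lemma Re_comb (l z w : R[i]) : complex.Re (l * z + w) =
  complex.Re l * complex.Re z + (- complex.Im l) * complex.Im z + complex.Re w.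
Proof. by case: l z w => [? ?] [? ?] [? ?] /=; ring. Qed.

Lemma Im_comb (l z w : R[i]) : complex.Im (l * z + w) =
  complex.Im l * complex.Re z + complex.Re l * complex.Im z + complex.Im w.
Proof. by case: l z w => [? ?] [? ?] [? ?] /=; ring. Qed.

Lemma cintegrable_comb l f g : cintegrable leb f -> cintegrable leb g ->
  cintegrable leb (fun x => l * f x + g x).
Proof.
move=> [fr fi] [gr gi]; split.
- by under eq_fun do rewrite Re_comb; exact: (integrable_comb _ _ fr fi gr).
- by under eq_fun do rewrite Im_comb; exact: (integrable_comb _ _ fr fi gi).
Qed.

Lemma fourier_integral_comb l f g k : cintegrable leb f -> cintegrable leb g ->
  fourier_integral (fun x => l * f x + g x) k = l * fourier_integral f k + fourier_integral g k.
Proof.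
move=> If Ig; have [fr fi] := If; have [gr gi] := Ig.
rewrite !fourier_integralE//; last exact: cintegrable_comb.
rewrite (_ : (fun x => complex.Re (l * f x + g x)) = (fun x => complex.Re l * complex.Re (f x) +
    (- complex.Im l) * complex.Im (f x) + complex.Re (g x))); last first.
  by apply/funext => x; rewrite Re_comb.
rewrite (_ : (fun x => complex.Im (l * f x + g x)) = (fun x => complex.Im l * complex.Re (f x) +
    complex.Re l * complex.Im (f x) + complex.Im (g x))); last first.
  by apply/funext => x; rewrite Im_comb.
have [-> ->] := fcos_comb (complex.Re l) (- complex.Im l) k fr fi gr.
have [-> ->] := fcos_comb (complex.Im l) (complex.Re l) k fr fi gi.
case: l => p q /=; apply/eqP; rewrite eq_complex /=; apply/andP; split; apply/eqP; ring.
Qed.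

Lemma ae_integrable (a b : RM -> R) : leb.-integrable setT (EFin \o a) ->
  measurable_fun setT b -> {ae leb, forall x : RM, a x = b x} ->
  leb.-integrable setT (EFin \o b).
Proof.
move=> ia mb ab; have /integrableP[ma la] := ia.
have mb' : measurable_fun setT (EFin \o b) by exact/measurable_EFinP.
apply/integrableP; split => //; apply: le_lt_trans la.
rewrite le_eqVlt; apply/orP; left; apply/eqP; apply: ae_eq_integral => //.
- exact: measurableT_comp.
- exact: measurableT_comp.
- by apply: filterS ab => x /= -> _.
Qed.

Lemma ae_cintegrable f g : cintegrable leb f -> cmeasurable g ->
  {ae leb, forall x : RM, f x = g x} -> cintegrable leb g.
Proof.
move=> [fr fi] [mr mi] fg; split.
- by apply: (ae_integrable fr mr); apply: filterS fg => x ->.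
- by apply: (ae_integrable fi mi); apply: filterS fg => x ->.
Qed.

Lemma ae_fcos (a b : RM -> R) k : measurable_fun setT a -> measurable_fun setT b ->
  {ae leb, forall x : RM, a x = b x} -> fcos a k = fcos b k /\ fsin a k = fsin b k.
Proof.
move=> ma mb ab; split; apply: ae_eq_Rintegral.
- by apply: measurable_funM => //; exact: measurable_cosk.
- by apply: measurable_funM => //; exact: measurable_cosk.
- by apply: filterS ab => x ->.
- by apply: measurable_funM => //; exact: measurable_sink.
- by apply: measurable_funM => //; exact: measurable_sink.
- by apply: filterS ab => x ->.
Qed.

(** [is_fourier] integrates arbitrary representatives of classes, so the transform must be
    insensitive to null sets. *)
Lemma ae_fourier_integral f g k : cintegrable leb f -> cmeasurable g ->
  {ae leb, forall x : RM, f x = g x} -> fourier_integral f k = fourier_integral g k.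
Proof.
move=> fi mg fg; rewrite !fourier_integralE//; last exact: ae_cintegrable fg.
have [gr gi] := mg; have [fr ff] := fi.
have mf : measurable_fun setT (re f) /\ measurable_fun setT (im f).
  by split; apply/measurable_EFinP; [exact: measurable_int fr|exact: measurable_int ff].
have [mr mi] := mf.
have [| -> ->] := ae_fcos k mr gr; first by apply: filterS fg => x ->.
by have [| -> ->] := ae_fcos k mi gi; first by apply: filterS fg => x ->.
Qed.

End ComplexFourier.

(** * Extension of the Fourier transform to L^2 and its unitarity *)

Section FourierL2.
Variable R : realType.
Local Notation leb := (@lebesgue_measure R).
Local Notation RM := (measurableTypeR R).
Local Notation L2R := (L2 leb).
Implicit Types (f : RM -> R[i]) (g h : L2R).

Lemma is_fourier_comb l g g' h h' : is_fourier g h -> is_fourier g' h' ->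
  is_fourier (l *: g + g') (l *: h + h').
Proof.
move=> [u [v [iu uv ug vh]]] [u' [v' [iu' uv' ug' vh']]].
exists (fun n => l *: u n + u' n), (fun n => l *: v n + v' n).
have rep_comb a b : {ae leb, forall x : RM, l * rep a x + rep b x = rep (l *: a + b : L2R) x}.
  by apply: filterS2 (repD (l *: a) b) (repZ l a) => x -> ->.
split.
- move=> n; apply: ae_cintegrable (rep_comb _ _); last exact: cmeasurable_rep.
  exact: cintegrable_comb.
- move=> n; apply: filterS3 (rep_comb (v n) (v' n)) (uv n) (uv' n) => k <- -> ->.
  rewrite -fourier_integral_comb//; apply: ae_fourier_integral.
  + exact: cintegrable_comb.
  + exact: cmeasurable_rep.
  + exact: rep_comb.
- exact: (L2_cvgD (L2_cvgZ l ug) ug').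
- exact: (L2_cvgD (L2_cvgZ l vh) vh').
Qed.

Lemma is_fourier_norm_le g h : is_fourier g h -> L2norm h <= L2norm g.
Proof.
move=> [u [v [iu uv /L2_cvg_norm ug /L2_cvg_norm vh]]].
apply: (ler_cvg_to vh ug); apply: nearW => n; rewrite !L2normE ler_sqrt ?N2_ge0//.
rewrite -lee_fin -!N2E; apply: le_trans (fourier_integral_L1L2_le (iu n)).
rewrite le_eqVlt; apply/orP; left; apply/eqP; apply: ae_eq_integral => //.
- exact: measurable_sqmod_rep.
- by apply/measurable_EFinP; apply: measurable_sqmod; exact: cmeasurable_fourier_integral.
- by apply: filterS (uv n) => k -> _.
Qed.

(** By linearity of the relation the difference of two values is a transform of [0], and the norm
    bound makes it vanish. *)
Lemma is_fourier_unique g h h' : is_fourier g h -> is_fourier g h' -> h = h'.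
Proof.
move=> gh gh'; have := is_fourier_comb (-1) gh gh'.
rewrite !scaleN1r addNr => /is_fourier_norm_le; rewrite L2norm0 => hh'.
apply/esym/eqP; rewrite -subr_eq0 addrC; apply/eqP; apply: L2norm_eq0.
by apply/eqP; rewrite eq_le hh' L2norm_ge0.
Qed.

Lemma N2B_le g h : N2 (g - h) <= 2 * (N2 g + N2 h).
Proof. by have := N2_ge0 (g + h); rewrite N2D N2B; lra. Qed.

Lemma L2_cvg_truncate g : L2_cvg (fun n => L2class leb (truncate n (rep g))) g.
Proof.
have mg := cmeasurable_rep g; have bt n := cbcs_truncate n mg.
have st n := cbcs_sq_integrable (bt n).
pose D n x := sqmod (truncate n (rep g) x - rep g x).
have mD n : measurable_fun setT (D n).
  apply: measurable_sqmod; have /sq_integrableP[[? ?] _] := st n; have [? ?] := mg.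
  by split; under eq_fun do rewrite raddfB/=; exact: measurable_funB.
have N2D n : N2 (L2class leb (truncate n (rep g)) - g) = \int[leb]_x D n x.
  apply: ae_eq_Rintegral => //.
    by apply: measurable_sqmod; exact: cmeasurable_rep.
  by apply: filterS2 (repB (L2class leb (truncate n (rep g))) g) (rep_class (st n)) => x -> ->.
have D0 : (fun n => \int[leb]_x D n x) @ \oo --> (0 : R).
  have -> : 0 = \int[leb]_(x in [set: RM]) (0 : R) by rewrite Rintegral_cst// mul0r.
  apply: (@Rintegral_dominated_cvg _ _ _ leb _ _ (fun x => sqmod (rep g x))) => //.
  - move=> x; apply: cvg_near_cst; near=> n.
    rewrite /D /truncate indicE mem_set/=; last first.
      by split; near: n; exact: nbhs_infty_gtr.
    by rewrite mul1r subrr /sqmod/= expr0n addr0.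
  - exact: (integrable_sqmod (rep_sq g)).
  - move=> n x; rewrite ger0_norm ?sqmod_ge0// /D /truncate indicE.
    case: (_ \in _); first by rewrite mul1r subrr /sqmod/= expr0n/= addr0 sqmod_ge0.
    by rewrite mul0r sub0r /sqmod !raddfN/= !sqrrN.
rewrite /L2_cvg -sqrtr0 (_ : (fun n => _) = (fun n => Num.sqrt (\int[leb]_x D n x))).
  by apply: continuous_cvg => //; exact: sqrt_continuous.
by apply/funext => n; rewrite L2normE N2D.
Unshelve. all: by end_near. Qed.

Lemma cbcs_dense g (e : R) : 0 < e ->
  exists f, cbcs f /\ N2 (L2class leb f - g) <= e.
Proof.
move=> e0; have s0 : 0 < Num.sqrt e by rewrite sqrtr_gt0.
have /cvgrPdist_lt/(_ _ s0)[n _ /(_ n (leqnn n))] := L2_cvg_truncate g.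
rewrite sub0r normrN ger0_norm ?L2norm_ge0// => h.
exists (truncate n (rep g)); split; first exact: cbcs_truncate (cmeasurable_rep g).
rewrite -sqr_L2norm -[leRHS](sqr_sqrtr (ltW e0)) lerXn2r ?nnegrE ?L2norm_ge0//.
exact: ltW.
Qed.

Definition Fclass f : L2R := L2class leb (fourier_integral f : RM -> R[i]).

Lemma cbcs_fourier_sq f : cbcs f -> (fourier_integral f : RM -> R[i]) \in sq_integrable leb.
Proof.
move=> bf; apply: fourier_integral_sq_integrable; first exact: cbcs_cintegrable.
exact: cbcs_sq_integrable.
Qed.

Lemma N2_Fclass f : cbcs f -> N2 (Fclass f) = N2 (L2class leb f).
Proof.
move=> bf; apply: EFin_inj.
apply: etrans (N2_class (cbcs_fourier_sq bf)) _.
apply: etrans (plancherel_cbcs bf) _; apply: esym.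
exact: N2_class (cbcs_sq_integrable bf).
Qed.

Lemma bcsB (a b : RM -> R) : bounded_compact_support a -> bounded_compact_support b ->
  bounded_compact_support (fun x => a x - b x).
Proof.
move=> ba bb; have [ma _ _] := ba; have [mb _ _] := bb.
have [M [N [_ _ aM aN]]] := bcs_bounds ba; have [M' [N' [_ _ bM bN]]] := bcs_bounds bb.
split; first exact: measurable_funB.
- by exists (M + M') => x; rewrite (le_trans (ler_normB _ _))// lerD.
- by exists (Num.max N N') => x; rewrite ge_max => /andP[/aN -> /bN ->]; rewrite subrr.
Qed.

Lemma cbcsB f f' : cbcs f -> cbcs f' -> cbcs (fun x => f x - f' x).
Proof.
move=> [? ?] [? ?]; split; under eq_fun do rewrite raddfB/=; exact: bcsB.
Qed.

Lemma L2classB f f' : f \in sq_integrable leb -> f' \in sq_integrable leb ->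
  L2class leb (fun x => f x - f' x) = L2class leb f - L2class leb f'.
Proof.
move=> sf sf'; apply: L2_ext.
have sff : (fun x => f x - f' x) \in sq_integrable leb by exact: (rpredB sf sf').
apply: filterS3 (rep_class sff) (repB (L2class leb f) (L2class leb f'))
  (filterI (rep_class sf) (rep_class sf')).
by move=> x -> -> [-> ->].
Qed.

Lemma FclassB f f' : cbcs f -> cbcs f' ->
  Fclass (fun x => f x - f' x) = Fclass f - Fclass f'.
Proof.
move=> bf bf'; rewrite /Fclass -L2classB ?cbcs_fourier_sq//; congr L2class.
apply/funext => k.
rewrite (_ : (fun x => f x - f' x) = (fun x => (-1) * f' x + f x)); last first.
  by apply/funext => x; rewrite mulN1r addrC.
by rewrite fourier_integral_comb ?mulN1r 1?addrC//; exact: cbcs_cintegrable.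
Qed.

(** The approximants are exported with the limit: identities proved for bounded functions with
    compact support then pass to all of L^2 through [fourier_approx]. *)
Lemma is_fourier_exists g : exists h (f : nat -> RM -> R[i]),
  [/\ is_fourier g h, forall n, cbcs (f n),
      L2_cvg (fun n => L2class leb (f n)) g & L2_cvg (fun n => Fclass (f n)) h].
Proof.
have e0 n : 0 < (8^-1) ^+ n :> R by rewrite exprn_gt0.
have /choice[f Hf] n := cbcs_dense g (e0 n).
have bf n := (Hf n).1; have fg n := (Hf n).2.
(* Plancherel transfers the approximation rate [(8^-1) ^+ n] to the transforms. Passing through [g]
   costs [N2B_le], whence the factor 4, and the rate is the one required by [L2_complete_fast]. *)
have fN n : N2 (Fclass (f n.+1) - Fclass (f n)) <= 4 * (8^-1) ^+ n.
  rewrite -FclassB// N2_Fclass; last exact: cbcsB.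
  rewrite L2classB ?cbcs_sq_integrable//.
  rewrite (_ : _ - _ = (L2class leb (f n.+1) - g) - (L2class leb (f n) - g)); last first.
    by rewrite opprB addrA subrK.
  apply: (le_trans (N2B_le _ _)); have := fg n; have := fg n.+1.
  have : (8^-1) ^+ n.+1 <= (8^-1) ^+ n :> R.
    by have := e0 n; rewrite exprS; lra.
  move: (N2 (L2class leb (f n.+1) - g)) (N2 (L2class leb (f n) - g)).
  by move: ((8^-1) ^+ n.+1) ((8^-1) ^+ n) => s t A B; lra.
have [h hh] := L2_complete_fast fN.
have ug : L2_cvg (fun n => L2class leb (f n)) g.
  have c0 : (fun n => Num.sqrt ((8^-1) ^+ n) : R) @ \oo --> (0 : R).
    rewrite -sqrtr0; apply: continuous_cvg; first exact: sqrt_continuous.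
    by apply: cvg_expr; rewrite ger0_norm ?invr_ge0// invf_lt1// ltr1n.
  apply: (squeeze_cvgr _ _ c0); last exact: cvg_cst.
  by near=> n; rewrite L2norm_ge0/= L2normE ler_sqrt ?(ltW (e0 n))// fg.
exists h, f; split => //.
exists (fun n => L2class leb (f n)), (fun n => Fclass (f n)).
have repf n := rep_class (cbcs_sq_integrable (bf n)).
have repf' n : {ae leb, forall x : RM, f n x = rep (L2class leb (f n)) x}.
  by apply: filterS (repf n) => x ->.
split => //.
- by move=> n; apply: ae_cintegrable (cbcs_cintegrable (bf n)) (cmeasurable_rep _) (repf' n).
- move=> n; apply: filterS (rep_class (cbcs_fourier_sq (bf n))) => k ->.
  exact: ae_fourier_integral (cbcs_cintegrable (bf n)) (cmeasurable_rep _) (repf' n).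
Unshelve. all: by end_near. Qed.

Lemma fourierP g : is_fourier g (fourier g).
Proof. by have [h [f [gh _ _ _]]] := is_fourier_exists g; exact: (xgetI 0 gh). Qed.

Lemma fourier_approx g : exists f : nat -> RM -> R[i],
  [/\ forall n, cbcs (f n), L2_cvg (fun n => L2class leb (f n)) g &
      L2_cvg (fun n => Fclass (f n)) (fourier g)].
Proof.
have [h [f [gh bf fg fh]]] := is_fourier_exists g; exists f; split => //.
by rewrite (is_fourier_unique (fourierP g) gh).
Qed.

Lemma fourier_comb l g g' : fourier (l *: g + g') = l *: fourier g + fourier g'.
Proof.
by apply: is_fourier_unique (fourierP _) _; apply: is_fourier_comb; exact: fourierP.
Qed.

Lemma L2norm_fourier g : L2norm (fourier g) = L2norm g.
Proof.
have [f [bf /L2_cvg_norm fg /L2_cvg_norm Ffg]] := fourier_approx g.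
have E : (fun n => L2norm (Fclass (f n))) = (fun n => L2norm (L2class leb (f n))).
  by apply/funext => n; rewrite !L2normE N2_Fclass.
by rewrite E in Ffg; exact: (cvg_unique _ Ffg fg).
Qed.

Lemma rdot_conj_class (s t : RM -> R[i]) : s \in sq_integrable leb ->
  t \in sq_integrable leb -> rdot (L2class leb s) (L2conj (L2class leb t)) =
  \int[leb]_x (complex.Re (s x) * complex.Re (t x) - complex.Im (s x) * complex.Im (t x)).
Proof.
move=> ss st; apply: ae_eq_Rintegral.
- exact: measurable_rdot_integrand (cmeasurable_rep _) (cmeasurable_rep _).
- have /sq_integrableP[[? ?] _] := ss; have /sq_integrableP[[? ?] _] := st.
  by apply: measurable_funB; exact: measurable_funM.
- apply: filterS3 (rep_class ss) (rep_class st) (rep_conj (L2class leb t)) => x -> + ->.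
  by move=> ->; case: (s x) (t x) => [? ?] [? ?] /=; ring.
Qed.

(** Conjugating the second argument turns [rdot] into the real part of the bilinear pairing. Its
    four terms are integrals against [cos (k * x)] or [sin (k * x)], kernels symmetric in [k] and
    [x], so each is transposed by an exchange of integrals. *)
Lemma fourier_mul_cbcs f f' : cbcs f -> cbcs f' ->
  rdot (Fclass f) (L2conj (L2class leb f')) = rdot (L2class leb f) (L2conj (Fclass f')).
Proof.
move=> bf bf'; have fi := cbcs_cintegrable bf; have fi' := cbcs_cintegrable bf'.
have [a_i b_i] := fi; have [p_i q_i] := fi'.
apply: etrans (rdot_conj_class (cbcs_fourier_sq bf) (cbcs_sq_integrable bf')) _.
apply: etrans _ (esym (rdot_conj_class (cbcs_sq_integrable bf) (cbcs_fourier_sq bf'))).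
pose c : R := (Num.sqrt (2 * pi))^-1.
set a := fun x => complex.Re (f x) in a_i; set b := fun x => complex.Im (f x) in b_i.
set p := fun x => complex.Re (f' x) in p_i; set q := fun x => complex.Im (f' x) in q_i.
have swapc (s t : RM -> R) : leb.-integrable setT (EFin \o s) ->
    leb.-integrable setT (EFin \o t) ->
    \int[leb]_k (fcos s k * t k) = \int[leb]_x (fcos t x * s x).
  move=> is_ it; under eq_Rintegral do rewrite mulrC.
  rewrite (@Rintegral_kernel_swap _ _ RM RM R leb leb (fun k x => cos (k * x)) t s 1)//.
  - by apply: eq_Rintegral => x _; rewrite mulrC; congr (_ * _);
      apply: eq_Rintegral => k _; rewrite [k * x]mulrC.
  - exact: measurable_cos2.
  - by move=> x y; exact: normr_cos_le1.
have swaps (s t : RM -> R) : leb.-integrable setT (EFin \o s) ->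
    leb.-integrable setT (EFin \o t) ->
    \int[leb]_k (fsin s k * t k) = \int[leb]_x (fsin t x * s x).
  move=> is_ it; under eq_Rintegral do rewrite mulrC.
  rewrite (@Rintegral_kernel_swap _ _ RM RM R leb leb (fun k x => sin (k * x)) t s 1)//.
  - by apply: eq_Rintegral => x _; rewrite mulrC; congr (_ * _);
      apply: eq_Rintegral => k _; rewrite [k * x]mulrC.
  - exact: measurable_sin2.
  - by move=> x y; exact: normr_sin_le1.
have ic (s t : RM -> R) : leb.-integrable setT (EFin \o s) ->
    leb.-integrable setT (EFin \o t) -> leb.-integrable setT (EFin \o (fun k => fcos s k * t k)).
  by move=> is_ it; apply: (integrable_bounded_mul (measurable_fcos is_) (normr_fcos_le is_)).
have is_ (s t : RM -> R) : leb.-integrable setT (EFin \o s) ->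
    leb.-integrable setT (EFin \o t) -> leb.-integrable setT (EFin \o (fun k => fsin s k * t k)).
  by move=> i1 it; apply: (integrable_bounded_mul (measurable_fsin i1) (normr_fsin_le i1)).
have split4 (s1 s2 s3 s4 : RM -> R) : leb.-integrable setT (EFin \o s1) ->
  leb.-integrable setT (EFin \o s2) -> leb.-integrable setT (EFin \o s3) ->
  leb.-integrable setT (EFin \o s4) ->
  \int[leb]_k (c * (s1 k + s2 k - (s3 k - s4 k))) =
  c * (\int[leb]_k s1 k + \int[leb]_k s2 k - (\int[leb]_k s3 k - \int[leb]_k s4 k)).
  move=> i1 i2 i3 i4.
  have iD (s t : RM -> R) : leb.-integrable setT (EFin \o s) ->
      leb.-integrable setT (EFin \o t) -> leb.-integrable setT (EFin \o (fun k => s k + t k)).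
    by move=> ? ?; rewrite /comp; under eq_fun do rewrite EFinD; exact: integrableD.
  have iB (s t : RM -> R) : leb.-integrable setT (EFin \o s) ->
      leb.-integrable setT (EFin \o t) -> leb.-integrable setT (EFin \o (fun k => s k - t k)).
    by move=> ? ?; rewrite /comp; under eq_fun do rewrite EFinB; exact: integrableB.
  have i12 := iD _ _ i1 i2; have i34 := iB _ _ i3 i4.
  by rewrite (RintegralZl _ _ (iB _ _ i12 i34))// RintegralB// RintegralD// RintegralB.
transitivity (\int[leb]_k (c * (fcos a k * p k + fsin b k * p k -
    (fcos b k * q k - fsin a k * q k)))).
  apply: eq_Rintegral => k _; rewrite Re_fourier_integral// Im_fourier_integral//.
  by rewrite -/c -/a -/b /p /q; ring.
transitivity (\int[leb]_k (c * (fcos p k * a k + fsin q k * a k -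
    (fcos q k * b k - fsin p k * b k)))); last first.
  apply: eq_Rintegral => k _; by rewrite Re_fourier_integral// Im_fourier_integral// -/c -/p -/q /a /b; ring.
apply: etrans (split4 _ _ _ _ (ic _ _ a_i p_i) (is_ _ _ b_i p_i)
  (ic _ _ b_i q_i) (is_ _ _ a_i q_i)) _.
apply: etrans _ (esym (split4 _ _ _ _ (ic _ _ p_i a_i) (is_ _ _ q_i a_i)
  (ic _ _ q_i b_i) (is_ _ _ p_i b_i))).
rewrite (swapc a p a_i p_i) (swaps b p b_i p_i) (swapc b q b_i q_i) (swaps a q a_i q_i).
(* After transposition the two sides differ only by the places of the two sine terms. *)
have key (x y z t : R) : x + y - (z - t) = x + t - (z - y) by ring.
by congr (_ * _); exact: key.
Qed.

Lemma rdot_fourier g h : rdot (fourier g) (L2conj h) = rdot g (L2conj (fourier h)).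
Proof.
have [f [bf fg Ffg]] := fourier_approx g; have [f' [bf' fh Ffh]] := fourier_approx h.
have c1 := L2_cvg_rdot Ffg (L2_cvg_conj fh).
have c2 := L2_cvg_rdot fg (L2_cvg_conj Ffh).
have E : (fun n => rdot (Fclass (f n)) (L2conj (L2class leb (f' n)))) =
         (fun n => rdot (L2class leb (f n)) (L2conj (Fclass (f' n)))).
  by apply/funext => n; exact: fourier_mul_cbcs.
by rewrite E in c1; exact: (cvg_unique _ c1 c2).
Qed.

Lemma fourier_unitary : unitary (@fourier R).
Proof.
have F0 : fourier 0 = 0 :> L2R by apply: L2norm_eq0; rewrite L2norm_fourier L2norm0.
have N2F g : N2 (fourier g) = N2 g by rewrite -!sqr_L2norm L2norm_fourier.
split => //.
- by move=> g h; have := fourier_comb 1 g h; rewrite !scale1r.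
- by move=> l g; have := fourier_comb l g 0; rewrite F0 !addr0.
- move=> h; pose b := L2conj (fourier (L2conj h)).
  have Nb : N2 b = N2 h by rewrite N2_conj N2F N2_conj.
  exists b; apply/eqP; rewrite -subr_eq0; apply/eqP; apply: L2_eq0.
  (* Writing [h] as a double conjugate gives the inner product the form treated by [rdot_fourier],
     which returns [rdot b b]. *)
  rewrite N2B N2F Nb -{3}(L2conjK h) rdot_fourier -N2_rdot Nb; ring.
Qed.

End FourierL2.

(** * Multiplication operators *)

Section MultiplicationOperator.
Context d (T : measurableType d) (R : realType).
Variable mu : {measure set T -> \bar R}.
Local Notation H := (L2 mu).
Implicit Types (f : T -> R[i]) (g h z : H) (l : R[i]).

Lemma cmeasurableM (p q : T -> R[i]) : cmeasurable p -> cmeasurable q ->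
  cmeasurable (fun x => p x * q x).
Proof.
move=> [pr pi] [qr qi]; split.
- rewrite (_ : (fun x => _) = (fun x => complex.Re (p x) * complex.Re (q x) -
      complex.Im (p x) * complex.Im (q x))).
    by apply: measurable_funB; exact: measurable_funM.
  by apply/funext => x; case: (p x) (q x) => [? ?] [? ?].
- rewrite (_ : (fun x => _) = (fun x => complex.Re (p x) * complex.Im (q x) +
      complex.Im (p x) * complex.Re (q x))).
    by apply: measurable_funD; exact: measurable_funM.
  by apply/funext => x; case: (p x) (q x) => [? ?] [? ?].
Qed.

Lemma cmeasurableB (p q : T -> R[i]) : cmeasurable p -> cmeasurable q ->
  cmeasurable (fun x => p x - q x).
Proof.
by move=> [pr pi] [qr qi]; split; under eq_fun do rewrite raddfB/=; exact: measurable_funB.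
Qed.

Lemma cmeasurable_conj (p : T -> R[i]) : cmeasurable p -> cmeasurable (fun x => (p x)^*%C).
Proof.
move=> [pr pi]; split.
- by rewrite (_ : (fun x => _) = (fun x => complex.Re (p x)))//; apply/funext => x; case: (p x).
- rewrite (_ : (fun x => _) = (fun x => - complex.Im (p x))); first exact: measurable_funN.
  by apply/funext => x; case: (p x).
Qed.

Lemma ae_eq_L2dot (u v u' v' : H) :
  {ae mu, forall x, rep u x * (rep v x)^*%C = rep u' x * (rep v' x)^*%C} ->
  L2dot u v = L2dot u' v'.
Proof.
have mcj (a b : H) : cmeasurable (fun x => rep a x * (rep b x)^*%C).
  by apply: cmeasurableM; [|apply: cmeasurable_conj]; exact: cmeasurable_rep.
move=> E; have [m1 m2] := mcj u v; have [m3 m4] := mcj u' v'.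
rewrite /L2dot /cintegral; congr (_ +i* _).
- by apply: ae_eq_Rintegral m1 m3 _; apply: filterS E => x ->.
- by apply: ae_eq_Rintegral m2 m4 _; apply: filterS E => x ->.
Qed.

Lemma cmeasurable_real (p : T -> R) : measurable_fun setT p -> cmeasurable (fun x => (p x)%:C).
Proof. by move=> mp; split => //=; exact: measurable_cst. Qed.

Lemma measurable_funV (p : T -> R) : measurable_fun setT p -> (forall x, 0 <= p x) ->
  measurable_fun setT (fun x => (p x)^-1).
Proof.
move=> mp p0; rewrite (_ : (fun x => _) = (fun x => p x `^ (-1))).
  exact: (measurableT_comp (measurable_powR _) mp).
by apply/funext => x; rewrite powR_inv1.
Qed.

Lemma cmeasurable_inv (p : T -> R[i]) : cmeasurable p -> (forall x, p x != 0) ->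
  cmeasurable (fun x => (p x)^-1).
Proof.
move=> mp p0; rewrite (_ : (fun x => _) = (fun x => ((sqmod (p x))^-1)%:C * (p x)^*%C)).
  apply: cmeasurableM; last exact: cmeasurable_conj.
  apply: cmeasurable_real; apply: measurable_funV => [|x]; first exact: measurable_sqmod.
  exact: sqmod_ge0.
apply/funext => x; apply: (mulfI (p0 x)); rewrite divff//.
have := p0 x; case: (p x) => a b; rewrite eq_complex /= negb_and => ab.
have s0 : a ^+ 2 + b ^+ 2 != 0.
  by rewrite paddr_eq0 ?sqr_ge0// !sqrf_eq0 negb_and.
rewrite /sqmod/=; apply/eqP; rewrite eq_complex /=; apply/andP.
by split; apply/eqP; field.
Qed.

Lemma sq_integrable_le (c : R) (p : T -> R[i]) f : cmeasurable p -> f \in sq_integrable mu ->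
  {ae mu, forall x, sqmod (p x) <= c * sqmod (f x)} -> p \in sq_integrable mu.
Proof.
move=> mp /sq_integrableP[mf If] pf; apply/sq_integrableP; split => //.
have mEf : measurable_fun setT (fun x => (sqmod (f x))%:E).
  by apply/measurable_EFinP; exact: measurable_sqmod.
apply: (@le_lt_trans _ _ (\int[mu]_x (`|c|%:E * (sqmod (f x))%:E))%E).
  apply: ae_ge0_le_integral => //.
  - by move=> x _; rewrite lee_fin sqmod_ge0.
  - by apply/measurable_EFinP; exact: measurable_sqmod.
  - by move=> x _; rewrite mule_ge0// lee_fin ?sqmod_ge0.
  - exact: measurable_funeM.
  - apply: filterS pf => x px _; rewrite -EFinM lee_fin (le_trans px)//.
    by rewrite ler_wpM2r ?sqmod_ge0// ler_norm.
rewrite ge0_integralZl//; first by rewrite lte_mul_pinfty.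
by move=> x _; rewrite lee_fin sqmod_ge0.
Qed.

Lemma ae_sq_integrable (p : T -> R[i]) f : cmeasurable p -> f \in sq_integrable mu ->
  {ae mu, forall x, f x = p x} -> p \in sq_integrable mu.
Proof.
move=> mp sf fp; apply: (sq_integrable_le (c := 1) mp sf).
by apply: filterS fp => x ->; rewrite mul1r.
Qed.

Lemma N2_le_ae (c : R) g h : 0 <= c -> {ae mu, forall x, sqmod (rep g x) <= c * sqmod (rep h x)} ->
  N2 g <= c * N2 h.
Proof.
move=> c0 gh; rewrite -lee_fin EFinM -!N2E -ge0_integralZl//; last 2 first.
- exact: measurable_sqmod_rep.
- by move=> x _; rewrite lee_fin sqmod_ge0.
apply: ae_ge0_le_integral => //.
- by move=> x _; rewrite lee_fin sqmod_ge0.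
- exact: measurable_sqmod_rep.
- by move=> x _; rewrite mule_ge0// lee_fin ?sqmod_ge0.
- by apply: measurable_funeM; exact: measurable_sqmod_rep.
- by apply: filterS gh => x hx _; rewrite -EFinM lee_fin.
Qed.

Variable m : T -> R[i].
Hypothesis mm : cmeasurable m.
Local Notation A := (mul_op mu m).

Lemma rep_mul_op g : dom A g -> {ae mu, forall x, rep (A g) x = m x * rep g x}.
Proof. exact: rep_class. Qed.

Lemma cmeasurable_mul_rep g : cmeasurable (fun x => m x * rep g x).
Proof. by apply: cmeasurableM => //; exact: cmeasurable_rep. Qed.

Lemma mul_op_class f : f \in sq_integrable mu -> (fun x => m x * f x) \in sq_integrable mu ->
  dom A (L2class mu f).
Proof.
move=> sf smf; apply: (ae_sq_integrable (cmeasurable_mul_rep _) smf).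
by apply: filterS (rep_class sf) => x ->.
Qed.

Lemma mul_opZ l g : dom A g -> dom A (l *: g) /\ A (l *: g) = l *: A g.
Proof.
move=> dg; have dl : dom A (l *: g).
  apply: (sq_integrable_le (c := sqmod l) (cmeasurable_mul_rep _) dg).
  by apply: filterS (repZ l g) => x ->; rewrite mulrCA [leLHS]sqmodM.
split => //; apply: L2_ext.
apply: filterS3 (rep_mul_op dl) (repZ l g) (filterI (repZ l (A g)) (rep_mul_op dg)).
by move=> x -> -> [-> ->]; rewrite mulrCA.
Qed.

Lemma rep_mul_opB g l : dom A g ->
  {ae mu, forall x, rep (A g - l *: g) x = (m x - l) * rep g x}.
Proof.
move=> dg; apply: filterS3 (repB (A g) (l *: g)) (repZ l g) (rep_mul_op dg).
by move=> x -> -> ->; rewrite mulrBl.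
Qed.

Section BoundedBelow.
Variables (l : R[i]) (c : R).
Hypothesis c0 : 0 < c.
Hypothesis mc : forall x, c <= sqmod (m x - l).

Let ml_neq0 x : m x - l != 0.
Proof.
apply/eqP => e; have := mc x; rewrite e /sqmod/= expr0n/= addr0.
by rewrite leNgt c0.
Qed.

Lemma mul_op_lower_bound g : dom A g -> N2 g <= c^-1 * N2 (A g - l *: g).
Proof.
move=> dg; apply: N2_le_ae; first by rewrite invr_ge0 ltW.
apply: filterS (rep_mul_opB l dg) => x ->; rewrite sqmodM mulrA.
by rewrite ler_peMl ?sqmod_ge0// mulrC ler_pdivlMr// mul1r.
Qed.

Lemma mul_op_shift_bij : set_bij (dom A) setT (fun g => A g - l *: g).
Proof.
have inv_le x (t : R[i]) : sqmod ((m x - l)^-1 * t) <= c^-1 * sqmod t.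
  rewrite sqmodM ler_wpM2r ?sqmod_ge0//.
  have e : sqmod (m x - l)^-1 * sqmod (m x - l) = 1.
    by rewrite -sqmodM mulVf// /sqmod/= expr1n expr0n addr0.
  have s0 : 0 < sqmod (m x - l) by exact: lt_le_trans (mc x).
  rewrite -[sqmod (_^-1)]mulr1 -(divff (lt0r_neq0 s0)) mulrA e mul1r.
  by rewrite lef_pV2 ?posrE.
split => //.
- move=> g h /set_mem dg /set_mem dh /= E; apply: L2_ext.
  have := rep_mul_opB l dg; rewrite E => Eg.
  apply: filterS2 Eg (rep_mul_opB l dh) => x -> /(mulfI (ml_neq0 x)).
  exact.
- move=> h _; pose f x := (m x - l)^-1 * rep h x.
  have mf : cmeasurable f.
    apply: cmeasurableM; last exact: cmeasurable_rep.
    apply: cmeasurable_inv => //.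
    by apply: cmeasurableB => //; split; exact: measurable_cst.
  have sf : f \in sq_integrable mu.
    by apply: (sq_integrable_le (c := c^-1) mf (rep_sq h)); apply: aeW => x; exact: inv_le.
  have mfE x : m x * f x = l * f x + rep h x.
    by apply/eqP; rewrite addrC -subr_eq -mulrBl /f mulrA divff ?mul1r.
  (* Although [m] may be unbounded, [m f] is the sum of the square integrable functions [l f] and
     [h]; hence [f] lies in the domain. *)
  have smf : (fun x => m x * f x) \in sq_integrable mu.
    have -> : (fun x => m x * f x) = l *: f + rep h by apply/funext => x; exact: mfE.
    by apply: rpredD (rep_sq h); apply: rpredZ.
  have df := mul_op_class sf smf.
  exists (L2class mu f) => //; apply: L2_ext.
  apply: filterS2 (rep_mul_opB l df) (rep_class sf) => x -> ->.
  by rewrite /f mulrA divff ?mul1r.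
Qed.

End BoundedBelow.

(** The indicator of [E] is an approximate eigenvector: it only sees values of [m] close to [l]. On
    [E] the symbol is bounded, which puts the indicator in the domain. *)
Lemma mul_op_indic (E : set T) l (c : R) : measurable E -> (0 < mu E < +oo)%E ->
    (forall x, E x -> sqmod (m x - l) <= c) ->
  exists g, [/\ dom A g, 0 < N2 g & N2 (A g - l *: g) <= c * N2 g].
Proof.
move=> mE /andP[E0 Eoo] Ec; pose f x : R[i] := (\1_E x)%:C.
have mf : cmeasurable f by apply: cmeasurable_real; exact: measurable_indic.
have fE x : sqmod (f x) = \1_E x.
  by rewrite /sqmod /f/= expr0n addr0 indicE; case: (x \in E); rewrite ?expr1n ?expr0n.
have If : (\int[mu]_x (sqmod (f x))%:E = mu E)%E.
  by under eq_integral do rewrite fE; rewrite integral_indic// setIT.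
have sf : f \in sq_integrable mu by apply/sq_integrableP; rewrite If.
have [x0 Ex0] : exists x, E x.
  by apply: contrapT => /forallNP nE; move: E0; rewrite (_ : E = set0) ?measure0 ?ltxx//;
    rewrite -subset0 => x /nE.
have c0 : 0 <= c by exact: le_trans (sqmod_ge0 _) (Ec _ Ex0).
have smf : (fun x => m x * f x) \in sq_integrable mu.
  apply: (sq_integrable_le (c := 2 * (c + sqmod l)) (cmeasurableM mm mf) sf).
  apply: aeW => x; rewrite sqmodM; rewrite [sqmod (f x)]fE indicE.
  case: (boolP (x \in E)) => [/set_mem Ex|_]; last by rewrite !mulr0.
  rewrite !mulr1 -{1}(subrK l (m x)) (le_trans (sqmodD _ _))// ler_wpM2l// lerD2r.
  exact: Ec.
have dg := mul_op_class sf smf.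
exists (L2class mu f); split => //.
  rewrite -lte_fin; have -> // : (N2 (L2class mu f))%:E = mu E.
  exact: etrans (N2_class sf) If.
apply: N2_le_ae => //; apply: filterS2 (rep_mul_opB l dg) (rep_class sf) => x -> ->.
rewrite sqmodM [sqmod (f x)]fE indicE; case: (boolP (x \in E)) => [/set_mem Ex|_].
  by rewrite !mulr1 Ec.
by rewrite !mulr0.
Qed.

End MultiplicationOperator.

(** * The operator A*A of a multiplication operator *)

Section AdjointProduct.
Context d (T : measurableType d) (R : realType).
Variable mu : {measure set T -> \bar R}.
Local Notation H := (L2 mu).
Implicit Types (f : T -> R[i]) (g h z : H) (l : R[i]).
Variable rho : T -> R[i].
Hypothesis mrho : cmeasurable rho.
Local Notation A := (mul_op mu rho).

Definition sqmodC (x : T) : R[i] := (sqmod (rho x))%:C.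
Local Notation B := (mul_op mu sqmodC).

Lemma cmeasurable_sqmodC : cmeasurable sqmodC.
Proof. by apply: cmeasurable_real; exact: measurable_sqmod. Qed.

Lemma sqmod_sqmodC x : sqmod (sqmodC x) = sqmod (rho x) ^+ 2.
Proof. by rewrite {1}/sqmod /= expr0n addr0. Qed.

(** The defect [w = |rho|^2 g - z] may fail to be square integrable. Cut off to [E n], where
    [|rho|^2 < n], it becomes an admissible test function [f n]; testing the adjoint relation on it
    shows that [f n] has norm [0], and the sets [E n] cover the space. *)
Lemma adjoint_value_mul_op g z : dom A g -> is_adjoint_value A (A g) z ->
  {ae mu, forall x, rep z x = sqmodC x * rep g x}.
Proof.
move=> dg adj.
pose E n := [set x | sqmod (rho x) < n%:R].
have mE n : measurable (E n).
  rewrite (_ : E n = (fun x => sqmod (rho x)) @^-1` `]-oo, n%:R[).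
    rewrite -[X in measurable X]setTI; exact: measurable_sqmod.
  by apply/seteqP; split => x /=; rewrite in_itv.
pose w x := sqmodC x * rep g x - rep z x.
pose f n x := (\1_(E n) x)%:C * w x.
have mw : cmeasurable w.
  apply: cmeasurableB; last exact: cmeasurable_rep.
  by apply: cmeasurable_mul_rep; exact: cmeasurable_sqmodC.
have mf n : cmeasurable (f n).
  by apply: cmeasurableM => //; apply: cmeasurable_real; exact: measurable_indic.
have fE n x : f n x = if x \in E n then w x else 0.
  by rewrite /f indicE; case: ifP => _; rewrite ?mul1r ?mul0r.
have sq0 : sqmod (0 : R[i]) = 0 by rewrite /sqmod/= expr0n addr0.
have m1E n : cmeasurable (fun x => (\1_(E n) x)%:C : R[i]).
  by apply: cmeasurable_real; exact: measurable_indic.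
have sf n : f n \in sq_integrable mu.
  have -> : f n = (fun x => (\1_(E n) x)%:C * (sqmodC x * rep g x)) -
                  (fun x => (\1_(E n) x)%:C * rep z x).
    by apply/funext => x; exact: mulrBr.
  apply: rpredB.
    apply: (sq_integrable_le (c := n%:R ^+ 2) (cmeasurableM (m1E n)
      (cmeasurable_mul_rep cmeasurable_sqmodC g)) (rep_sq g)).
    apply: aeW => x; rewrite indicE; case: (boolP (x \in E n)) => [/set_mem/= En|_]; last first.
      by rewrite mul0r sq0 mulr_ge0 ?sqmod_ge0// exprn_ge0.
    rewrite mul1r sqmodM ler_wpM2r ?sqmod_ge0// {1}/sqmod/= expr0n/= addr0.
    by rewrite lerXn2r ?nnegrE ?sqmod_ge0 ?ler0n// ltW.
  apply: (sq_integrable_le (c := 1) (cmeasurableM (m1E n) (cmeasurable_rep z)) (rep_sq z)).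
  apply: aeW => x; rewrite indicE mul1r; case: (x \in E n); first by rewrite mul1r.
  by rewrite mul0r sq0 sqmod_ge0.
have srf n : (fun x => rho x * f n x) \in sq_integrable mu.
  apply: (sq_integrable_le (c := n%:R) (cmeasurableM mrho (mf n)) (sf n)).
  apply: aeW => x; rewrite sqmodM fE; case: ifPn => [/set_mem/= En|_].
    by rewrite ler_wpM2r ?sqmod_ge0// ltW.
  by rewrite sq0 !mulr0.
pose F n := L2class mu (f n).
have dF n : dom A (F n) by exact: mul_op_class.
have F0 n : N2 (F n) = 0.
  have := adj _ (dF n); rewrite !L2dotE => -[e _].
  (* The real part of the adjoint relation is enough: the two integrands differ pointwise by
     [sqmod (f n x)]. *)
  have e0 : rdot (A (F n)) (A g) - rdot (F n) z = 0 by rewrite e subrr.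
  rewrite -e0 /rdot -RintegralB//; try exact: integrable_rdot.
  apply: ae_eq_Rintegral.
  - by apply: measurable_sqmod; exact: cmeasurable_rep.
  - by apply: measurable_funB;
      exact: measurable_rdot_integrand (cmeasurable_rep _) (cmeasurable_rep _).
  - apply: filterS3 (rep_mul_op (dF n)) (rep_mul_op dg) (rep_class (sf n)) => x -> -> ->.
    rewrite fE; case: ifP => _; last first.
      by rewrite mulr0 /sqmod/= !mul0r expr0n/= !addr0 subrr.
    rewrite /w /sqmodC /sqmod.
    by case: (rho x) (rep g x) (rep z x) => [? ?] [? ?] [? ?] /=; ring.
have all0 : {ae mu, forall x, forall n, f n x = 0}.
  apply/ae_foralln => n.
  have E0 := L2_eq0 (F0 n).
  have r0 : {ae mu, forall x, rep (F n) x = 0}.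
    rewrite E0; have := repZ 0 (0 : H); rewrite scale0r.
    by apply: filterS => x ->; rewrite mul0r.
  by apply: filterS2 (rep_class (sf n)) r0 => x <-.
apply: filterS all0 => x fx0.
have [n _ /(_ n (leqnn n)) En] := nbhs_infty_gtr (sqmod (rho x)).
have := fx0 n; rewrite fE mem_set// /w => /eqP.
by rewrite subr_eq0 => /eqP.
Qed.

(** Because [|rho|^2 <= 1 + |rho|^4]. *)
Lemma dom_sqmodC_sub g : dom B g -> dom A g.
Proof.
move=> dB; apply/sq_integrableP; split; first exact: cmeasurable_mul_rep.
apply: le_lt_trans (_ : (\int[mu]_x ((sqmod (rep g x))%:E + (sqmod (sqmodC x * rep g x))%:E) < +oo)%E).
  have mB := cmeasurable_mul_rep cmeasurable_sqmodC g.
  apply: ge0_le_integral => //.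
  - by move=> x _; rewrite lee_fin sqmod_ge0.
  - by apply/measurable_EFinP; apply: measurable_sqmod; exact: cmeasurable_mul_rep.
  - apply: emeasurable_funD; first exact: measurable_sqmod_rep.
    by apply/measurable_EFinP; exact: measurable_sqmod.
  - move=> x _; rewrite -EFinD lee_fin [sqmod (rho x * _)]sqmodM [sqmod (sqmodC x * _)]sqmodM sqmod_sqmodC.
    rewrite -[X in _ <= X + _]mul1r -mulrDl ler_wpM2r ?sqmod_ge0//.
    by have := sqr_ge0 (sqmod (rho x) - 1); have := sqmod_ge0 (rho x); nra.
have i1 : mu.-integrable setT (fun x => (sqmod (rep g x))%:E + (sqmod (sqmodC x * rep g x))%:E)%E.
  apply: integrableD => //; first exact: integrable_sqmod (rep_sq g).
  exact: integrable_sqmod dB.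
by have /fin_numPlt/andP[_] := integrable_fin_num measurableT i1; exact.
Qed.

Lemma adjoint_value_sqmodC g : dom B g -> is_adjoint_value A (A g) (B g).
Proof.
move=> dB; have dA := dom_sqmodC_sub dB => f df.
apply: ae_eq_L2dot.
apply: filterS3 (rep_mul_op df) (rep_mul_op dA) (rep_mul_op dB) => x -> -> ->.
rewrite /sqmodC /sqmod; case: (rho x) (rep f x) (rep g x) => [? ?] [? ?] [? ?] /=.
by apply/eqP; rewrite eq_complex /=; apply/andP; split; apply/eqP; ring.
Qed.

Lemma adjoint_mul_op g : dom (comp_op (adjoint A) A) g <-> dom B g.
Proof.
split.
  move=> [dg [z adj]]; have E := adjoint_value_mul_op dg adj.
  apply: (ae_sq_integrable (cmeasurable_mul_rep cmeasurable_sqmodC g) (rep_sq z)).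
  exact: E.
by move=> dB; split; [exact: dom_sqmodC_sub|exists (B g); exact: adjoint_value_sqmodC].
Qed.

(** This stands in for density of the domain and makes the [xget] in [adjoint] a determined value at
    [A g]. *)
Lemma adjoint_value_unique g z z' : dom A g -> is_adjoint_value A (A g) z ->
  is_adjoint_value A (A g) z' -> z = z'.
Proof.
move=> dg /(adjoint_value_mul_op dg) Ez /(adjoint_value_mul_op dg) Ez'.
by apply: L2_ext; apply: filterS2 Ez Ez' => x -> ->.
Qed.

Lemma comp_adjoint_mul_op g : dom B g -> comp_op (adjoint A) A g = B g.
Proof.
move=> dB; have dA := dom_sqmodC_sub dB; have adj := adjoint_value_sqmodC dB.
have := xgetI (0 : H) adj; rewrite -/(op_fun (adjoint A) (A g)) => adj'.
exact: adjoint_value_unique dA adj' adj.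
Qed.

End AdjointProduct.

(** * Unitary equivalence *)

Section UnitaryEquivalence.
Context d d' (T : measurableType d) (T' : measurableType d') (R : realType).
Variables (mu : {measure set T -> \bar R}) (nu : {measure set T' -> \bar R}).
Local Notation H := (L2 mu).
Local Notation K := (L2 nu).
Variable U : H -> K.
Hypothesis unitaryU : unitary U.

Let UD : {morph U : u v / u + v}. Proof. by have [] := unitaryU. Qed.
Let UZ a : {morph U : u / a *: u}. Proof. by have [_ UZ _ _] := unitaryU; exact: UZ. Qed.
Let UN2 u : N2 (U u) = N2 u. Proof. by have [] := unitaryU. Qed.

Lemma unitaryB u v : U (u - v) = U u - U v.
Proof. by rewrite UD -scaleN1r UZ scaleN1r. Qed.

Lemma unitary_inj : injective U.
Proof.
move=> u v uv; apply/eqP; rewrite -subr_eq0; apply/eqP; apply: L2_eq0.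
by rewrite -UN2 unitaryB uv subrr -(scale0r (0 : K)) N2Z /sqmod/= expr0n addr0 mul0r.
Qed.

Lemma unitary_rdot u v : rdot (U u) (U v) = rdot u v.
Proof.
have := UN2 (u + v); rewrite UD !N2D !UN2 => /addrI.
by apply: mulfI.
Qed.

Lemma unitary_dot u v : L2dot (U u) (U v) = L2dot u v.
Proof. by rewrite !L2dotE -UZ !unitary_rdot. Qed.

(** The operators are compared on the domain only, since [op_fun] is meaningless outside it. *)
Definition similar (A : operator H H) (B : operator K K) : Prop :=
  (forall f, dom A f <-> dom B (U f)) /\ (forall f, dom A f -> U (A f) = B (U f)).

Lemma similar_shift_bij A B l : similar A B ->
  set_bij (dom A) setT (fun f => A f - l *: f) <->
  set_bij (dom B) setT (fun g => B g - l *: g).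
Proof.
move=> [dAB AB]; have [_ _ _ Usurj] := unitaryU.
have E f : dom A f -> U (A f - l *: f) = B (U f) - l *: U f.
  by move=> df; rewrite unitaryB UZ AB.
split=> -[_ inj surj]; split => //.
- move=> g g'; have [f <-] := Usurj g; have [f' <-] := Usurj g'.
  move=> /set_mem/dAB df /set_mem/dAB df' /=; rewrite -!E// => /unitary_inj e.
  by congr U; apply: inj => //; exact: mem_set.
- move=> k _; have [h <-] := Usurj k; have [f df <-] := surj h I.
  by exists (U f); [exact/dAB|rewrite E].
- move=> f f' /set_mem df /set_mem df' /= e; apply: unitary_inj; apply: inj.
  + exact/mem_set/dAB.
  + exact/mem_set/dAB.
  + by rewrite -!E// e.
- move=> h _; have [g dg e] := surj (U h) I; have [f fg] := Usurj g; subst g.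
  by have df := (dAB f).2 dg; exists f => //; apply: unitary_inj; rewrite E.
Qed.

Lemma similar_resolvent A B : similar A B -> resolvent_set A = resolvent_set B.
Proof.
move=> AB; have [dAB eAB] := AB; have [_ _ _ Usurj] := unitaryU.
have nU u : L2norm (U u) = L2norm u by rewrite !L2normE UN2.
apply/seteqP; split => l [bij [M HM]]; split; try exact/(similar_shift_bij l AB).
- exists M => g; have [f <-] := Usurj g => /dAB df.
  by rewrite -eAB// -UZ -unitaryB !nU; exact: HM.
- exists M => f df; rewrite -nU -[L2norm (A f - _)]nU unitaryB UZ eAB//.
  by apply: HM; exact/dAB.
Qed.

Lemma similar_adjoint_value A B h z : similar A B ->
  is_adjoint_value A h z <-> is_adjoint_value B (U h) (U z).
Proof.
move=> [dAB eAB]; have [_ _ _ Usurj] := unitaryU; split => adj.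
- move=> g; have [f <-] := Usurj g => /dAB df.
  by rewrite -eAB// !unitary_dot; exact: adj.
- move=> f df; rewrite -unitary_dot -[RHS]unitary_dot eAB//; apply: adj; exact/dAB.
Qed.

(** Each adjoint picks its own value by [xget], and [U] need not carry one pick to the other. Both
    are adjoint values for [B], so [uniq] identifies them. *)
Lemma similar_comp_adjoint A B : similar A B ->
  (forall g z z', dom B g -> is_adjoint_value B (B g) z ->
     is_adjoint_value B (B g) z' -> z = z') ->
  similar (comp_op (adjoint A) A) (comp_op (adjoint B) B).
Proof.
move=> AB uniq; have [dAB eAB] := AB; have [_ _ _ Usurj] := unitaryU.
have adjE f z : dom A f -> is_adjoint_value A (A f) z <->
    is_adjoint_value B (B (U f)) (U z).
  by move=> df; rewrite -eAB//; exact: similar_adjoint_value.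
split.
- move=> f; split => -[df [z adj]].
  + by split; [exact/dAB|exists (U z); apply/adjE].
  + have df' := (dAB f).2 df; split => //.
    by have [y yz] := Usurj z; exists y; apply/adjE => //; rewrite yz.
- move=> f [df [z adj]]; have a1 := xgetI (0 : H) adj.
  have /(adjE _ _ df) a2 := adj; have a3 := xgetI (0 : K) a2.
  have /(adjE _ _ df) a4 := a1.
  by apply: uniq a4 a3; exact/dAB.
Qed.

End UnitaryEquivalence.

Lemma unitary_id d (T : measurableType d) (R : realType)
    (mu : {measure set T -> \bar R}) : unitary (@idfun (L2 mu)).
Proof. by split => // w; exists w. Qed.

Lemma unitary_comp d1 d2 d3 (T1 : measurableType d1) (T2 : measurableType d2)
    (T3 : measurableType d3) (R : realType) (m1 : {measure set T1 -> \bar R})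
    (m2 : {measure set T2 -> \bar R}) (m3 : {measure set T3 -> \bar R})
    (V : L2 m2 -> L2 m3) (U : L2 m1 -> L2 m2) :
  unitary V -> unitary U -> unitary (V \o U).
Proof.
move=> [VD VZ VN Vs] [UD UZ UN Us]; split.
- by move=> u v /=; rewrite UD VD.
- by move=> a u /=; rewrite UZ VZ.
- by move=> u /=; rewrite VN UN.
- by move=> w; have [v <-] := Vs w; have [u <-] := Us v; exists u.
Qed.

(** * The Black-Scholes symbol *)

Section Symbol.
Variable R : realType.
Variables r sigma : R.
Hypotheses (r_gt0 : 0 < r) (sigma_gt0 : 0 < sigma).
Local Notation leb := (@lebesgue_measure R).
Local Notation RM := (measurableTypeR R).
Local Notation rho := (rho_0 r sigma : RM -> R[i]).
Local Notation A := (mul_op leb rho).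

Let P (k : R) : R := sqmod (rho_0 r sigma k).

Lemma sqmod_rho_0 k : P k = (2^-1 * sigma ^+ 2 * k ^+ 2 + r) ^+ 2 +
  ((r - 2^-1 * sigma ^+ 2) * k) ^+ 2.
Proof. by rewrite /P /sqmod /rho_0 /=; ring. Qed.

Lemma sqmod_rho_0_ge k : r ^+ 2 <= P k.
Proof.
have t0 : 0 <= 2^-1 * sigma ^+ 2 * k ^+ 2 by apply: mulr_ge0; rewrite ?sqr_ge0// mulr_ge0 ?invr_ge0 ?sqr_ge0//.
by rewrite sqmod_rho_0 ler_wpDr ?sqr_ge0// lerXn2r ?nnegrE ?addr_ge0 ?lerDr// ltW.
Qed.

Lemma continuous_sqmod_rho_0 : continuous P.
Proof.
rewrite (_ : P = fun k => (2^-1 * sigma ^+ 2 * (k * k) + r) * (2^-1 * sigma ^+ 2 * (k * k) + r) +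
  ((r - 2^-1 * sigma ^+ 2) * k) * ((r - 2^-1 * sigma ^+ 2) * k)); last first.
  by apply/funext => k; rewrite sqmod_rho_0 !expr2.
move=> k; have ck : (fun x : R => x) @ k --> k by exact: cvg_id.
have c1 : (fun k : R => 2^-1 * sigma ^+ 2 * (k * k) + r) @ k -->
    2^-1 * sigma ^+ 2 * (k * k) + r.
  by apply: cvgD; [apply: cvgM; [exact: cvg_cst|exact: cvgM]|exact: cvg_cst].
have c2 : (fun k : R => (r - 2^-1 * sigma ^+ 2) * k) @ k --> (r - 2^-1 * sigma ^+ 2) * k.
  by apply: cvgM => //; exact: cvg_cst.
exact: (cvgD (cvgM c1 c1) (cvgM c2 c2)).
Qed.

Lemma cmeasurable_rho_0 : cmeasurable rho.
Proof.
have mk : measurable_fun [set: RM] (fun k : RM => k : R) by exact: measurable_id.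
split => /=.
- apply: measurable_funB; last exact: measurable_cst.
  apply: measurable_funN; apply: measurable_funM; first exact: measurable_cst.
  exact: measurable_funX.
- by apply: measurable_funM => //; exact: measurable_cst.
Qed.

Lemma sqmod_rho_0_onto s : r ^+ 2 <= s -> exists k, P k = s.
Proof.
move=> rs; have s2 : 0 < sigma ^+ 2 by rewrite exprn_gt0.
(* The square in [sqmod_rho_0] dominates its cross term, so [P K >= sigma ^+ 2 * r * K ^+ 2];
   moreover [K ^+ 2 >= K - 1], which is [s / (sigma ^+ 2 * r)]. *)
pose K := 1 + s / (sigma ^+ 2 * r).
have sr0 : 0 <= s / (sigma ^+ 2 * r).
  apply: divr_ge0; first exact: le_trans (sqr_ge0 r) rs.
  by rewrite mulr_ge0 ?(ltW s2) ?(ltW r_gt0).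
have P0 : P 0 = r ^+ 2 by rewrite sqmod_rho_0; ring.
have PK : s <= P K.
  have sE : s = sigma ^+ 2 * r * (s / (sigma ^+ 2 * r)).
    by rewrite mulrC divfK// mulf_neq0// gt_eqF.
  rewrite sqmod_rho_0 ler_wpDr ?sqr_ge0// {1}sE.
  have KK : s / (sigma ^+ 2 * r) <= K ^+ 2.
    rewrite /K; move: (s / (sigma ^+ 2 * r)) sr0 => t t0.
    by rewrite expr2; nra.
  apply: (@le_trans _ _ (sigma ^+ 2 * r * K ^+ 2)).
    by rewrite ler_wpM2l// mulr_ge0 ?(ltW s2)// ltW.
  rewrite -subr_ge0 [leRHS](_ : _ = (2^-1 * sigma ^+ 2 * K ^+ 2) ^+ 2 + r ^+ 2).
    by rewrite addr_ge0// sqr_ge0.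
  by move: K {KK} => K; field.
have K0 : 0 <= K by rewrite addr_ge0.
have [||k _ kE] := @IVT _ P 0 K s K0.
- by apply: continuous_subspaceT; exact: continuous_sqmod_rho_0.
- rewrite P0 ge_min rs/= le_max PK orbT//.
- by exists k.
Qed.

Lemma near_interval (q : R -> R) (x0 c : R) : {for x0, continuous q} -> q x0 < c ->
  exists b, x0 < b /\ forall x, x0 <= x <= b -> q x <= c.
Proof.
move=> cq qc; have : \forall x \near x0, q x < c by exact: (cvgr_lt _ cq).
move=> /nbhs_ballP[e /= e0 He]; exists (x0 + e / 2); split.
  by rewrite ltrDl divr_gt0.
move=> x /andP[x0x xb]; apply: ltW; apply: He; rewrite /ball/= ltr_norml.
by apply/andP; split; lra.
Qed.

(** Continuity at one point keeps the symbol close to [l] on an interval of positive length, whose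
    indicator is the approximate eigenvector. *)
Lemma mul_op_near (m : RM -> R[i]) (l : R[i]) (x0 c : R) : cmeasurable m ->
  {for x0, continuous (fun x : R => sqmod (m x - l))} -> sqmod (m x0 - l) < c ->
  exists g, [/\ dom (mul_op leb m) g, 0 < N2 g & N2 (mul_op leb m g - l *: g) <= c * N2 g].
Proof.
move=> mm cm mc; have [b [x0b Hb]] := near_interval cm mc.
have E1 : (0 < leb [set` `[x0, b]] < +oo)%E.
  by rewrite lebesgue_measure_itv/= lte_fin x0b -EFinB lte_fin subr_gt0 x0b ltry.
apply: (mul_op_indic mm _ E1); first exact: measurable_itv.
by move=> x /=; rewrite in_itv/=; exact: Hb.
Qed.

Local Notation B := (mul_op leb (sqmodC rho)).

Lemma sqmod_real_sub (p a b : R) : sqmod (p%:C - (a +i* b)) = (p - a) ^+ 2 + b ^+ 2.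
Proof. by rewrite /sqmod/= sub0r sqrrN. Qed.

Lemma resolvent_set_sqmodC l : resolvent_set B l <-> ~ (exists2 s, r ^+ 2 <= s & l = s%:C).
Proof.
have mB := cmeasurable_sqmodC cmeasurable_rho_0.
split.
- move=> [_ [M HM]] [s rs lE]; have [k kE] := sqmod_rho_0_onto rs.
  (* Chosen so that [M ^+ 2 * c < 1]. The resolvent bound would then give
     [N2 g <= M ^+ 2 * c * N2 g < N2 g]. *)
  pose c := (M ^+ 2 + 1)^-1 / 2.
  have M1 : 0 < M ^+ 2 + 1 by rewrite ltr_wpDl// sqr_ge0.
  have c0 : 0 < c by rewrite divr_gt0// invr_gt0.
  have qE x : sqmod (sqmodC rho x - l) = (P x - s) * (P x - s).
    by rewrite lE sqmod_real_sub expr0n addr0 expr2.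
  have [||g [dg g0 Ng]] := @mul_op_near _ l k c mB.
  + rewrite (_ : (fun x => _) = (fun x => (P x - s) * (P x - s))); last first.
      by apply/funext => x; exact: qE.
    have c1 : (fun x => P x - s) @ k --> P k - s.
      by apply: cvgB; [exact: continuous_sqmod_rho_0|exact: cvg_cst].
    exact: cvgM.
  + by rewrite qE kE subrr mul0r.
  have := HM g dg; rewrite -ler_sqr ?nnegrE ?L2norm_ge0//; last first.
    by apply: le_trans (HM g dg); exact: L2norm_ge0.
  rewrite exprMn !sqr_L2norm leNgt => /negP; apply.
  apply: (le_lt_trans (ler_wpM2l (sqr_ge0 M) Ng)); rewrite mulrA.
  rewrite -[ltRHS]mul1r ltr_pM2r// /c mulrA ltr_pdivrMr// mul1r.
  rewrite ltr_pdivrMr//; have := sqr_ge0 M; lra.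
- move=> nl; case: l nl => a b nl.
  (* A lower bound for the squared distance from [l] to the range of the symbol: [b ^+ 2] off the
     real axis, [(r ^+ 2 - a) ^+ 2] for a real [a] below [r ^+ 2]. *)
  have [c c0 cP] : exists2 c, 0 < c & forall x, c <= sqmod (sqmodC rho x - (a +i* b)).
    have [b0|b0] := eqVneq b 0; last first.
      exists (b ^+ 2); first by rewrite exprn_even_gt0.
      by move=> x; rewrite sqmod_real_sub lerDr sqr_ge0.
    have ar : a < r ^+ 2.
      by rewrite ltNge; apply/negP => ra; apply: nl; exists a => //; rewrite b0.
    exists ((r ^+ 2 - a) ^+ 2); first by rewrite exprn_gt0// subr_gt0.
    move=> x; rewrite sqmod_real_sub ler_wpDr ?sqr_ge0//.
    have := sqmod_rho_0_ge x => Px.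
    by rewrite lerXn2r ?nnegrE ?subr_ge0 ?(ltW ar) ?lerD2r// (le_trans (ltW ar)).
  split; first exact: mul_op_shift_bij c0 cP.
  exists (Num.sqrt c^-1) => g dg; rewrite !L2normE -sqrtrM ?invr_ge0 ?(ltW c0)//.
  rewrite ler_sqrt ?mulr_ge0 ?N2_ge0 ?invr_ge0 ?(ltW c0)//.
  exact: (mul_op_lower_bound c0 cP dg).
Qed.

Lemma spectrum_comp_adjoint_rho_0 l :
  spectrum (comp_op (adjoint A) A) l <-> exists2 s, r ^+ 2 <= s & l = s%:C.
Proof.
have mr := cmeasurable_rho_0.
(* The two operators agree on a common domain but need not be equal as records; similarity through
   the identity is enough to compare their spectra. *)
have S : similar idfun (comp_op (adjoint A) A) B.
  split; first by move=> f; exact: adjoint_mul_op.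
  by move=> f /(adjoint_mul_op mr) dB; exact: comp_adjoint_mul_op.
rewrite /spectrum (similar_resolvent (unitary_id leb) S) /setC /=.
split; first by move=> h; apply: contrapT => h'; apply: h; exact/resolvent_set_sqmodC.
by move=> h /resolvent_set_sqmodC.
Qed.

End Symbol.

(** Surjectivity makes the pseudo-inverses right inverses, so that [F \o Q] undoes the
    conjugation. *)
Lemma similar_pinv d1 d2 d3 (T1 : measurableType d1) (T2 : measurableType d2)
    (T3 : measurableType d3) (R : realType) (m1 : {measure set T1 -> \bar R})
    (m2 : {measure set T2 -> \bar R}) (m3 : {measure set T3 -> \bar R})
    (F : L2 m2 -> L2 m3) (Q : L2 m1 -> L2 m2) (B : operator (L2 m3) (L2 m3)) :
  unitary F -> unitary Q ->
  similar (F \o Q) (Operator [set f | dom B (F (Q f))]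
    (fun f => 'pinv_(fun=> 0) setT Q ('pinv_(fun=> 0) setT F (B (F (Q f)))))) B.
Proof.
move=> [_ _ _ Fs] [_ _ _ Qs].
have invF w : F ('pinv_(fun=> 0) setT F w) = w.
  by apply: pinvK; apply/mem_set; have [u uw] := Fs w; exists u.
have invQ w : Q ('pinv_(fun=> 0) setT Q w) = w.
  by apply: pinvK; apply/mem_set; have [u uw] := Qs w; exists u.
by split => // f _ /=; rewrite invQ invF.
Qed.

(** * Consequences for an operator unitarily equivalent to the symbol *)

Section SimilarToSymbol.
Context d (T : measurableType d) (R : realType).
Variable mu : {measure set T -> \bar R}.
Variables r sigma : R.
Hypotheses (r_gt0 : 0 < r) (sigma_gt0 : 0 < sigma).
Local Notation leb := (@lebesgue_measure R).
Local Notation RM := (measurableTypeR R).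
Local Notation rho := (rho_0 r sigma : RM -> R[i]).
Local Notation T_rho := (mul_op leb rho).
Local Notation H := (L2 mu).
Variables (U : H -> L2 leb) (A : operator H H).
Hypotheses (unitaryU : unitary U) (A_similar : similar U A T_rho).

Let UA f : dom A f -> U (A f) = T_rho (U f).
Proof. exact: A_similar.2. Qed.

Let rho_ge (x : RM) : r ^+ 2 <= sqmod (rho x - 0).
Proof. by rewrite subr0; exact: sqmod_rho_0_ge. Qed.

Let r2_gt0 : 0 < r ^+ 2. Proof. exact: exprn_gt0. Qed.

Lemma similar_rho_0_bij : set_bij (dom A) setT A.
Proof.
have := (similar_shift_bij unitaryU 0 A_similar).2
  (mul_op_shift_bij leb (cmeasurable_rho_0 r sigma) r2_gt0 rho_ge).
by rewrite (_ : (fun f => _) = op_fun A)//; apply/funext => f; rewrite scale0r subr0.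
Qed.

Lemma similar_rho_0_lower_bound f : dom A f -> r * L2norm f <= L2norm (A f).
Proof.
move=> df; have [_ _ UN _] := unitaryU.
have := mul_op_lower_bound r2_gt0 rho_ge ((A_similar.1 f).1 df).
rewrite scale0r subr0 -(UA df) => h0.
move: h0; rewrite !UN mulrC ler_pdivlMr// => h.
rewrite -ler_sqr ?nnegrE ?mulr_ge0 ?L2norm_ge0 ?(ltW r_gt0)//.
by rewrite exprMn !sqr_L2norm mulrC.
Qed.

Lemma similar_rho_0_scale a f : dom A f -> dom A (a *: f) /\ A (a *: f) = a *: A f.
Proof.
move=> df; have [_ UZ _ _] := unitaryU.
have [dT TZ] := mul_opZ (cmeasurable_rho_0 r sigma) a ((A_similar.1 f).1 df).
split; first by apply/(A_similar.1 _).2; rewrite UZ.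
by apply: (unitary_inj unitaryU); rewrite UA ?UZ ?UA//; apply/(A_similar.1 _).2; rewrite UZ.
Qed.

Lemma similar_rho_0_near (c : R) : r ^+ 2 < c ->
  exists f, [/\ dom A f, 0 < N2 f & N2 (A f) <= c * N2 f].
Proof.
move=> rc; have [_ _ UN Us] := unitaryU.
have e : (fun x : R => sqmod (rho x - 0)) = (fun x : R => sqmod (rho_0 r sigma x)).
  by apply/funext => x; rewrite subr0.
(* The first [0] is the spectral parameter, the second the frequency, where [|rho|^2] takes its
   minimum [r ^+ 2]. *)
have [||g [dg g0 Ng]] := @mul_op_near R rho 0 0 c (cmeasurable_rho_0 r sigma).
- by rewrite e; exact: continuous_sqmod_rho_0.
- by rewrite subr0 sqmod_rho_0 [ltLHS](_ : _ = r ^+ 2)//; ring.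
have [f fg] := Us g.
have df : dom A f by apply/(A_similar.1 _).2; rewrite fg.
exists f; rewrite -!UN (UA df) fg; split => //.
by move: Ng; rewrite scale0r subr0.
Qed.

Lemma similar_rho_0_singular_values : singular_values A = [set s%:C%C | s in `[r, +oo[].
Proof.
have S := similar_comp_adjoint unitaryU A_similar
  (adjoint_value_unique (cmeasurable_rho_0 r sigma)).
have spec l : spectrum (comp_op (adjoint A) A) l <->
    exists2 s, r ^+ 2 <= s & l = s%:C.
  rewrite -(spectrum_comp_adjoint_rho_0 r_gt0 sigma_gt0) /spectrum.
  by rewrite (similar_resolvent unitaryU S).
(* On squares of nonnegative reals the complex root is the real one, so it carries [[r^2, +oo[] onto
   [[r, +oo[]. *)
have sqrtE (s : R) : 0 <= s -> sqrtC ((s ^+ 2)%:C) = s%:C.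
  by move=> s0; rewrite rmorphXn /= sqrCK// lecR.
apply/seteqP; split => z /=.
- move=> [l /spec[s rs ->] <-]; exists (Num.sqrt s).
    rewrite in_itv/= andbT -(ger0_norm (ltW r_gt0)) -sqrtr_sqr ler_sqrt//.
    exact: le_trans (sqr_ge0 r) rs.
  by rewrite -sqrtE ?sqrtr_ge0// sqr_sqrtr// (le_trans _ rs)// sqr_ge0.
- move=> [s]; rewrite in_itv/= andbT => rs <-.
  have s0 : 0 <= s by exact: le_trans (ltW r_gt0) rs.
  exists ((s ^+ 2)%:C); last exact: sqrtE.
  by apply/spec; exists (s ^+ 2) => //; rewrite lerXn2r ?nnegrE ?(ltW r_gt0).
Qed.

(** The upper bound is [similar_rho_0_lower_bound] read backwards. For the lower bound, vectors
    concentrated near frequency [0] almost attain it, and their normalized images under [A] are the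
    test vectors. *)
Lemma similar_rho_0_inverse_norm : opnorm (inverse_op A) = (r^-1)%:E.
Proof.
have [_ inj surj] := similar_rho_0_bij.
apply/eqP; rewrite eq_le; apply/andP; split.
- apply: ge_ereal_sup => _ [u /= u1 <-]; rewrite lee_fin.
  have [f df fu] := surj u I.
  have -> : inverse_op A u = f by rewrite -fu; apply: pinvKV inj _ (mem_set df).
  rewrite -[leRHS]mulr1 mulrC ler_pdivlMr// mulrC.
  by apply: le_trans (similar_rho_0_lower_bound df) _; rewrite fu.
- apply/lee_addgt0Pr => e e0; rewrite -leeBlDr// -EFinB.
  (* With this choice [c * (r^-1 - e) = 1 - (r * e) ^+ 2 <= 1], so a vector with
     [L2norm (A f) <= c * L2norm f] yields a ratio of at least [r^-1 - e]. *)
  pose c := r * (1 + r * e); have re : 0 < r * e by rewrite mulr_gt0.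
  have rc : r < c by rewrite /c mulrDr mulr1 ltrDl mulr_gt0.
  have c0 : 0 < c by exact: lt_trans rc.
  have [|f [df f0 Nf]] := @similar_rho_0_near (c ^+ 2).
    by rewrite ltrXn2r ?nnegrE ?ltW.
  have f1 : 0 < L2norm f by rewrite L2normE sqrtr_gt0.
  have Af0 : 0 < L2norm (A f).
    by apply: lt_le_trans (similar_rho_0_lower_bound df); rewrite mulr_gt0.
  have Afc : L2norm (A f) <= c * L2norm f.
    have cf0 : 0 <= c * L2norm f := mulr_ge0 (ltW c0) (L2norm_ge0 f).
    rewrite -ler_sqr ?nnegrE ?cf0 ?L2norm_ge0//.
    by rewrite exprMn !sqr_L2norm.
  have [dg Ag] := similar_rho_0_scale ((L2norm (A f))^-1)%:C df.
  have nZ (t : R) (u : H) : 0 <= t -> L2norm (t%:C *: u) = t * L2norm u.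
    move=> t0; rewrite L2normZ; congr (_ * _).
    by rewrite /sqmod/= expr0n addr0 sqrtr_sqr ger0_norm.
  have i0 : 0 <= (L2norm (A f))^-1 by rewrite invr_ge0 ltW.
  apply: le_ereal_sup_tmp.
  exists (L2norm (inverse_op A (((L2norm (A f))^-1)%:C *: A f)))%:E.
    exists (((L2norm (A f))^-1)%:C *: A f) => //=.
    by rewrite nZ// mulVf// gt_eqF.
  rewrite -Ag [inverse_op _ _](_ : _ = ((L2norm (A f))^-1)%:C *: f); last first.
    exact: pinvKV inj _ (mem_set dg).
  rewrite lee_fin nZ// ler_pdivlMl//.
  (* A negative [r^-1 - e] makes the bound immediate; otherwise [Afc] may be multiplied by it. *)
  have [re0|re0] := leP 0 (r^-1 - e); last first.
    by apply: le_trans (L2norm_ge0 f); rewrite mulr_ge0_le0// ltW.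
  apply: le_trans (ler_wpM2r re0 Afc) _; rewrite mulrAC ler_piMl ?(ltW f1)//.
  rewrite (_ : c * _ = 1 - (r * e) ^+ 2); last by rewrite /c; field; rewrite gt_eqF.
  by rewrite gerBl sqr_ge0.
Qed.

End SimilarToSymbol.

Lemma similar_A_0 (R : realType) (r sigma : R) :
  similar (@fourier R \o @Q_0 R) (A_0 r sigma)
    (mul_op (@lebesgue_measure R) (rho_0 r sigma : measurableTypeR R -> R[i])).
Proof.
exact: (similar_pinv (mul_op (@lebesgue_measure R)
  (rho_0 r sigma : measurableTypeR R -> R[i])) (@fourier_unitary R) (@Q_0_unitary R)).
Qed.

Theorem proposition9p3 (R : realType) (r sigma : R)
    (r_gt0 : 0 < r) (sigma_gt0 : 0 < sigma) :
  [/\ set_bij (dom (A_0 r sigma)) [set: H_0 R] (A_0 r sigma),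
      singular_values (A_0 r sigma) = [set s%:C%C | s in `[r, +oo[] &
      opnorm (inverse_op (A_0 r sigma)) = (r^-1)%:E].
Proof.
have unitaryU := unitary_comp (@fourier_unitary R) (@Q_0_unitary R).
have A_similar := similar_A_0 r sigma.
split.
- exact: (similar_rho_0_bij r_gt0 unitaryU A_similar).
- exact: (similar_rho_0_singular_values r_gt0 sigma_gt0 unitaryU A_similar).
- exact: (similar_rho_0_inverse_norm r_gt0 unitaryU A_similar).
Qed.
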